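(* For every $K>0$ there exist constants $c,C>0$ depending only on $K$ such that the following holds. Let $d\ge1$, let $\pi$ be the standard Gaussian $\mathcal N(0,I_d)$ on $\mathbb R^d$, and let $h=c\,d^{-1/3}$. Let $\mu_0$ be $M_0$-warm with respect to $\pi$, let $0<\varepsilon<M_0$, and suppose that $\log\frac{M_0}{\varepsilon h}\le K\,d^{1/3}$. Then the mixing time of MALA with target $\pi$, step size $h$ and initial distribution $\mu_0$ satisfies $$\tau_{\rm mix}(\varepsilon,\mu_0;\mathrm{TV})\le C\,d^{1/3}\log\Bigl(\frac{M_0}{\varepsilon}\Bigr).$$
   Context: MALA with target $\pi=\mathcal N(0,I_d)$ and step size $h>0$: the proposal kernel $Q(x,\cdot)$ is the Gaussian $\mathcal N((1-h)x,2hI_d)$ with density $Q(x,y)$ (i.e. the potential is $V(x)=\|x\|^2/2$); acceptance probability $A(x,y)=\min\bigl\{1,\frac{\pi(y)Q(y,x)}{\pi(x)Q(x,y)}\bigr\}$; the MALA kernel is $T(x,B)=\int_BQ(x,y)A(x,y)\,dy+\mathbf 1_B(x)\bigl(1-\int_{\mathbb R^d}Q(x,y)A(x,y)\,dy\bigr)$. Let $\mu_n$ be the law of the $n$-th iterate started from $\mu_0$. $\mu_0$ is $M_0$-warm with respect to $\pi$ if $\mu_0(E)\le M_0\,\pi(E)$ for every Borel set $E$. The mixing time is $\tau_{\rm mix}(\varepsilon,\mu_0;\mathrm{TV})=\inf\{n\in\mathbb N:\|\mu_n-\pi\|_{\rm TV}\le\varepsilon\}$ with $\mathbb N=\{0,1,2,\dots\}$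 and $\|\mu-\nu\|_{\rm TV}=\sup_B|\mu(B)-\nu(B)|$. *)

(* Defs.v *)
From HB Require Import structures.
From mathcomp Require Import all_boot all_order all_algebra.
From mathcomp Require Import all_classical all_reals all_analysis.
From mathcomp Require Import measurable_realfun.

Set Implicit Arguments.
Unset Strict Implicit.
Unset Printing Implicit Defensive.

Import Order.TTheory GRing.Theory Num.Theory.
Import numFieldNormedType.Exports.

Local Open Scope classical_set_scope.
Local Open Scope ring_scope.

(* R^d. The library's sigma-algebra on tuples is generated by the coordinate
   maps, so its measurable sets are the Borel sets of R^d. *)
Notation Rd R d := (d.-tuple (measurableTypeR R)).

Definition consRd (R : realType) (d : nat)
    (p : measurableTypeR R * Rd R d) : Rd R d.+1 :=
  [tuple of p.1 :: p.2].

Lemma measurable_consRd (R : realType) (d : nat) :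
  measurable_fun setT (@consRd R d).
Proof. by apply: measurable_cons. Qed.

(* d-dimensional Lebesgue measure, as the iterated product of d copies of the
   one-dimensional one transported to tuples. *)
Fixpoint lebesgue_Rd (R : realType) (d : nat) : set (Rd R d) -> \bar R :=
  match d with
  | 0%N => dirac [tuple]
  | n.+1 => pushforward (lebesgue_measure \x @lebesgue_Rd R n)%E (@consRd R n)
  end.

Section lebesgue_Rd_measure.
Context (R : realType).

Let unconsRd d (t : Rd R d.+1) : measurableTypeR R * Rd R d :=
  (thead t, [tuple of behead t]).

Let consRdK d : cancel (@consRd R d) (@unconsRd d).
Proof.
by case=> x t; rewrite /unconsRd /consRd theadE; congr pair; apply/val_inj.
Qed.

Let unconsRdK d : cancel (@unconsRd d) (@consRd R d).
Proof. by move=> t; rewrite /consRd [RHS]tuple_eta. Qed.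

Let measurable_unconsRd d : measurable_fun setT (@unconsRd d).
Proof.
apply: measurable_fun_pair; last exact: measurable_behead.
exact: measurable_tnth.
Qed.

Lemma lebesgue_Rd_exists d :
  exists m : {sigma_finite_measure set (Rd R d) -> \bar R},
    @lebesgue_Rd R d = m.
Proof.
elim: d => [|d [m IH]]; first by exists (dirac [tuple]).
have mf := @measurable_consRd R d.
pose p : {measure set (measurableTypeR R * Rd R d)%type -> \bar R} :=
  (lebesgue_measure \x m)%E.
pose mu : {measure set _ -> \bar R} :=
  @measure_function_pushforward__canonical__measure_function_Measure
    _ _ _ _ R p (@consRd R d) mf.
have sf : sigma_finite setT mu.
  have [F TF Ff] : sigma_finite setT p.
    have /sigma_finiteP[F [TF ndF Foo]] := sigma_finiteT (@lebesgue_measure R).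
    have /sigma_finiteP[G [TG ndG Goo]] := sigma_finiteT m.
    exists (fun n => F n `*` G n).
      rewrite -setXTT TF TG predeqE => -[x y]; split.
        move=> [/= [n _ Fnx] [k _ Gky]]; exists (maxn n k) => //; split.
        - by move: x Fnx; exact/subsetPset/ndF/leq_maxl.
        - by move: y Gky; exact/subsetPset/ndG/leq_maxr.
      by move=> [n _ []/= ? ?]; split; exists n.
    move=> k; have [? ?] := Foo k; have [? ?] := Goo k.
    split; first exact: measurableX.
    by rewrite /p /= product_measure1E// lte_mul_pinfty// ge0_fin_numE.
  exists (fun n => (@unconsRd d) @^-1` F n).
    by rewrite -preimage_bigcup -TF preimage_setT.
  move=> n; have [mF Fn] := Ff n; split.
    by rewrite -[X in measurable X]setTI; exact: measurable_unconsRd.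
  rewrite /mu /= /pushforward -comp_preimage.
  rewrite [X in X @^-1` _](_ : _ = id) ?preimage_id//.
  by apply/funext => x; exact: consRdK.
pose S := Measure_isSigmaFinite.Build _ _ _ mu sf.
pose mu' : {sigma_finite_measure set (Rd R d.+1) -> \bar R} :=
  HB.pack (Measure.sort mu) (Measure.class mu) S.
by exists mu'; rewrite /= IH.
Qed.

Variable d : nat.

Let lebesgue_Rd0 : @lebesgue_Rd R d set0 = 0%E.
Proof. by have [m ->] := lebesgue_Rd_exists d. Qed.

Let lebesgue_Rd_ge0 A : (0 <= @lebesgue_Rd R d A)%E.
Proof. by have [m ->] := lebesgue_Rd_exists d. Qed.

Let lebesgue_Rd_sigma_additive : semi_sigma_additive (@lebesgue_Rd R d).
Proof.
have [m ->] := lebesgue_Rd_exists d; exact: measure_semi_sigma_additive.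
Qed.

HB.instance Definition _ := isMeasure.Build _ _ _ (@lebesgue_Rd R d)
  lebesgue_Rd0 lebesgue_Rd_ge0 lebesgue_Rd_sigma_additive.

Let lebesgue_Rd_sigma_finite : sigma_finite setT (@lebesgue_Rd R d).
Proof. have [m ->] := lebesgue_Rd_exists d; exact: sigma_finiteT. Qed.

HB.instance Definition _ := Measure_isSigmaFinite.Build _ _ _
  (@lebesgue_Rd R d) lebesgue_Rd_sigma_finite.

End lebesgue_Rd_measure.

Lemma lebesgue_Rd_box (R : realType) (d : nat)
    (A : 'I_d -> set (measurableTypeR R)) :
  (forall i, measurable (A i)) ->
  @lebesgue_Rd R d [set x | forall i, A i (tnth x i)] =
  (\prod_(i < d) lebesgue_measure (A i))%E.
Proof.
elim: d A => [|d IH] A mA.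
  rewrite big_ord0 /= diracE mem_set//.
  by case.
rewrite big_ord_recl -IH//= /pushforward -product_measure1E//.
- congr (_ _); apply/seteqP; split => [[x t] /= xtA|[x t] /= [Ax At] i].
    by split => [|i]; [have := xtA ord0|have := xtA (lift ord0 i)];
      rewrite /consRd ?tnthS ?tnth0.
  by rewrite /consRd; case: (unliftP ord0 i) => [j ->|->]; rewrite ?tnthS ?tnth0.
- rewrite (_ : mkset _ =
      \bigcap_(i in setT) (fun x : Rd R d => tnth x i) @^-1` A (lift ord0 i)).
    apply: fin_bigcap_measurable; first exact: finite_finset.
    by move=> i _; rewrite -[X in measurable X]setTI; apply: measurable_tnth.
  by apply/seteqP; split => x xA i; [move=> _; exact: xA|exact: (xA i I)].
Qed.

Lemma ge0_integral_lebesgue_Rd_prod (R : realType) (d : nat)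
    (f : 'I_d -> measurableTypeR R -> R) :
  (forall i, measurable_fun setT (f i)) -> (forall i x, 0 <= f i x) ->
  (\int[@lebesgue_Rd R d]_x (\prod_(i < d) f i (tnth x i))%:E =
   \prod_(i < d) \int[lebesgue_measure]_x (f i x)%:E)%E.
Proof.
have mprod n (g : 'I_n -> measurableTypeR R -> R) :
    (forall i, measurable_fun setT (g i)) ->
    measurable_fun setT (fun x : Rd R n => (\prod_(i < n) g i (tnth x i))%:E).
  move=> mg; apply/measurable_EFinP; apply: measurable_prod => i _.
  by apply: measurableT_comp => //; exact: measurable_tnth.
elim: d f => [|d IH] f mf f0.
  rewrite big_ord0; under eq_integral do rewrite big_ord0.
  by rewrite integral_cst//= diracT mule1.
have gE (x : measurableTypeR R) (t : Rd R d) :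
    \prod_(i < d.+1) f i (tnth (consRd (x, t)) i) =
    f ord0 x * \prod_(i < d) f (lift ord0 i) (tnth t i).
  rewrite big_ord_recl /consRd tnth0; congr (_ * _).
  by apply: eq_bigr => i _; rewrite tnthS.
rewrite /= ge0_integral_pushforward//=; last 3 first.
- exact: measurable_consRd.
- exact: mprod.
- by move=> x _; rewrite lee_fin; apply: prodr_ge0.
rewrite preimage_setT fubini_tonelli1//=; last 2 first.
- apply: (@measurableT_comp _ _ _ _ _ _
    (fun x => (\prod_(i < d.+1) f i (tnth x i))%:E)).
    exact: mprod.
  exact: measurable_consRd.
- by move=> x; rewrite lee_fin; apply: prodr_ge0.
rewrite /fubini_F /=.
under eq_integral => x _.
  under eq_integral => t _ do rewrite gE EFinM.
  rewrite ge0_integralZl//=; last 3 first.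
  - by apply: (mprod d (fun i => f (lift ord0 i))) => i; exact: mf.
  - by move=> t _; rewrite lee_fin prodr_ge0.
  - by rewrite lee_fin.
  rewrite (IH (fun i => f (lift ord0 i)))//.
  over.
rewrite ge0_integralZr//=.
- by rewrite big_ord_recl.
- exact/measurable_EFinP.
- by move=> x _; rewrite lee_fin.
- by apply: prode_ge0 => i _; apply: integral_ge0 => x _; rewrite lee_fin.
Qed.

Section gaussian.
Context (R : realType).

Definition sqdist_Rd (d : nat) (x y : Rd R d) : R :=
  \sum_(i < d) (tnth x i - tnth y i) ^+ 2.

(* density of N(m, v I_d) with respect to Lebesgue measure, for v > 0 *)
Definition gaussian_pdf (d : nat) (m : Rd R d) (v : R) (x : Rd R d) : R :=
  (2 * pi * v) `^ (- (d%:R / 2)) * expR (- (sqdist_Rd x m / (2 * v))).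

Lemma gaussian_pdf_prod d (m : Rd R d) v x : 0 < v ->
  gaussian_pdf m v x =
  \prod_(i < d) normal_pdf (tnth m i) (Num.sqrt v) (tnth x i).
Proof.
move=> v0; have sv0 : Num.sqrt v != 0 by rewrite gt_eqF// sqrtr_gt0.
under eq_bigr => i _ do rewrite normal_pdfE//.
rewrite big_split /= prodr_const card_ord /gaussian_pdf; congr (_ * _).
  rewrite /normal_peak sqr_sqrtr ?ltW// powRN exprVn; congr (_^-1).
  rewrite -[v * pi *+ 2]mulr_natl [v * pi]mulrC mulrA -powR12_sqrt; last first.
    by rewrite !mulr_ge0 ?pi_ge0 ?ltW.
  by rewrite -powR_mulrn ?powR_ge0// -powRrM [2^-1 * _]mulrC.
rewrite /normal_fun -expR_sum sqr_sqrtr ?ltW//; congr expR.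
rewrite mulr_suml -sumrN; apply: eq_bigr => i _.
by rewrite -[v *+ 2]mulr_natl mulNr.
Qed.

Lemma gaussian_pdf_ge0 d (m : Rd R d) v x : 0 <= gaussian_pdf m v x.
Proof. by rewrite mulr_ge0 ?powR_ge0 ?expR_ge0. Qed.

Lemma measurable_gaussian_pdf d (m : Rd R d) v :
  measurable_fun setT (gaussian_pdf m v).
Proof.
apply: measurable_funM => //; apply: measurableT_comp => //.
apply: measurableT_comp => //; apply: measurable_funM => //.
apply: measurable_sum => i; apply: measurable_funX.
by apply: measurable_funB => //; exact: measurable_tnth.
Qed.

Lemma integral_gaussian_pdf d (m : Rd R d) v : 0 < v ->
  (\int[@lebesgue_Rd R d]_x (gaussian_pdf m v x)%:E = 1)%E.
Proof.
move=> v0; under eq_integral do rewrite gaussian_pdf_prod//.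
rewrite (@ge0_integral_lebesgue_Rd_prod _ _
  (fun i => normal_pdf (tnth m i) (Num.sqrt v))).
- by rewrite big1// => i _; exact: integral_normal_pdf.
- by move=> i; exact: measurable_normal_pdf.
- by move=> i x; exact: normal_pdf_ge0.
Qed.

Definition std_gaussian_pdf (d : nat) (x : Rd R d) : R :=
  gaussian_pdf [tuple 0 | i < d] 1 x.

Definition std_gaussian (d : nat) (A : set (Rd R d)) : \bar R :=
  (\int[@lebesgue_Rd R d]_(x in A) (std_gaussian_pdf x)%:E)%E.

Section std_gaussian_probability.
Variable d : nat.

Let std_gaussian0 : @std_gaussian d set0 = 0%E.
Proof. exact: integral_set0. Qed.

Let std_gaussian_ge0 A : (0 <= @std_gaussian d A)%E.
Proof. by apply: integral_ge0 => x _; rewrite lee_fin gaussian_pdf_ge0. Qed.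

Let std_gaussian_sigma_additive : semi_sigma_additive (@std_gaussian d).
Proof.
move=> F mF tF mUF; rewrite /std_gaussian ge0_integral_bigcup//=.
- apply: is_cvg_ereal_nneg_natsum_cond => n _ _.
  exact: std_gaussian_ge0.
- apply/measurable_EFinP; apply: measurable_funTS.
  exact: measurable_gaussian_pdf.
- by move=> x _; rewrite lee_fin gaussian_pdf_ge0.
Qed.

HB.instance Definition _ := isMeasure.Build _ _ _ (@std_gaussian d)
  std_gaussian0 std_gaussian_ge0 std_gaussian_sigma_additive.

Let std_gaussian_setT : @std_gaussian d setT = 1%E.
Proof. exact: integral_gaussian_pdf. Qed.

HB.instance Definition _ :=
  @Measure_isProbability.Build _ _ R (@std_gaussian d) std_gaussian_setT.

End std_gaussian_probability.

End gaussian.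

Section mala.
Context (R : realType) (d : nat) (h : R).
Implicit Types (x y : Rd R d) (B : set (Rd R d)).

(* x - h * grad V(x) for the potential V(x) = |x|^2 / 2 *)
Definition mala_proposal_mean x : Rd R d := [tuple (1 - h) * tnth x i | i < d].

Definition mala_proposal_pdf x y : R :=
  gaussian_pdf (mala_proposal_mean x) (2 * h) y.

Definition mala_accept x y : R :=
  Num.min 1 (std_gaussian_pdf y * mala_proposal_pdf y x /
             (std_gaussian_pdf x * mala_proposal_pdf x y)).

Definition mala_kernel x B : \bar R :=
  (\int[@lebesgue_Rd R d]_(y in B) (mala_proposal_pdf x y * mala_accept x y)%:E
   + (\1_B x)%:E *
     (1 - \int[@lebesgue_Rd R d]_y (mala_proposal_pdf x y * mala_accept x y)%:E))%E.

Fixpoint mala_law (mu0 : set (Rd R d) -> \bar R) (n : nat) :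
    set (Rd R d) -> \bar R :=
  match n with
  | 0%N => mu0
  | n'.+1 => fun B => (\int[mala_law mu0 n']_x mala_kernel x B)%E
  end.

End mala.

Section mixing.
Context {disp : measure_display} {T : measurableType disp} (R : realType).
Implicit Types mu nu : set T -> \bar R.

Definition tv_dist mu nu : \bar R :=
  ereal_sup [set `|mu B - nu B|%E | B in measurable].

Definition warm (M0 : R) mu nu : Prop :=
  forall E, measurable E -> (mu E <= M0%:E * nu E)%E.

(* ereal_inf set0 = +oo: the mixing time is +oo if the law never gets
   eps-close to nu *)
Definition mixing_time (eps : R) (mu : nat -> set T -> \bar R)
    (nu : set T -> \bar R) : \bar R :=
  ereal_inf [set n%:R%:E | n in [set n | (tv_dist (mu n) nu <= eps%:E)%E]].

End mixing.

(* Main.v *)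
From HB Require Import structures.
Require Import Defs.
From mathcomp Require Import all_boot all_order all_algebra.
From mathcomp Require Import all_classical all_reals all_analysis.
From mathcomp Require Import measurable_realfun giry ring lra.

(** The proof works with the operator [T = mala_op h] on functions with values in
    [0, 1], and with the variance of [T ^ n] applied to the indicator of a set [B].

    Duality turns the law into an operator: the mass of [B] after [n] steps is the
    integral of [T ^ n \1_B] against the initial law ([mala_lawE]).  For an
    [M0]-warm start this integral is within
    [M0 * (eta / 2 + Var (T ^ n \1_B) / (2 * eta))] of the mass that the target
    gives to [B], for every [eta > 0] ([warm_mean_le]); with [eta = eps / M0] it
    suffices that the variance drop below [(eps / M0) ^ 2].

    For the Gaussian target the flow [pi Q A] of accepted moves is explicit: it is
    a Gaussian symmetric in [x] and [y] times [exp (- h / 8 * ||x|^2 - |y|^2|)]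
    ([mala_flowE]).  Both factors are Gram kernels, so [T] is a positive operator
    ([mala_gram]) and [|T g|^2 <= <g, T g>] ([mala_op_contraction]): in one step
    the squared norm drops at least by the Dirichlet form of [g].

    This form is compared with the one of an Ornstein-Uhlenbeck kernel of
    correlation [1 - e], where [e] is of order [h]; there the Poincare inequality
    gives at least [e] times the variance ([ou_poincare]).  A pointwise comparison
    of the two flows fails: only events of probability [exp (- K * d^(1/3))] can be
    neglected, and the Ornstein-Uhlenbeck kernel has more likely moves that change
    the squared norm so much that MALA accepts them with vanishing probability.  A
    move from [x] to [y] is therefore split into two moves through a third point
    [z], drawn from a Gaussian triple with the same pair correlations and weighted
    so that [|z|^2] is near the mean of [|x|^2] and [|y|^2] ([path]).  Given [x] and
    [y], the weight costs a constant factor, because the squared norm of [z]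
    fluctuates by [sqrt (h * d)], at most of order [1 / h]; given [x] and [z],
    averaging it over [y] produces the acceptance factor of MALA.  The outcome is
    [dirichlet_comparison].  The comparison leaves out the pairs where one of
    two chi-square variables deviates from [d] by more than [tau = T0 * d^(2/3)];
    by a Chernoff bound they have mass [4 * exp (- (T0 - 1) * d^(1/3) / 4)].

    Hence the variance contracts by a factor [1 - h / C1] per step up to this small
    error ([variance_mala_op]).  The error accumulates to at most [C1 / h] times
    itself, and since [ln (M0 / (eps * h)) <= K * d^(1/3)] it stays below half of
    [(eps / M0) ^ 2] when [T0] is large in terms of [K] ([bad_error_le]); the
    constant [c] is then taken small in terms of [T0].  The geometric part needs
    [n] of order [ln (M0 / eps) / h] steps.  Rounding [n] up is harmless because
    [ln (M0 / eps) >= 1] unless [eps >= 1 - 1 / M0], and in that case the initial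
    law is already within [eps] of the target ([tv_dist_warm_le]). *)

Set Implicit Arguments.
Unset Strict Implicit.
Unset Printing Implicit Defensive.

Import Order.TTheory GRing.Theory Num.Theory.
Import numFieldNormedType.Exports.
Local Open Scope classical_set_scope.
Local Open Scope ring_scope.

(** * Nonnegative integrals of real functions *)

Section nonneg_integrals.
Context d (X : measurableType d) (R : realType).
Variable mu : {measure set X -> \bar R}.

Lemma ge0_integralD_EFin (f g : X -> R) :
  measurable_fun setT f -> measurable_fun setT g ->
  (forall x, 0 <= f x) -> (forall x, 0 <= g x) ->
  (\int[mu]_x (f x + g x)%:E = \int[mu]_x (f x)%:E + \int[mu]_x (g x)%:E)%E.
Proof.
move=> mf mg f0 g0; under eq_integral do rewrite EFinD.
by rewrite ge0_integralD//; first [exact/measurable_EFinP |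
  move=> x _; rewrite lee_fin].
Qed.

Lemma ge0_integralZl_real (f : X -> R) (k : R) :
  measurable_fun setT f -> (forall x, 0 <= f x) -> 0 <= k ->
  (\int[mu]_x (k * f x)%:E = k%:E * \int[mu]_x (f x)%:E)%E.
Proof.
move=> mf f0 k0; under eq_integral do rewrite EFinM.
by rewrite ge0_integralZl//; first [exact/measurable_EFinP |
  move=> x _; rewrite lee_fin].
Qed.

Lemma ge0_le_integral_EFin (f g : X -> R) :
  measurable_fun setT f -> measurable_fun setT g ->
  (forall x, 0 <= f x) -> (forall x, f x <= g x) ->
  (\int[mu]_x (f x)%:E <= \int[mu]_x (g x)%:E)%E.
Proof.
move=> mf mg f0 fg; apply: ge0_le_integral => //;
  first [exact/measurable_EFinP | move=> x _; rewrite lee_fin//].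
Qed.

Lemma integral_EFin_ge0 (f : X -> R) : (forall x, 0 <= f x) ->
  (0 <= \int[mu]_x (f x)%:E)%E.
Proof. by move=> f0; apply: integral_ge0 => x _; rewrite lee_fin. Qed.

Import HBNNSimple.

(** An integral reads a set function on measurable sets only. This is how the
    successive laws, which come as bare set functions, are replaced by measures. *)
Lemma integral_ext_measurable (m1 m2 : set X -> \bar R) (f : X -> \bar R) :
  (forall A, measurable A -> m1 A = m2 A) ->
  (\int[m1]_x f x = \int[m2]_x f x)%E.
Proof.
move=> m12.
have si (h : {nnsfun X >-> R}) :
    sintegral m1 h = sintegral m2 h.
  rewrite /sintegral; apply: eq_fsbigr => r _; congr (_ * _)%E.
  by apply: m12.
rewrite /integral; congr (ereal_sup _ - ereal_sup _)%E; apply/seteqP;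
  by split => _ [h hg <-]; exists h.
Qed.

End nonneg_integrals.

Section tonelli.
Context d1 d2 (X : measurableType d1) (Y : measurableType d2) (R : realType).
Variables (mu : {sigma_finite_measure set X -> \bar R})
  (nu : {sigma_finite_measure set Y -> \bar R}).
Variable F : X -> Y -> R.
Hypothesis mF : measurable_fun setT (fun z : X * Y => F z.1 z.2).
Hypothesis F0 : forall x y, 0 <= F x y.

Lemma measurable_section1 x : measurable_fun setT (F x).
Proof. exact: (measurableT_comp mF (pair1_measurable x)). Qed.

Lemma measurable_section2 y : measurable_fun setT (F ^~ y).
Proof. exact: (measurable_fun_pair1 y mF). Qed.

Lemma measurable_integral_section1 :
  measurable_fun setT (fun x => \int[nu]_y (F x y)%:E)%E.
Proof.
apply: (measurable_fun_fubini_tonelli_F (m2 := nu)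
  (fun z : X * Y => (F z.1 z.2)%:E)).
- exact/measurable_EFinP.
- by move=> z; rewrite lee_fin.
Qed.

Lemma tonelli_EFin :
  (\int[mu]_x \int[nu]_y (F x y)%:E = \int[nu]_y \int[mu]_x (F x y)%:E)%E.
Proof.
apply: (fubini_tonelli (fun z : X * Y => (F z.1 z.2)%:E)).
- exact/measurable_EFinP.
- by move=> z; rewrite lee_fin.
Qed.

End tonelli.

Section iterated_integrals.
Context d1 d2 (X : measurableType d1) (Y : measurableType d2) (R : realType).
Variables (mu : {sigma_finite_measure set X -> \bar R})
  (nu : {sigma_finite_measure set Y -> \bar R}).
Variables F G : X -> Y -> R.
Hypothesis mF : measurable_fun setT (fun z : X * Y => F z.1 z.2).
Hypothesis mG : measurable_fun setT (fun z : X * Y => G z.1 z.2).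
Hypothesis F0 : forall x y, 0 <= F x y.

Lemma ge0_integral2D : (forall x y, 0 <= G x y) ->
  (\int[mu]_x \int[nu]_y (F x y + G x y)%:E =
   \int[mu]_x \int[nu]_y (F x y)%:E + \int[mu]_x \int[nu]_y (G x y)%:E)%E.
Proof.
move=> G0; rewrite -ge0_integralD//; last 4 first.
- by move=> x _; exact: integral_EFin_ge0.
- exact: measurable_integral_section1.
- by move=> x _; exact: integral_EFin_ge0.
- exact: measurable_integral_section1.
apply: eq_integral => x _; rewrite ge0_integralD_EFin//.
- exact: (measurable_section1 mF).
- exact: (measurable_section1 mG).
Qed.

Lemma ge0_integral2Zl k : 0 <= k ->
  (\int[mu]_x \int[nu]_y (k * F x y)%:E =
   k%:E * \int[mu]_x \int[nu]_y (F x y)%:E)%E.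
Proof.
move=> k0; rewrite -ge0_integralZl//; last 2 first.
- exact: measurable_integral_section1.
- by move=> x _; exact: integral_EFin_ge0.
apply: eq_integral => x _; rewrite ge0_integralZl_real//.
exact: (measurable_section1 mF).
Qed.

Lemma ge0_le_integral2 : (forall x y, F x y <= G x y) ->
  (\int[mu]_x \int[nu]_y (F x y)%:E <= \int[mu]_x \int[nu]_y (G x y)%:E)%E.
Proof.
move=> FG; have G0 x y : 0 <= G x y by exact: le_trans (FG x y).
apply: ge0_le_integral => //.
- by move=> x _; exact: integral_EFin_ge0.
- exact: (measurable_integral_section1 nu mF).
- exact: (measurable_integral_section1 nu mG).
- move=> x _; apply: ge0_le_integral_EFin => //.
  + exact: (measurable_section1 mF).
  + exact: (measurable_section1 mG).
Qed.

End iterated_integrals.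

Section density.
Context d (X : measurableType d) (R : realType).
Variables (L m : {measure set X -> \bar R}) (w : X -> R).
Hypotheses (mw : measurable_fun setT w) (w0 : forall x, 0 <= w x).
Hypothesis mE : forall A, measurable A -> (m A = \int[L]_(x in A) (w x)%:E)%E.

Import HBNNSimple.

(** Read off on simple functions and passed to the limit by monotone convergence. *)
Lemma ge0_integral_density (f : X -> \bar R) :
  measurable_fun setT f -> (forall x, 0 <= f x)%E ->
  (\int[m]_x f x = \int[L]_x (f x * (w x)%:E))%E.
Proof.
move=> mf f0; pose g := nnsfun_approx measurableT mf.
have mwE : measurable_fun setT (EFin \o w) by exact/measurable_EFinP.
have gE n x : (g n x)%:E =
    (\sum_(r \in range (g n)) r%:E * (\1_(g n @^-1` [set r]) x)%:E)%E.
  by rewrite [in LHS]fimfunE -fsumEFin//; under eq_fsbigr do rewrite EFinM.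
have intg n : (\int[m]_x (g n x)%:E = \int[L]_x ((g n x)%:E * (w x)%:E))%E.
  rewrite integralT_nnsfun sintegralE.
  under [RHS]eq_integral => x _.
    rewrite gE ge0_mule_fsuml; last first.
      by move=> r; rewrite -EFinM; exact: nnfun_muleindic_ge0.
    over.
  rewrite ge0_integral_fsum//; last 2 first.
  - move=> r; apply: emeasurable_funM => //.
    by apply/measurable_EFinP; apply: measurable_funM => //.
  - by move=> r x _; rewrite mule_ge0 ?lee_fin//; exact: nnfun_muleindic_ge0.
  apply: eq_fsbigr => r _.
  have [r0|r0] := ltP r 0.
    have e0 : g n @^-1` [set r] = set0 by exact: preimage_nnfun0.
    rewrite e0 measure0 mule0 integral0_eq// => x _.
    by rewrite indic0 mule0 mul0e.
  under eq_integral do rewrite -muleA.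
  rewrite ge0_integralZl ?lee_fin//; last 2 first.
  - by apply: emeasurable_funM => //; apply/measurable_EFinP.
  - by move=> x _; rewrite mule_ge0 ?lee_fin.
  congr (_ * _)%E; rewrite mE//.
  rewrite integral_mkcond; apply: eq_integral => x _.
  rewrite patchE indicE; case: ifPn => _; first by rewrite mul1e.
  by rewrite mul0e.
have mono x : {homo (fun n => (g n x)%:E) : a b / (a <= b)%N >-> (a <= b)%E}.
  by move=> a b ab; rewrite lee_fin; exact/lefP/nd_nnsfun_approx.
have limg x : limn (fun n => (g n x)%:E) = f x.
  by apply/cvg_lim => //; exact: cvg_nnsfun_approx.
under eq_integral do rewrite -limg.
rewrite monotone_convergence//; last 2 first.
- by move=> n; exact/measurable_EFinP.
- by move=> n x _; rewrite lee_fin.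
under eq_fun do rewrite intg.
rewrite -monotone_convergence//; last 3 first.
- by move=> n; apply: emeasurable_funM => //; exact/measurable_EFinP.
- by move=> n x _; rewrite mule_ge0 ?lee_fin.
- by move=> x _ a b ab; rewrite lee_wpmul2r ?lee_fin//; exact: mono.
apply: eq_integral => x _.
apply/cvg_lim => //; apply: cvgeZr => //.
by apply: cvg_nnsfun_approx.
Qed.

End density.

(** * Reversible kernels with a density and a holding probability *)

(** Functions with values in [0, 1] are stable by Markov operators, contain the
    indicators and are always integrable, so that integrals over a probability can
    be handled as real numbers. *)
Definition unit_fun d (X : measurableType d) (R : realType) (g : X -> R) :=
  measurable_fun setT g /\ forall x, 0 <= g x <= 1.

Section unit_functions.
Context d (X : measurableType d) (R : realType).
Implicit Types f g : X -> R.

Lemma unit_fun_measurable g : unit_fun g -> measurable_fun setT g.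
Proof. by case. Qed.

Lemma unit_fun_ge0 g : unit_fun g -> forall x, 0 <= g x.
Proof. by move=> [_ g01] x; have /andP[] := g01 x. Qed.

Lemma unit_fun_le1 g : unit_fun g -> forall x, g x <= 1.
Proof. by move=> [_ g01] x; have /andP[] := g01 x. Qed.

Lemma unit_funM f g : unit_fun f -> unit_fun g -> unit_fun (fun x => f x * g x).
Proof.
move=> [mf f01] [mg g01]; split; first exact: measurable_funM.
move=> x; have /andP[f0 f1] := f01 x; have /andP[g0 g1] := g01 x.
by rewrite mulr_ge0//= mulr_ile1.
Qed.

Lemma unit_fun_cst1 : unit_fun (fun _ : X => 1 : R).
Proof. by split => // x; rewrite ler01 lexx. Qed.

Lemma unit_fun_indic (A : set X) : measurable A -> unit_fun (\1_A : X -> R).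
Proof.
move=> mA; split; first by [].
by move=> x; rewrite indicE; case: (_ \in _); rewrite ?ler01 ?lexx.
Qed.

Variable pi : probability X R.

Lemma bounded_integrable (M : R) f : measurable_fun setT f ->
  (forall x, `|f x| <= M) -> pi.-integrable setT (EFin \o f).
Proof.
move=> mf fM; apply: measurable_bounded_integrable => //.
  by apply: le_lt_trans (ltry 1); exact: probability_le1.
exists M; split; first exact: num_real.
by move=> N MN x _; exact: le_trans (fM x) (ltW MN).
Qed.

Lemma unit_fun_integrable g : unit_fun g -> pi.-integrable setT (EFin \o g).
Proof.
move=> ug; apply: (@bounded_integrable 1); first exact: unit_fun_measurable.
by move=> x; rewrite ger0_norm ?unit_fun_ge0 ?unit_fun_le1.
Qed.

Lemma unit_fun_integralE g : unit_fun g ->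
  (\int[pi]_x (g x)%:E)%E = (\int[pi]_x g x)%:E.
Proof.
by move=> ug; rewrite /Rintegral fineK// (integrable_fin_num measurableT)//;
  exact: unit_fun_integrable.
Qed.

Lemma unit_fun_integral_le1 g : unit_fun g -> 0 <= \int[pi]_x g x <= 1.
Proof.
move=> ug; rewrite Rintegral_ge0/=; last by move=> x _; exact: unit_fun_ge0.
rewrite -lee_fin -unit_fun_integralE// -[leRHS](@probability_setT _ _ _ pi).
rewrite -[leRHS]mul1e -integral_cst// ge0_le_integral//.
- by move=> x _; rewrite lee_fin unit_fun_ge0.
- exact/measurable_EFinP/unit_fun_measurable.
- by move=> x _; rewrite lee_fin unit_fun_le1.
Qed.

(** The second moment of a combination of two functions, with the integrals of
    the products kept as separate unknowns. *)
Lemma integral_square_affine g u (a b c : R) : unit_fun g -> unit_fun u ->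
  \int[pi]_x (a * g x + b * u x + c) ^+ 2 =
  a ^+ 2 * (\int[pi]_x (g x * g x)) + b ^+ 2 * (\int[pi]_x (u x * u x))
  + c ^+ 2 + 2 * a * b * (\int[pi]_x (g x * u x))
  + 2 * a * c * (\int[pi]_x g x) + 2 * b * c * (\int[pi]_x u x).
Proof.
move=> ug uu.
have iD := RintegralD (mu := pi) measurableT.
have ii f k : unit_fun f -> pi.-integrable setT (EFin \o (fun x => k * f x)).
  move=> uf; have -> : EFin \o (fun x => k * f x) = (fun x => k%:E * (f x)%:E)%E.
    by apply/funext => x /=; rewrite EFinM.
  by apply: integrableZl => //; exact: unit_fun_integrable.
have iZ f k : unit_fun f -> \int[pi]_x (k * f x) = k * \int[pi]_x f x.
  by move=> uf; rewrite RintegralZl//; exact: unit_fun_integrable.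
have iiD f f' : pi.-integrable setT (EFin \o f) ->
    pi.-integrable setT (EFin \o f') ->
    pi.-integrable setT (EFin \o (fun x => f x + f' x)).
  move=> i1 i2; have -> : EFin \o (fun x => f x + f' x) =
    (fun x => (f x)%:E + (f' x)%:E)%E by [].
  exact: integrableD.
have ugg := unit_funM ug ug; have uuu := unit_funM uu uu.
have ugu := unit_funM ug uu; have u1 := unit_fun_cst1.
transitivity (\int[pi]_x (a ^+ 2 * (g x * g x) + (b ^+ 2 * (u x * u x) +
    (c ^+ 2 * 1 + (2 * a * b * (g x * u x) +
    (2 * a * c * g x + 2 * b * c * u x)))))).
  by apply: eq_Rintegral => x _; ring.
have i6 := ii _ (2 * b * c) uu; have i5 := ii _ (2 * a * c) ug.
have i4 := ii _ (2 * a * b) ugu; have i3 := ii _ (c ^+ 2) u1.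
have i2 := ii _ (b ^+ 2) uuu; have i1 := ii _ (a ^+ 2) ugg.
have j5 := iiD _ _ i5 i6; have j4 := iiD _ _ i4 j5.
have j3 := iiD _ _ i3 j4; have j2 := iiD _ _ i2 j3.
rewrite (iD _ _ i1 j2) (iD _ _ i2 j3) (iD _ _ i3 j4) (iD _ _ i4 j5).
rewrite (iD _ _ i5 i6) !iZ//.
have -> : \int[pi]_x (1 : R) = 1.
  by rewrite Rintegral_cst// [X in fine X]probability_setT mulr1.
ring.
Qed.

End unit_functions.

Section reversible_kernel.
Context d (X : measurableType d) (R : realType).
Variables (L : {sigma_finite_measure set X -> \bar R}) (pi : probability X R).
Variables (p : X -> R) (t : X -> X -> R).
Implicit Types f g : X -> R.
Hypotheses (mp : measurable_fun setT p) (p0 : forall x, 0 <= p x).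
Hypothesis piE :
  forall A, measurable A -> (pi A = \int[L]_(x in A) (p x)%:E)%E.
Hypothesis mt : measurable_fun setT (fun z : X * X => t z.1 z.2).
Hypothesis t0 : forall x y, 0 <= t x y.
Hypothesis t1 : forall x, (\int[L]_y (t x y)%:E <= 1)%E.
Hypothesis rev : forall x y, p x * t x y = p y * t y x.

Definition holding x : R := 1 - fine (\int[L]_y (t x y)%:E)%E.

Definition kernel_op (g : X -> R) x : R :=
  fine (\int[L]_y (t x y * g y)%:E)%E + holding x * g x.

Let t_fin x : (\int[L]_y (t x y)%:E)%E \is a fin_num.
Proof.
by rewrite ge0_fin_numE ?integral_EFin_ge0// (le_lt_trans (t1 x)) ?ltry.
Qed.

Let mtx x : measurable_fun setT (t x).
Proof. exact: (measurable_section1 mt). Qed.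

Lemma unit_fun_holding : unit_fun holding.
Proof.
split.
  apply: measurable_funB => //.
  by apply: measurableT_comp => //; exact: measurable_integral_section1.
move=> x; rewrite subr_ge0 -lee_fin fineK// t1/= lerBlDr lerDl.
by apply: fine_ge0; exact: integral_EFin_ge0.
Qed.

Let mtg g : measurable_fun setT g ->
  measurable_fun setT (fun z : X * X => t z.1 z.2 * g z.2).
Proof.
move=> mg; apply: measurable_funM => //.
by apply: measurableT_comp => //; exact: measurable_snd.
Qed.

Let tg_fin g x : unit_fun g -> (\int[L]_y (t x y * g y)%:E)%E \is a fin_num.
Proof.
move=> ug; have [mg _] := ug.
have g0 := unit_fun_ge0 ug; have g1 := unit_fun_le1 ug.
rewrite ge0_fin_numE; last first.
  by apply: integral_EFin_ge0 => y; rewrite mulr_ge0.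
apply: le_lt_trans (ltry 1); apply: le_trans (t1 x).
apply: ge0_le_integral_EFin => //.
- exact: measurable_funM.
- by move=> y; rewrite mulr_ge0.
- by move=> y; rewrite ler_piMr.
Qed.

Lemma unit_fun_kernel_op g : unit_fun g -> unit_fun (kernel_op g).
Proof.
move=> ug; have [mg _] := ug; have [mh _] := unit_fun_holding.
have g0 := unit_fun_ge0 ug; have g1 := unit_fun_le1 ug.
have h0 := unit_fun_ge0 unit_fun_holding.
split.
  apply: measurable_funD; last exact: measurable_funM.
  apply: measurableT_comp => //.
  apply: (measurable_integral_section1 L (F := fun x y => t x y * g y)).
    exact: mtg.
  by move=> x y; rewrite mulr_ge0.
move=> x; apply/andP; split.
  rewrite addr_ge0 ?mulr_ge0// fine_ge0//.
  by apply: integral_EFin_ge0 => y; rewrite mulr_ge0.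
rewrite /kernel_op -lerBrDr; apply: (@le_trans _ _ (1 - holding x)); last first.
  by rewrite lerB// ler_piMr.
rewrite /holding subKr fine_le//; first exact: tg_fin.
apply: ge0_le_integral_EFin => //.
- exact: measurable_funM.
- by move=> y; rewrite mulr_ge0.
- by move=> y; rewrite ler_piMr.
Qed.

Lemma kernel_op1 : kernel_op (fun=> 1) = fun=> 1.
Proof.
apply/funext => x; rewrite /kernel_op /holding mulr1.
by under eq_integral do rewrite mulr1; rewrite subrKC.
Qed.

Let mflow f g : measurable_fun setT f -> measurable_fun setT g ->
  measurable_fun setT (fun z : X * X => f z.1 * g z.2 * (p z.1 * t z.1 z.2)).
Proof.
move=> mf mg; apply: measurable_funM; apply: measurable_funM => //.
- by apply: measurableT_comp => //; exact: measurable_fst.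
- by apply: measurableT_comp => //; exact: measurable_snd.
- by apply: measurableT_comp => //; exact: measurable_fst.
Qed.

(** The correlation splits into what moves, an integral against the symmetric flow
    [p x * t x y], and what stays put. *)
Lemma integral_kernel_op f g : unit_fun f -> unit_fun g ->
  (\int[pi]_x (f x * kernel_op g x)%:E =
   \int[L]_x \int[L]_y (f x * g y * (p x * t x y))%:E +
   \int[pi]_x (f x * g x * holding x)%:E)%E.
Proof.
move=> uf ug; have [mf _] := uf; have [mg _] := ug.
have g0 := unit_fun_ge0 ug; have f0 := unit_fun_ge0 uf.
have uh := unit_fun_holding.
have h0 := unit_fun_ge0 uh; have [mh _] := uh.
pose G x := fine (\int[L]_y (t x y * g y)%:E)%E.
have mG : measurable_fun setT G.
  apply: measurableT_comp => //.
  apply: (measurable_integral_section1 L (F := fun x y => t x y * g y)).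
    exact: mtg.
  by move=> x y; rewrite mulr_ge0.
have G0 x : 0 <= G x.
  by rewrite fine_ge0//; apply: integral_EFin_ge0 => y; rewrite mulr_ge0.
transitivity (\int[pi]_x (f x * G x + f x * g x * holding x)%:E)%E.
  by apply: eq_integral => x _; congr EFin; rewrite /kernel_op -/(G x); ring.
rewrite ge0_integralD_EFin//; last 4 first.
- exact: measurable_funM.
- by apply: measurable_funM => //; exact: measurable_funM.
- by move=> x; rewrite mulr_ge0.
- by move=> x; rewrite !mulr_ge0.
congr (_ + _)%E.
rewrite (ge0_integral_density mp p0 piE); last 2 first.
- by apply/measurable_EFinP; exact: measurable_funM.
- by move=> x; rewrite lee_fin mulr_ge0.
apply: eq_integral => x _.
transitivity (\int[L]_y ((f x * p x) * (t x y * g y))%:E)%E.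
  rewrite ge0_integralZl_real.
  - by rewrite -EFinM -[in RHS](fineK (tg_fin x ug)) -EFinM mulrAC.
  - exact: measurable_funM.
  - by move=> y; rewrite mulr_ge0.
  - by rewrite mulr_ge0.
by apply: eq_integral => y _; congr EFin; ring.
Qed.

Lemma kernel_op_sym f g : unit_fun f -> unit_fun g ->
  \int[pi]_x (f x * kernel_op g x) = \int[pi]_x (g x * kernel_op f x).
Proof.
move=> uf ug; apply: EFin_inj.
have uTg := unit_fun_kernel_op ug; have uTf := unit_fun_kernel_op uf.
rewrite -!unit_fun_integralE; try exact: unit_funM.
rewrite (integral_kernel_op uf ug) (integral_kernel_op ug uf).
apply: (f_equal2 adde); last first.
  by apply: eq_integral => x _; rewrite (mulrC (f x)).
rewrite (tonelli_EFin L L (F := fun x y => f x * g y * (p x * t x y))).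
- apply: eq_integral => y _; apply: eq_integral => x _.
  by rewrite rev (mulrC (f x)).
- by apply: mflow; exact: unit_fun_measurable.
- by move=> x y; rewrite !mulr_ge0 ?(unit_fun_ge0 uf) ?(unit_fun_ge0 ug).
Qed.

Lemma integral_kernel_op1 g : unit_fun g ->
  \int[pi]_x kernel_op g x = \int[pi]_x g x.
Proof.
move=> ug; have := kernel_op_sym (unit_fun_cst1 _ _) ug.
rewrite kernel_op1; under eq_Rintegral do rewrite mul1r.
by move=> ->; apply: eq_Rintegral => x _; rewrite mulr1.
Qed.

(** Expanding the square: the diagonal terms are integrals of [g ^ 2] against
    the part of [pi] that moves, which reversibility makes equal. *)
Lemma dirichlet_formE g : unit_fun g ->
  (\int[L]_x \int[L]_y ((g x - g y) ^+ 2 * (p x * t x y))%:E)%E =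
  (2 * (\int[pi]_x (g x * g x) - \int[pi]_x (g x * kernel_op g x)))%:E.
Proof.
move=> ug; have [mg _] := ug; have g0 := unit_fun_ge0 ug.
have mg1 : measurable_fun setT (g \o (@fst X X)).
  by apply: measurableT_comp => //; exact: measurable_fst.
have mg2 : measurable_fun setT (g \o (@snd X X)).
  by apply: measurableT_comp => //; exact: measurable_snd.
have mpt : measurable_fun setT (fun z : X * X => p z.1 * t z.1 z.2).
  by apply: measurable_funM => //; apply: measurableT_comp => //;
    exact: measurable_fst.
have pt0 x y : 0 <= p x * t x y by rewrite mulr_ge0.
pose A := (\int[L]_x \int[L]_y ((g x - g y) ^+ 2 * (p x * t x y))%:E)%E.
pose B := (\int[L]_x \int[L]_y (g x * g y * (p x * t x y))%:E)%E.
pose C := (\int[L]_x \int[L]_y (g x ^+ 2 * (p x * t x y))%:E)%E.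
pose D := (\int[L]_x \int[L]_y (g y ^+ 2 * (p x * t x y))%:E)%E.
pose H := (\int[pi]_x (g x * g x * holding x)%:E)%E.
have mA : measurable_fun setT
    (fun z : X * X => (g z.1 - g z.2) ^+ 2 * (p z.1 * t z.1 z.2)).
  apply: measurable_funM => //; apply: measurable_funX.
  exact: measurable_funB.
have mB : measurable_fun setT
    (fun z : X * X => g z.1 * g z.2 * (p z.1 * t z.1 z.2)) by exact: mflow.
have mC : measurable_fun setT
    (fun z : X * X => g z.1 ^+ 2 * (p z.1 * t z.1 z.2)).
  by apply: measurable_funM => //; exact: measurable_funX.
have mD : measurable_fun setT
    (fun z : X * X => g z.2 ^+ 2 * (p z.1 * t z.1 z.2)).
  by apply: measurable_funM => //; exact: measurable_funX.
have A0 x y : 0 <= (g x - g y) ^+ 2 * (p x * t x y).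
  by rewrite mulr_ge0 ?sqr_ge0.
have B0 x y : 0 <= g x * g y * (p x * t x y) by rewrite !mulr_ge0.
have C0 x y : 0 <= g x ^+ 2 * (p x * t x y) by rewrite !mulr_ge0.
have D0 x y : 0 <= g y ^+ 2 * (p x * t x y) by rewrite !mulr_ge0.
have ABCD : (A + (B + B) = C + D)%E.
  have mBB := measurable_funD mB mB.
  have BB0 x y : 0 <= g x * g y * (p x * t x y) + g x * g y * (p x * t x y).
    by rewrite addr_ge0.
  have e1 : _ = (B + B)%E := ge0_integral2D L L mB mB B0 B0.
  have e2 : _ = (C + D)%E := ge0_integral2D L L mC mD C0 D0.
  have e3 : _ = (A + _)%E := ge0_integral2D L L mA mBB A0 BB0.
  apply: (etrans (congr1 (adde A) (esym e1))).
  apply: (etrans (esym e3)); apply: (etrans _ e2).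
  by apply: eq_integral => x _; apply: eq_integral => y _; congr EFin; ring.
have CD : D = C.
  rewrite /D (tonelli_EFin L L (F := fun x y => g y ^+ 2 * (p x * t x y)) mD D0).
  by apply: eq_integral => x _; apply: eq_integral => y _; rewrite rev.
have uh := unit_fun_holding; have h0 := unit_fun_ge0 uh.
have h1 := unit_fun_le1 uh; have [mh _] := uh.
have ugg := unit_funM ug ug.
have uggh := unit_funM ugg uh.
have uTg := unit_fun_kernel_op ug; have ugTg := unit_funM ug uTg.
have BH : (\int[pi]_x (g x * kernel_op g x))%:E = (B + H)%E.
  by rewrite -(unit_fun_integralE pi ugTg) (integral_kernel_op ug ug).
have CH : (\int[pi]_x (g x * g x))%:E = (C + H)%E.
  rewrite -(unit_fun_integralE pi ugg).
  have h'0 x : 0 <= 1 - holding x by rewrite subr_ge0.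
  have m1 : measurable_fun setT (fun x => g x * g x * (1 - holding x)).
    by apply: measurable_funM; [exact: ugg.1 | exact: measurable_funB].
  have n1 x : 0 <= g x * g x * (1 - holding x).
    by apply: mulr_ge0; [exact: mulr_ge0 (g0 x) (g0 x) | exact: h'0].
  have n2 x : 0 <= g x * g x * holding x.
    by apply: mulr_ge0; [exact: mulr_ge0 (g0 x) (g0 x) | exact: h0].
  have -> : C = (\int[pi]_x (g x * g x * (1 - holding x))%:E)%E.
    rewrite (ge0_integral_density mp p0 piE); last 2 first.
    - exact/measurable_EFinP.
    - by move=> x; rewrite lee_fin.
    apply: eq_integral => x _.
    transitivity (\int[L]_y ((g x ^+ 2 * p x) * t x y)%:E)%E.
      by apply: eq_integral => y _; congr EFin; ring.
    rewrite (ge0_integralZl_real _ (mtx x) (t0 x)); last first.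
      by rewrite mulr_ge0 ?sqr_ge0.
    rewrite /holding subKr -EFinM -[X in (_ * X)%E](fineK (t_fin x)) -EFinM.
    by congr EFin; ring.
  rewrite -(ge0_integralD_EFin _ m1 uggh.1 n1 n2).
  by apply: eq_integral => x _; congr EFin; ring.
rewrite -/A; move: ABCD BH CH; rewrite CD => ABCD BH CH.
have nA : (0 <= A)%E by apply: integral_ge0 => x _; exact: integral_EFin_ge0.
have nB : (0 <= B)%E by apply: integral_ge0 => x _; exact: integral_EFin_ge0.
have nC : (0 <= C)%E by apply: integral_ge0 => x _; exact: integral_EFin_ge0.
have nH : (0 <= H)%E.
  by apply: integral_EFin_ge0 => x; rewrite !mulr_ge0.
clearbody A B C D H.
case: A B C D H nA nB nC nH {CD} ABCD BH CH => [a||] [b||] [c||] D [h||] //=.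
by move=> _ _ _ _ [ABC] [->] [->]; congr EFin; lra.
Qed.

Section gram.
Context dY (Y : measurableType dY).
Variables (nu : {sigma_finite_measure set Y -> \bar R}) (psi : X -> Y -> R).
Hypothesis mpsi : measurable_fun setT (fun z : X * Y => psi z.1 z.2).
Hypothesis psi0 : forall x z, 0 <= psi x z.
Hypothesis gram : forall x y,
  (\int[nu]_z (psi x z * psi y z)%:E)%E = (p x * t x y)%:E.

Let mfpsi f : measurable_fun setT f ->
  measurable_fun setT (fun z : X * Y => f z.1 * psi z.1 z.2).
Proof.
move=> mf; apply: measurable_funM => //.
by apply: measurableT_comp => //; exact: measurable_fst.
Qed.

Definition feature f z : \bar R := (\int[L]_x (f x * psi x z)%:E)%E.

Let feature_ge0 f z : unit_fun f -> (0 <= feature f z)%E.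
Proof.
by move=> uf; apply: integral_EFin_ge0 => x; rewrite mulr_ge0 ?(unit_fun_ge0 uf).
Qed.

Lemma measurable_feature f : unit_fun f -> measurable_fun setT (feature f).
Proof.
move=> uf; apply: (measurable_integral_section1 L (F := fun z x => f x * psi x z)).
  apply: (measurableT_comp (f := fun v : X * Y => f v.1 * psi v.1 v.2)
    (g := fun v : Y * X => (v.2, v.1)));
    [exact: mfpsi uf.1 | exact: measurable_fun_pair measurable_snd measurable_fst].
by move=> z x; rewrite mulr_ge0 ?(unit_fun_ge0 uf).
Qed.

Lemma gram_flow f g : unit_fun f -> unit_fun g ->
  (\int[L]_x \int[L]_y (f x * g y * (p x * t x y))%:E =
   \int[nu]_z (feature f z * feature g z))%E.
Proof.
move=> uf ug; have f0 := unit_fun_ge0 uf; have g0 := unit_fun_ge0 ug.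
have fpsi0 x z : 0 <= f x * psi x z by rewrite mulr_ge0.
have gpsi0 x z : 0 <= g x * psi x z by rewrite mulr_ge0.
have mfp := mfpsi uf.1; have mgp := mfpsi ug.1.
have mpx x : measurable_fun setT (psi x) by exact: (measurable_section1 mpsi).
have mpz z : measurable_fun setT (psi ^~ z) by exact: (measurable_section2 mpsi).
transitivity (\int[L]_x \int[nu]_z ((f x * psi x z)%:E * feature g z))%E.
  apply: eq_integral => x _.
  transitivity (\int[L]_y \int[nu]_z ((f x * psi x z) * (g y * psi y z))%:E)%E.
    apply: eq_integral => y _.
    transitivity (\int[nu]_z ((f x * g y) * (psi x z * psi y z))%:E)%E.
      rewrite ge0_integralZl_real ?gram ?EFinM//.
      - by apply: measurable_funM; exact: mpx.
      - by move=> z; rewrite mulr_ge0.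
      - by rewrite mulr_ge0.
    by apply: eq_integral => z _; congr EFin; ring.
  rewrite (tonelli_EFin L nu
    (F := fun y z => (f x * psi x z) * (g y * psi y z))).
  - apply: eq_integral => z _; rewrite ge0_integralZl_real//.
    apply: measurable_funM; [exact: ug.1 | exact: mpz].
  - apply: measurable_funM => //.
    apply: (measurableT_comp (f := fun z => f x * psi x z)).
      by apply: measurable_funM => //; exact: mpx.
    exact: measurable_snd.
  - by move=> y z; exact: mulr_ge0.
have m2 : measurable_fun setT (feature g \o (@snd X Y)).
  by apply: measurableT_comp; [exact: measurable_feature | exact: measurable_snd].
rewrite (fubini_tonelli (m1 := L) (m2 := nu)
  (fun v : X * Y => (f v.1 * psi v.1 v.2)%:E * feature g v.2)%E); last 2 first.
- by apply: emeasurable_funM; [exact/measurable_EFinP | exact: m2].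
- by move=> v; rewrite mule_ge0 ?lee_fin ?feature_ge0.
apply: eq_integral => z _ /=; rewrite ge0_integralZr//.
- apply/measurable_EFinP; apply: measurable_funM; [exact: uf.1 | exact: mpz].
- by move=> x _; rewrite lee_fin.
- exact: feature_ge0.
Qed.

Let amgme (a b : \bar R) : (0 <= a -> 0 <= b -> a * b + a * b <= a * a + b * b)%E.
Proof.
case: a b => [a||] [b||]//= a0 b0.
- by rewrite -!EFinM -!EFinD lee_fin; have := sqr_ge0 (a - b); nra.
- by rewrite mulyy addey ?leey// -EFinM.
- by rewrite mulyy addye ?leey// -EFinM.
Qed.

(** The moving part is an inner product of features and the holding part is a
    multiplication by a nonnegative function, so both are positive forms. *)
Lemma kernel_op_psd f g : unit_fun f -> unit_fun g ->
  2 * \int[pi]_x (f x * kernel_op g x) <=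
  \int[pi]_x (f x * kernel_op f x) + \int[pi]_x (g x * kernel_op g x).
Proof.
move=> uf ug; have uh := unit_fun_holding.
have uTf := unit_fun_kernel_op uf; have uTg := unit_fun_kernel_op ug.
rewrite -lee_fin mulr_natl mulr2n !EFinD.
rewrite -!unit_fun_integralE; try exact: unit_funM.
rewrite !integral_kernel_op ?gram_flow; try by [].
set a := (\int[nu]_z _)%E; set b := (\int[pi]_x _)%E.
set a1 := (\int[nu]_z _)%E; set b1 := (\int[pi]_x _)%E.
set a2 := (\int[nu]_z _)%E; set b2 := (\int[pi]_x _)%E.
have eqle (u v u' v' : \bar R) : u = u' -> v = v' -> (u <= v)%E -> (u' <= v')%E.
  by move=> <- <-.
rewrite [leLHS]addeACA [leRHS]addeACA; apply: leeD.
  have mG f' g' : unit_fun f' -> unit_fun g' ->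
      measurable_fun setT (fun z => feature f' z * feature g' z)%E.
    by move=> u1 u2; apply: emeasurable_funM; exact: measurable_feature.
  have G0 f' g' : unit_fun f' -> unit_fun g' ->
      forall z, [set: Y] z -> (0 <= feature f' z * feature g' z)%E.
    by move=> u1 u2 z _; apply: mule_ge0; exact: feature_ge0.
  have e1 : _ = (a + a)%E := ge0_integralD _ measurableT
    (G0 _ _ uf ug) (mG _ _ uf ug) (G0 _ _ uf ug) (mG _ _ uf ug).
  have e2 : _ = (a1 + a2)%E := ge0_integralD _ measurableT
    (G0 _ _ uf uf) (mG _ _ uf uf) (G0 _ _ ug ug) (mG _ _ ug ug).
  apply: (eqle _ _ _ _ e1 e2).
  apply: ge0_le_integral => //.
  - by move=> z zT; apply: adde_ge0; exact: G0.
  - by apply: emeasurable_funD; exact: mG.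
  - by apply: emeasurable_funD; exact: mG.
  - by move=> z _; apply: amgme; exact: feature_ge0.
have mh f' g' : unit_fun f' -> unit_fun g' ->
    measurable_fun setT (fun z => f' z * g' z * holding z).
  by move=> u1 u2; apply: measurable_funM; [exact: (unit_funM u1 u2).1|exact: uh.1].
have h0 f' g' : unit_fun f' -> unit_fun g' ->
    forall z, 0 <= f' z * g' z * holding z.
  by move=> u1 u2 z; rewrite !mulr_ge0 ?(unit_fun_ge0 u1) ?(unit_fun_ge0 u2)
    ?(unit_fun_ge0 uh).
have e1 : _ = (b + b)%E := ge0_integralD_EFin _
  (mh _ _ uf ug) (mh _ _ uf ug) (h0 _ _ uf ug) (h0 _ _ uf ug).
have e2 : _ = (b1 + b2)%E := ge0_integralD_EFin _
  (mh _ _ uf uf) (mh _ _ ug ug) (h0 _ _ uf uf) (h0 _ _ ug ug).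
apply: (eqle _ _ _ _ e1 e2).
apply: ge0_le_integral_EFin.
- by apply: measurable_funD; exact: mh.
- by apply: measurable_funD; exact: mh.
- by move=> z; apply: addr_ge0; exact: h0.
- move=> z; have := unit_fun_ge0 uh z; have := sqr_ge0 (f z - g z); nra.
Qed.

(** Positivity applied to [g - T g]: [0 <= <g - T g, T (g - T g)>], together
    with [<T g, T (T g)> <= <T g, T g>]. *)
Lemma kernel_op_contraction g : unit_fun g ->
  \int[pi]_x (kernel_op g x * kernel_op g x) <=
  \int[pi]_x (g x * kernel_op g x).
Proof.
move=> ug; have uT := unit_fun_kernel_op ug.
have := kernel_op_psd ug uT; rewrite (kernel_op_sym ug uT).
suff : \int[pi]_x (kernel_op g x * kernel_op (kernel_op g) x) <=
       \int[pi]_x (kernel_op g x * kernel_op g x) by lra.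
rewrite -subr_ge0 -(pmulr_rge0 _ (ltr0n R 2)) -lee_fin -dirichlet_formE//.
by apply: integral_ge0 => x _; apply: integral_EFin_ge0 => y;
  rewrite mulr_ge0 ?sqr_ge0// mulr_ge0.
Qed.

End gram.

Section law.

Definition moving_measure x (B : set X) : \bar R :=
  (\int[L]_(y in B) (t x y)%:E)%E.

Section moving_measure_measure.
Variable x : X.

Let moving0 : moving_measure x set0 = 0%E.
Proof. exact: integral_set0. Qed.

Let moving_ge0 A : (0 <= moving_measure x A)%E.
Proof. by apply: integral_ge0 => y _; rewrite lee_fin. Qed.

Let moving_sigma_additive : semi_sigma_additive (moving_measure x).
Proof.
move=> F mF tF mUF; rewrite /moving_measure ge0_integral_bigcup//=.
- by apply: is_cvg_ereal_nneg_natsum_cond => n _ _; exact: moving_ge0.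
- by apply/measurable_EFinP; apply: measurable_funTS.
- by move=> y _; rewrite lee_fin.
Qed.

HB.instance Definition _ := isMeasure.Build _ _ _ (moving_measure x)
  moving0 moving_ge0 moving_sigma_additive.

Definition kernel_measure : set X -> \bar R :=
  measure_add (moving_measure x)
    (mscale (NngNum (unit_fun_ge0 unit_fun_holding x)) \d_x).

HB.instance Definition _ := Measure.on kernel_measure.

Lemma kernel_measureE B : kernel_measure B =
  (moving_measure x B + (holding x)%:E * \d_x B)%E.
Proof. exact: measure_addE. Qed.

Let kernel_measure_le1 : (kernel_measure setT <= 1)%E.
Proof.
rewrite kernel_measureE diracT mule1 /holding /moving_measure.
move: (t_fin x); case: (\int[L]_y (t x y)%:E)%E => [r||]//= _.
by rewrite -EFinD subrKC.
Qed.

HB.instance Definition _ := Measure_isSubProbability.Build _ _ _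
  kernel_measure kernel_measure_le1.

Definition kernel_giry : giry X R := kernel_measure.

End moving_measure_measure.

Lemma integral_kernel_measure x g : unit_fun g ->
  (\int[kernel_measure x]_y (g y)%:E = (kernel_op g x)%:E)%E.
Proof.
move=> ug; have g0 := unit_fun_ge0 ug.
have mg : measurable_fun setT (EFin \o g) by apply/measurable_EFinP; exact: ug.1.
apply: (etrans (ge0_integral_measure_add _ _ measurableT _ mg)).
  by move=> y _; rewrite lee_fin.
rewrite ge0_integral_mscale//; last by move=> y _; rewrite lee_fin.
rewrite integral_dirac// diracT mul1e /kernel_op [RHS]EFinD fineK ?tg_fin//.
congr (_ + _)%E.
rewrite (ge0_integral_density (L := L) (w := t x))//.
by apply: eq_integral => y _; rewrite -EFinM mulrC.
Qed.

Lemma kernel_measure_indic x B : measurable B ->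
  kernel_measure x B = (kernel_op \1_B x)%:E.
Proof.
move=> mB; rewrite -integral_kernel_measure; last exact: unit_fun_indic.
by rewrite integral_indic// setIT.
Qed.

Lemma measurable_kernel_giry : measurable_fun setT kernel_giry.
Proof.
apply: measurable_giry_codensity => // B mB.
have -> : kernel_giry^~ B = EFin \o kernel_op \1_B.
  by apply/funext => x; exact: kernel_measure_indic.
apply/measurable_EFinP.
by have [] := unit_fun_kernel_op (@unit_fun_indic _ X R B mB).
Qed.

(** The law after [n] steps, tested on a set, is the initial law tested on the
    [n]-th iterate of the operator. *)
Lemma law_kernel_op (mu0 : probability X R) (law : nat -> set X -> \bar R) :
  law 0%N = mu0 ->
  (forall n B, measurable B -> (law n.+1 B = \int[law n]_x kernel_measure x B)%E) ->
  forall n B, measurable B ->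
    law n B = (\int[mu0]_x iter n kernel_op \1_B x)%:E.
Proof.
move=> law0 lawS n.
suff [m [mlaw mint]] : exists m : giry X R,
    (forall B, measurable B -> law n B = m B) /\
    (forall g, unit_fun g ->
      (\int[m]_x (g x)%:E = (\int[mu0]_x iter n kernel_op g x)%:E)%E).
  move=> B mB; rewrite mlaw// -mint; last exact: unit_fun_indic.
  by rewrite integral_indic// setIT.
elim: n => [|n [m [mlaw mint]]].
  exists (mu0 : giry X R); split => [B mB|g ug]; first by rewrite law0.
  exact: unit_fun_integralE.
exists (giry_bind m measurable_kernel_giry).
have bindE g : unit_fun g ->
    (\int[giry_bind m measurable_kernel_giry]_x (g x)%:E =
     (\int[mu0]_x iter n.+1 kernel_op g x)%:E)%E.
  move=> ug; rewrite iterSr -mint; last exact: unit_fun_kernel_op.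
  have /= := @giry_int_bind _ _ _ _ _ m _ measurable_kernel_giry (EFin \o g).
  rewrite /giry_int => -> //; last 2 first.
  - by apply/measurable_EFinP; exact: ug.1.
  - by move=> x; rewrite lee_fin (unit_fun_ge0 ug).
  by apply: eq_integral => x _; exact: integral_kernel_measure.
split => // B mB; have uB := @unit_fun_indic _ X R B mB.
transitivity (\int[giry_bind m measurable_kernel_giry]_x (\1_B x)%:E)%E; last first.
  by rewrite integral_indic// setIT.
rewrite bindE// iterSr -mint; last exact: unit_fun_kernel_op.
rewrite lawS// (integral_ext_measurable _ mlaw); apply: eq_integral => x _.
exact: kernel_measure_indic.
Qed.

End law.

End reversible_kernel.

(** * Gaussian densities on R^d as exponentials of quadratic forms *)

Section gaussian_exponents.
Context (R : realType) (d : nat).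
Implicit Types (x y z : Rd R d) (a b v : R).

Definition sqnorm x : R := \sum_(i < d) tnth x i ^+ 2.
Definition dot x y : R := \sum_(i < d) tnth x i * tnth y i.

Lemma dotC x y : dot x y = dot y x.
Proof. by apply: eq_bigr => i _; rewrite mulrC. Qed.

Definition lincomb a b x y : Rd R d :=
  [tuple a * tnth x i + b * tnth y i | i < d].

Definition scale a x : Rd R d := [tuple a * tnth x i | i < d].

Lemma sqdist_lincomb a b x y z :
  sqdist_Rd z (lincomb a b x y) =
  sqnorm z - 2 * a * dot z x - 2 * b * dot z y + a ^+ 2 * sqnorm x
  + 2 * a * b * dot x y + b ^+ 2 * sqnorm y.
Proof.
rewrite /sqdist_Rd /sqnorm /dot !mulr_sumr -!sumrB -!big_split/=.
by apply: eq_bigr => i _; rewrite tnth_mktuple; ring.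
Qed.

Lemma sqdist_scale a x y :
  sqdist_Rd y (scale a x) = sqnorm y - 2 * a * dot x y + a ^+ 2 * sqnorm x.
Proof.
rewrite /sqdist_Rd /sqnorm /dot !mulr_sumr -!sumrB -!big_split/=.
by apply: eq_bigr => i _; rewrite tnth_mktuple; ring.
Qed.

Lemma sqdist0 x : sqdist_Rd x [tuple 0 | i < d] = sqnorm x.
Proof.
by apply: eq_bigr => i _; rewrite tnth_mktuple subr0.
Qed.

Lemma gaussian_pdfE (m : Rd R d) v x : 0 < v ->
  gaussian_pdf m v x =
  expR (- (d%:R / 2) * ln (2 * pi * v) - sqdist_Rd x m / (2 * v)).
Proof.
move=> v0; have c0 : 0 < 2 * pi * v by rewrite !mulr_gt0 ?pi_gt0.
by rewrite /gaussian_pdf /powR gt_eqF// -expRD.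
Qed.

Lemma std_gaussian_pdfE x :
  std_gaussian_pdf x = expR (- (d%:R / 2) * ln (2 * pi) - sqnorm x / 2).
Proof. by rewrite /std_gaussian_pdf gaussian_pdfE// sqdist0 !mulr1. Qed.

Lemma measurable_sqnorm : measurable_fun setT sqnorm.
Proof.
by apply: measurable_sum => i; apply: measurable_funX; exact: measurable_tnth.
Qed.

Lemma measurable_dot d' (Z : measurableType d') (f g : Z -> Rd R d) :
  measurable_fun setT f -> measurable_fun setT g ->
  measurable_fun setT (fun u => dot (f u) (g u)).
Proof.
move=> mf mg; apply: measurable_sum => i; apply: measurable_funM.
- by apply: (measurableT_comp (f := fun x : Rd R d => tnth x i)) => //;
    exact: measurable_tnth.
- by apply: (measurableT_comp (f := fun x : Rd R d => tnth x i)) => //;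
    exact: measurable_tnth.
Qed.

End gaussian_exponents.

Section gaussian_integral2.
Context (R : realType) (d : nat).
Local Notation L := (@lebesgue_Rd R d).

(** Factor the exponential into the density of [x], with variance
    [(a + b) / (8 a b)], and that of [y] given [x], with mean
    [(b - a) / (a + b) * x]. *)
Lemma gaussian_integral2 (k a b : R) : 0 < a -> 0 < b ->
  (\int[L]_x \int[L]_y (expR (k
     - a * (sqnorm x + 2 * dot x y + sqnorm y)
     - b * (sqnorm x - 2 * dot x y + sqnorm y)))%:E =
   (expR (k + d%:R * ln pi - d%:R / 2 * ln (4 * a * b)))%:E)%E.
Proof.
move=> a0 b0; have ab0 : 0 < a + b by rewrite addr_gt0.
have abn : a + b != 0 by rewrite gt_eqF.
have an : a != 0 by rewrite gt_eqF.
have bn : b != 0 by rewrite gt_eqF.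
pose v := (2 * (a + b))^-1; pose r := (b - a) / (a + b).
pose w := (a + b) / (8 * a * b).
have v0 : 0 < v by rewrite invr_gt0 mulr_gt0.
have w0 : 0 < w by rewrite divr_gt0// !mulr_gt0.
pose c := k + d%:R / 2 * ln (2 * pi * v) + d%:R / 2 * ln (2 * pi * w).
transitivity (\int[L]_x \int[L]_y (expR c * gaussian_pdf [tuple 0 | i < d] w x *
    gaussian_pdf (scale r x) v y)%:E)%E.
  apply: eq_integral => x _; apply: eq_integral => y _; congr EFin.
  rewrite !gaussian_pdfE// -!expRD; congr expR.
  rewrite sqdist_scale sqdist0 /c /v /w /r; field.
  by rewrite an bn abn.
transitivity (\int[L]_x (expR c * gaussian_pdf [tuple 0 | i < d] w x)%:E)%E.
  apply: eq_integral => x _; rewrite ge0_integralZl_real.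
  - by rewrite integral_gaussian_pdf// mule1.
  - exact: measurable_gaussian_pdf.
  - by move=> y; exact: gaussian_pdf_ge0.
  - by rewrite mulr_ge0 ?expR_ge0 ?gaussian_pdf_ge0.
rewrite ge0_integralZl_real ?expR_ge0//; last 2 first.
- exact: measurable_gaussian_pdf.
- by move=> y; exact: gaussian_pdf_ge0.
rewrite integral_gaussian_pdf// mule1; congr (expR _)%:E.
have pi0 : 0 < pi :> R := pi_gt0 R.
rewrite /c; have -> : 2 * pi * v = pi / (a + b).
  by rewrite /v; field; rewrite abn.
have -> : 2 * pi * w = pi * (a + b) / (4 * a * b).
  by rewrite /w; field; rewrite an bn.
rewrite !ln_div ?posrE ?lnM ?posrE ?mulr_gt0//.
by field.
Qed.

End gaussian_integral2.

(** * Poincare inequality for the Ornstein-Uhlenbeck kernel *)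

Lemma bernoulli_ineq (R : realType) (e : R) n : 0 <= e ->
  1 + n%:R * e <= (1 + e) ^+ n.
Proof.
move=> e0; elim: n => [|n IH]; first by rewrite expr0 mul0r addr0.
have e1 : 0 <= 1 + e by rewrite addr_ge0.
rewrite exprS; apply: (le_trans _ (ler_wpM2l e1 IH)).
rewrite -natr1; have : 0 <= n%:R * e * e by rewrite !mulr_ge0.
by nra.
Qed.

(** Iterating the hypothesis gives [(b r / V) ^ (2 ^ k) <= b (r ^ (2 ^ k)) / V].
    As [b] is at most linear near [0], taking [2 ^ k]-th roots leaves
    [b r / V <= r], whatever the constant [C] of the linear bound. *)
Lemma le_of_square_ineq (R : realType) (b : R -> R) (V C D r : R) :
  0 <= V -> 0 <= C -> 0 <= D -> 0 < r -> r < 1 ->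
  (forall q, 0 < q -> q < 1 -> b q ^+ 2 <= V * b (q ^+ 2)) ->
  (forall q, 0 < q -> q < 1 -> D * q ^+ 2 <= 2^-1 -> b q <= C * q) ->
  b r <= r * V.
Proof.
move=> V0 C0 D0 r0 r1 bsq blin; rewrite leNgt; apply/negP => rVb.
have b0 : 0 < b r by apply: le_lt_trans rVb; apply: mulr_ge0 => //; exact: ltW.
have Vp : 0 < V.
  rewrite lt_def V0 andbT; apply/eqP => V00.
  have := bsq _ r0 r1; rewrite V00 mul0r leNgt => /negP; apply.
  by rewrite exprn_gt0.
have [x xE] : exists x, x = b r / V by exists (b r / V).
have xr : r < x by rewrite xE ltr_pdivlMr.
have x0 : 0 < x by rewrite (lt_trans r0).
have rn0 n : 0 < r ^+ n by rewrite exprn_gt0.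
have rn1 n : (0 < n)%N -> r ^+ n < 1.
  by move=> n0; rewrite expr_lt1// ltW.
have pow k : x ^+ (2 ^ k) <= b (r ^+ (2 ^ k)) / V.
  elim: k => [|k IH]; first by rewrite expn0 !expr1 xE.
  have e2 : (0 < 2 ^ k)%N by rewrite expn_gt0.
  have := bsq _ (rn0 (2 ^ k)%N) (rn1 _ e2).
  rewrite expnS mulnC !exprM => H.
  rewrite ler_pdivlMr//.
  have a0 : 0 <= x ^+ (2 ^ k) by rewrite exprn_ge0// ltW.
  have : (x ^+ (2 ^ k)) ^+ 2 <= (b (r ^+ (2 ^ k)) / V) ^+ 2.
    by rewrite ler_sqr ?nnegrE// (le_trans a0).
  rewrite expr_div_n ler_pdivlMr ?exprn_gt0// => H2.
  have := le_trans H2 H; rewrite (expr2 V) mulrA (mulrC V).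
  by rewrite ler_pM2r.
have [e eE] : exists e, e = x / r - 1 by exists (x / r - 1).
have e0 : 0 < e by rewrite eE subr_gt0 ltr_pdivlMr ?mul1r.
have [f fE] : exists f, f = r^-1 - 1 by exists (r^-1 - 1).
have f0 : 0 < f by rewrite fE subr_gt0 -[ltLHS]invr1 ltf_pV2 ?posrE.
pose k := (Num.truncn (C / V / e)).+1; pose l := (Num.truncn (2 * D / f)).+1.
have Ck : C / V < k%:R * e by rewrite -ltr_pdivrMr// truncnS_gt.
have dl : 2 * D < l%:R * f by rewrite -ltr_pdivrMr// truncnS_gt.
clearbody k l; pose m := (k + l)%N.
have [n nE] : exists n, n = (2 ^ m)%N by exists (2 ^ m)%N.
have mn : (m < n)%N by rewrite nE; exact: ltn_expl.
have n0 : (0 < n)%N by rewrite nE expn_gt0.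
have kn : (k <= n)%N by rewrite (leq_trans (leq_addr l k))// ltnW.
have lln : (l <= n)%N by rewrite (leq_trans (leq_addl k l))// ltnW.
have rp := rn0 n.
have dr : D * (r ^+ n) ^+ 2 <= 2^-1.
  have rle : r ^+ n <= 1 by rewrite ltW// rn1.
  have dr1 : D * r ^+ n <= 2^-1.
    have B := bernoulli_ineq n (ltW f0).
    have E : (1 + f) ^+ n * r ^+ n = 1.
      by rewrite -exprMn fE subrKC mulVf ?expr1n// gt_eqF.
    have : 2 * D <= (1 + f) ^+ n.
      apply: le_trans B; apply: (@le_trans _ _ (n%:R * f)); last by rewrite lerDr.
      by apply: le_trans (ltW dl) _; rewrite ler_pM2r// ler_nat.
    move=> /(fun h => ler_wpM2r (ltW rp) h); rewrite E.
    by rewrite -mulrA; lra.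
  apply: le_trans dr1; rewrite expr2 mulrA ler_piMr//.
  by apply: mulr_ge0 => //; exact: ltW.
have H2 := blin _ rp (rn1 _ n0) dr.
have := pow m; rewrite -nE ler_pdivlMr// => H1.
have : x ^+ n <= C / V * r ^+ n.
  by rewrite mulrAC ler_pdivlMr//; exact: le_trans H1 H2.
rewrite -ler_pdivrMr// -expr_div_n => H3.
have := bernoulli_ineq n (ltW e0); rewrite {2}eE subrKC => H4.
have := le_trans H4 H3.
have : k%:R * e <= n%:R * e by rewrite ler_pM2r// ler_nat.
lra.
Qed.

Section ornstein_uhlenbeck.
Context (R : realType) (d : nat).
Local Notation L := (@lebesgue_Rd R d).
Local Notation gauss := (@std_gaussian R d).
Local Notation p := (@std_gaussian_pdf R d).
Implicit Types (x y z : Rd R d) (r : R) (g : Rd R d -> R).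

Lemma measurable_std_gaussian_pdf : measurable_fun setT p.
Proof. exact: measurable_gaussian_pdf. Qed.

Lemma std_gaussian_pdf_ge0 x : 0 <= p x.
Proof. exact: gaussian_pdf_ge0. Qed.

Lemma std_gaussianE A : measurable A ->
  (gauss A = \int[L]_(x in A) (p x)%:E)%E.
Proof. by []. Qed.

Definition ou_pdf r x y : R := gaussian_pdf (scale r x) (1 - r ^+ 2) y.

Let sqr1 r : 0 < r -> r < 1 -> 0 < 1 - r ^+ 2.
Proof. by move=> r0 r1; rewrite subr_gt0 expr_lt1// ltW. Qed.

Lemma ou_pdf_ge0 r x y : 0 <= ou_pdf r x y.
Proof. exact: gaussian_pdf_ge0. Qed.

Lemma measurable_ou_pdf r : 0 < r -> r < 1 ->
  measurable_fun setT (fun z : Rd R d * Rd R d => ou_pdf r z.1 z.2).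
Proof.
move=> r0 r1; rewrite /ou_pdf.
under eq_fun do rewrite (gaussian_pdfE _ _ (sqr1 r0 r1)) sqdist_scale.
have mN1 : measurable_fun setT (fun z : Rd R d * Rd R d => sqnorm z.1) :=
  measurableT_comp (@measurable_sqnorm R d) measurable_fst.
have mN2 : measurable_fun setT (fun z : Rd R d * Rd R d => sqnorm z.2) :=
  measurableT_comp (@measurable_sqnorm R d) measurable_snd.
apply: measurableT_comp => //; apply: measurable_funB => //.
apply: measurable_funM => //; apply: measurable_funD.
  apply: measurable_funB; first exact: mN2.
  by apply: measurable_funM => //; apply: measurable_dot;
    [exact: measurable_fst | exact: measurable_snd].
by apply: measurable_funM => //; exact: mN1.
Qed.

Lemma integral_ou_pdf r x : 0 < r -> r < 1 ->
  (\int[L]_y (ou_pdf r x y)%:E = 1)%E.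
Proof. by move=> r0 r1; exact: integral_gaussian_pdf (sqr1 r0 r1). Qed.

Lemma ou_flowE r x y : 0 < r -> r < 1 ->
  p x * ou_pdf r x y = expR (- d%:R * ln (2 * pi) - d%:R / 2 * ln (1 - r ^+ 2)
    - (4 * (1 + r))^-1 * (sqnorm x + 2 * dot x y + sqnorm y)
    - (4 * (1 - r))^-1 * (sqnorm x - 2 * dot x y + sqnorm y)).
Proof.
move=> r0 r1; have s0 := sqr1 r0 r1; have pi0 := pi_gt0 R.
rewrite std_gaussian_pdfE /ou_pdf gaussian_pdfE// -expRD; congr expR.
rewrite sqdist_scale [in LHS](lnM (x := 2 * pi)) ?posrE ?mulr_gt0//.
have n1 : 1 + r != 0 by rewrite gt_eqF// addr_gt0.
have n2 : 1 - r != 0 by rewrite gt_eqF// subr_gt0.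
have -> : 1 - r ^+ 2 = (1 - r) * (1 + r) by ring.
by field; rewrite n1 n2.
Qed.

Lemma ou_flow_sym r x y : 0 < r -> r < 1 ->
  p x * ou_pdf r x y = p y * ou_pdf r y x.
Proof.
move=> r0 r1; rewrite !ou_flowE//; congr expR; rewrite (dotC y x); ring.
Qed.

(** Going from [x] to [y] with correlation [r ^ 2] is passing through a point
    [z] that has correlation [r] with both. *)
Lemma ou_gram r x y : 0 < r -> r < 1 ->
  (\int[gauss]_z (ou_pdf r z x * ou_pdf r z y)%:E)%E =
  (p x * ou_pdf (r ^+ 2) x y)%:E.
Proof.
move=> r0 r1; have s0 := sqr1 r0 r1; have pi0 := pi_gt0 R.
have r20 : 0 < r ^+ 2 by rewrite exprn_gt0.
have r21 : r ^+ 2 < 1 by rewrite expr_lt1// ltW.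
have q0 : 0 < 1 + r ^+ 2 by rewrite addr_gt0.
have mou u : measurable_fun setT (fun z => ou_pdf r z u).
  exact: (measurable_section2 (measurable_ou_pdf r0 r1)).
rewrite (ge0_integral_density measurable_std_gaussian_pdf std_gaussian_pdf_ge0
  std_gaussianE); last 2 first.
- by apply/measurable_EFinP; apply: measurable_funM; exact: mou.
- by move=> z; rewrite lee_fin mulr_ge0 ?ou_pdf_ge0.
pose a := r / (1 + r ^+ 2); pose v := (1 - r ^+ 2) / (1 + r ^+ 2).
have v0 : 0 < v by rewrite divr_gt0.
transitivity (\int[L]_z (p x * ou_pdf (r ^+ 2) x y *
    gaussian_pdf (lincomb a a x y) v z)%:E)%E; last first.
  rewrite ge0_integralZl_real.
  - by rewrite integral_gaussian_pdf// mule1.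
  - exact: measurable_gaussian_pdf.
  - by move=> z; exact: gaussian_pdf_ge0.
  - by rewrite mulr_ge0 ?ou_pdf_ge0 ?std_gaussian_pdf_ge0.
apply: eq_integral => z _; rewrite -EFinM; congr EFin.
rewrite ou_flowE// /ou_pdf std_gaussian_pdfE !gaussian_pdfE// -!expRD.
congr expR; rewrite !sqdist_scale sqdist_lincomb.
have -> : 1 - (r ^+ 2) ^+ 2 = (1 - r ^+ 2) * (1 + r ^+ 2) by ring.
rewrite /v /a !(ln_div, lnM) ?posrE ?mulr_gt0 ?divr_gt0 ?invr_gt0//.
have n3 : 1 + r ^+ 2 != 0 by rewrite gt_eqF.
have -> : ln (1 - r ^+ 2) = ln (1 - r) + ln (1 + r) :> R.
  by rewrite -lnM ?posrE ?subr_gt0 ?addr_gt0//; congr ln; ring.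
have n4 : 1 - r ^+ 2 != 0 by rewrite gt_eqF.
by field; rewrite n3 n4.
Qed.

Definition ou_op r := kernel_op L (ou_pdf r).

Let ou_t1 r : 0 < r -> r < 1 -> forall x, (\int[L]_y (ou_pdf r x y)%:E <= 1)%E.
Proof. by move=> r0 r1 x; rewrite integral_ou_pdf. Qed.

Lemma unit_fun_ou_op r g : 0 < r -> r < 1 -> unit_fun g ->
  unit_fun (ou_op r g).
Proof.
move=> r0 r1; apply: unit_fun_kernel_op.
- exact: measurable_ou_pdf.
- exact: ou_pdf_ge0.
- exact: ou_t1.
Qed.

Lemma ou_holding r x : 0 < r -> r < 1 -> holding L (ou_pdf r) x = 0.
Proof. by move=> r0 r1; rewrite /holding integral_ou_pdf// subrr. Qed.

Lemma integral_ou_op r g : 0 < r -> r < 1 -> unit_fun g ->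
  (\int[gauss]_x (g x * ou_op r g x))%:E =
  (\int[L]_x \int[L]_y (g x * g y * (p x * ou_pdf r x y))%:E)%E.
Proof.
move=> r0 r1 ug; have uP := unit_fun_ou_op r0 r1 ug.
rewrite -unit_fun_integralE; last exact: unit_funM.
rewrite (integral_kernel_op (measurable_std_gaussian_pdf) std_gaussian_pdf_ge0
  std_gaussianE (measurable_ou_pdf r0 r1) (@ou_pdf_ge0 r) (ou_t1 r0 r1) ug ug).
under [X in (_ + X)%E]eq_integral do rewrite ou_holding// mulr0.
by rewrite integral0 adde0.
Qed.

Lemma ou_op_mean r g : 0 < r -> r < 1 -> unit_fun g ->
  \int[gauss]_x ou_op r g x = \int[gauss]_x g x.
Proof.
move=> r0 r1 ug.
apply: (integral_kernel_op1 measurable_std_gaussian_pdf std_gaussian_pdf_ge0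
  std_gaussianE (measurable_ou_pdf r0 r1) (@ou_pdf_ge0 r) (ou_t1 r0 r1) _ ug).
by move=> x y; exact: ou_flow_sym.
Qed.

Lemma ou_op_square r g : 0 < r -> r < 1 -> unit_fun g ->
  \int[gauss]_x (ou_op r g x * ou_op r g x) =
  \int[gauss]_x (g x * ou_op (r ^+ 2) g x).
Proof.
move=> r0 r1 ug; have uP := unit_fun_ou_op r0 r1 ug.
have r20 : 0 < r ^+ 2 by rewrite exprn_gt0.
have r21 : r ^+ 2 < 1 by rewrite expr_lt1// ltW.
apply: EFin_inj; rewrite [RHS](integral_ou_op r20 r21 ug).
rewrite -unit_fun_integralE; last exact: unit_funM.
rewrite (gram_flow L (p := p) (nu := gauss) (psi := fun x z => ou_pdf r z x)
  (t := ou_pdf (r ^+ 2)) _ _ _ ug ug); last 3 first.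
- apply: (measurableT_comp (f := fun v : Rd R d * Rd R d => ou_pdf r v.1 v.2)
    (g := fun v : Rd R d * Rd R d => (v.2, v.1))); first exact: measurable_ou_pdf.
  exact: measurable_fun_pair measurable_snd measurable_fst.
- by move=> x z; exact: ou_pdf_ge0.
- by move=> x y; rewrite ou_gram.
apply: eq_integral => z _.
have -> : feature L (fun x z => ou_pdf r z x) g z = (ou_op r g z)%:E.
  rewrite /ou_op /kernel_op ou_holding// mul0r addr0 /feature fineK.
    by apply: eq_integral => x _; rewrite mulrC.
  rewrite ge0_fin_numE; last first.
    by apply: integral_EFin_ge0 => y; rewrite mulr_ge0 ?ou_pdf_ge0 ?(unit_fun_ge0 ug).
  apply: le_lt_trans (ltry 1); rewrite -(integral_ou_pdf z r0 r1).
  have m1 := measurable_section1 (measurable_ou_pdf r0 r1) z.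
  apply: ge0_le_integral_EFin.
  - by apply: measurable_funM; [exact: m1 | exact: ug.1].
  - exact: m1.
  - by move=> y; rewrite mulr_ge0 ?ou_pdf_ge0 ?(unit_fun_ge0 ug).
  - by move=> y; rewrite ler_piMr ?ou_pdf_ge0 ?(unit_fun_le1 ug).
by rewrite -EFinM.
Qed.

Definition gauss_variance g : R :=
  \int[gauss]_x (g x * g x) - (\int[gauss]_x g x) ^+ 2.

Definition autocov r g : R :=
  \int[gauss]_x (g x * ou_op r g x) - (\int[gauss]_x g x) ^+ 2.

Lemma gauss_variance_ge0 g : unit_fun g -> 0 <= gauss_variance g.
Proof.
move=> ug; have H := integral_square_affine gauss 1 0 (- \int[gauss]_x g x) ug ug.
have : 0 <= \int[gauss]_x (1 * g x + 0 * g x + - \int[gauss]_x g x) ^+ 2.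
  by apply: Rintegral_ge0 => x _; exact: sqr_ge0.
rewrite H /gauss_variance; move: (\int[gauss]_x (g x * g x)) (\int[gauss]_x g x).
by move=> A m; nra.
Qed.

(** Cauchy-Schwarz, as [autocov (r ^ 2) g] is the variance of [ou_op r g]. *)
Lemma autocov_sqr_le r g : 0 < r -> r < 1 -> unit_fun g ->
  autocov r g ^+ 2 <= gauss_variance g * autocov (r ^+ 2) g.
Proof.
move=> r0 r1 ug; have uP := unit_fun_ou_op r0 r1 ug.
have mP := ou_op_mean r0 r1 ug; have sP := ou_op_square r0 r1 ug.
have expand (A m b c s : R) :
    s ^+ 2 * A + (- 1) ^+ 2 * c + ((1 - s) * m) ^+ 2 + 2 * s * (- 1) * b
      + 2 * s * ((1 - s) * m) * m + 2 * (- 1) * ((1 - s) * m) * m =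
    s ^+ 2 * (A - m ^+ 2) - 2 * s * (b - m ^+ 2) + (c - m ^+ 2) by ring.
have key s : 0 <= s ^+ 2 * gauss_variance g - 2 * s * autocov r g + autocov (r ^+ 2) g.
  have H := integral_square_affine gauss s (- 1) ((1 - s) * \int[gauss]_x g x) ug uP.
  have : 0 <= \int[gauss]_x (s * g x + - 1 * ou_op r g x +
      (1 - s) * (\int[gauss]_x g x)) ^+ 2.
    by apply: Rintegral_ge0 => x _; exact: sqr_ge0.
  by rewrite H mP sP expand.
have V0 := gauss_variance_ge0 ug; clear mP sP.
move: key V0; move: (gauss_variance g) (autocov r g) (autocov (r ^+ 2) g) => V b c key V0.
have [V00|Vn0] := eqVneq V 0.
  rewrite V00 mul0r; suff -> : b = 0 by rewrite expr0n.
  have [//|bn0] := eqVneq b 0; exfalso.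
  have := key ((c + 1) / (2 * b)); rewrite V00 mulr0 add0r.
  have -> : 2 * ((c + 1) / (2 * b)) * b = c + 1 by field.
  lra.
have Vp : 0 < V by rewrite lt_def Vn0.
have := key (b / V).
have -> : (b / V) ^+ 2 * V - 2 * (b / V) * b + c = (V * c - b ^+ 2) / V by field.
by rewrite pmulr_lge0 ?invr_gt0// subr_ge0.
Qed.

(** With [k] the density of the flow relative to [p x * p y] and [G = g x * g y] in
    [0, 1], one has [G * (k - 1) <= r / 2 + (k - 1) ^ 2 / (2 * r)]. The integral of
    the square is the chi-square divergence [(1 - r ^ 2) ^ (- d) - 1], which is of
    order [r ^ 2]. *)
Lemma autocov_small r g : 0 < r -> r < 1 -> d%:R * r ^+ 2 <= 2^-1 ->
  unit_fun g -> autocov r g <= (2^-1 + d%:R) * r.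
Proof.
move=> r0 r1 dr ug; have uP := unit_fun_ou_op r0 r1 ug.
have pi0 := pi_gt0 R; pose rV := r^-1.
have rV0 : 0 < rV by rewrite invr_gt0.
have rrV : r * rV = 1 by rewrite mulfV ?gt_eqF.
have conclude (b m2 e : R) : e <= 1 + 2 * d%:R * r ^+ 2 ->
    b + rV <= m2 + (r / 2 + rV / 2 + rV / 2 * e) -> b - m2 <= (2^-1 + d%:R) * r.
  move=> e1; have rV2 : rV * r ^+ 2 = r by rewrite expr2 mulrA (mulrC rV) rrV mul1r.
  have := ler_wpM2l (ltW (divr_gt0 rV0 (ltr0n R 2))) e1.
  have -> : rV / 2 * (1 + 2 * d%:R * r ^+ 2) = rV / 2 + d%:R * (rV * r ^+ 2).
    by move: rV {rV0 rrV rV2} => v; field.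
  by rewrite rV2; lra.
have eq_leq2 (u v : \bar R) : u = v -> (u <= v)%E by move=> ->.
have mp := measurable_std_gaussian_pdf; have p0 := std_gaussian_pdf_ge0.
have mp1 : measurable_fun setT (fun z : Rd R d * Rd R d => p z.1) :=
  measurableT_comp mp measurable_fst.
have mp2 : measurable_fun setT (fun z : Rd R d * Rd R d => p z.2) :=
  measurableT_comp mp measurable_snd.
have mg1 : measurable_fun setT (fun z : Rd R d * Rd R d => g z.1) :=
  measurableT_comp ug.1 measurable_fst.
have mg2 : measurable_fun setT (fun z : Rd R d * Rd R d => g z.2) :=
  measurableT_comp ug.1 measurable_snd.
have g0 := unit_fun_ge0 ug; have g1 := unit_fun_le1 ug.
pose s x y := p x * ou_pdf r x y.
pose q x y := expR (- d%:R * ln (2 * pi) - d%:R * ln (1 - r ^+ 2)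
    - ((1 - r) / (4 * (1 + r))) * (sqnorm x + 2 * dot x y + sqnorm y)
    - ((1 + r) / (4 * (1 - r))) * (sqnorm x - 2 * dot x y + sqnorm y)).
have n1 : 0 < 1 + r by rewrite addr_gt0.
have n2 : 0 < 1 - r by rewrite subr_gt0.
have n1' : 1 + r != 0 by rewrite gt_eqF.
have n2' : 1 - r != 0 by rewrite gt_eqF.
have pp0 x : 0 < p x by rewrite std_gaussian_pdfE expR_gt0.
have sE x y : s x y ^+ 2 = q x y * (p x * p y).
  rewrite /s ou_flowE// /q !std_gaussian_pdfE -!expRD -expRM_natl; congr expR.
  by rewrite mulr2n; field; rewrite n1' n2'.
have q0 x y : 0 <= q x y by exact: expR_ge0.
have s0 x y : 0 <= s x y by rewrite /s mulr_ge0 ?ou_pdf_ge0.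
have ms : measurable_fun setT (fun z : Rd R d * Rd R d => s z.1 z.2).
  by apply: measurable_funM; [exact: mp1 | exact: measurable_ou_pdf].
have mN1 : measurable_fun setT (fun z : Rd R d * Rd R d => sqnorm z.1) :=
  measurableT_comp (@measurable_sqnorm R d) measurable_fst.
have mN2 : measurable_fun setT (fun z : Rd R d * Rd R d => sqnorm z.2) :=
  measurableT_comp (@measurable_sqnorm R d) measurable_snd.
have md : measurable_fun setT (fun z : Rd R d * Rd R d => dot z.1 z.2).
  by apply: measurable_dot; [exact: measurable_fst | exact: measurable_snd].
have mq : measurable_fun setT (fun z : Rd R d * Rd R d => q z.1 z.2).
  apply: measurableT_comp => //; apply: measurable_funB; last first.
    apply: measurable_funM => //; apply: measurable_funD; last exact: mN2.
    by apply: measurable_funB; [exact: mN1 | exact: measurable_funM].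
  apply: measurable_funB => //.
  apply: measurable_funM => //; apply: measurable_funD; last exact: mN2.
  by apply: measurable_funD; [exact: mN1 | exact: measurable_funM].
have mpp : measurable_fun setT (fun z : Rd R d * Rd R d => p z.1 * p z.2).
  exact: (measurable_funM mp1 mp2).
have mgg : measurable_fun setT (fun z : Rd R d * Rd R d => g z.1 * g z.2).
  exact: (measurable_funM mg1 mg2).
pose I2 (F : Rd R d -> Rd R d -> R) := (\int[L]_x \int[L]_y (F x y)%:E)%E.
have int_s : I2 s = 1%:E.
  rewrite /I2; transitivity (\int[L]_x (p x)%:E)%E; last exact: integral_gaussian_pdf.
  apply: eq_integral => x _; rewrite ge0_integralZl_real//.
  - by rewrite integral_ou_pdf// mule1.
  - exact: (measurable_section1 (measurable_ou_pdf r0 r1)).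
  - by move=> y; exact: ou_pdf_ge0.
have int_pp : I2 (fun x y => p x * p y) = 1%:E.
  rewrite /I2; transitivity (\int[L]_x (p x)%:E)%E; last exact: integral_gaussian_pdf.
  apply: eq_integral => x _; rewrite ge0_integralZl_real//.
  by rewrite integral_gaussian_pdf// mule1.
have int_ggpp : I2 (fun x y => g x * g y * (p x * p y)) =
    ((\int[gauss]_x g x) ^+ 2)%:E.
  have e : (\int[L]_y (g y * p y)%:E)%E = (\int[gauss]_x g x)%:E.
    rewrite -unit_fun_integralE// (ge0_integral_density mp p0 std_gaussianE).
    - by apply: eq_integral => x _; rewrite EFinM.
    - by apply/measurable_EFinP; exact: ug.1.
    - by move=> x; rewrite lee_fin.
  have mgp : measurable_fun setT (fun y => g y * p y).
    by apply: measurable_funM; [exact: ug.1|].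
  rewrite /I2; transitivity (\int[L]_x ((\int[gauss]_x g x) * (g x * p x))%:E)%E.
    apply: eq_integral => x _.
    transitivity (\int[L]_y ((g x * p x) * (g y * p y))%:E)%E.
      by apply: eq_integral => y _; congr EFin; ring.
    rewrite ge0_integralZl_real ?e//.
    - by rewrite -EFinM mulrC.
    - by move=> y; rewrite mulr_ge0.
    - by rewrite mulr_ge0.
  rewrite ge0_integralZl_real ?e -?EFinM ?expr2//.
  - by move=> y; rewrite mulr_ge0.
  - by have /andP[] := unit_fun_integral_le1 gauss ug.
have int_q : I2 q = (expR (- d%:R * ln (1 - r ^+ 2)))%:E.
  rewrite /I2 /q gaussian_integral2 ?divr_gt0 ?mulr_gt0//; congr (expR _)%:E.
  have -> : 4 * ((1 - r) / (4 * (1 + r))) * ((1 + r) / (4 * (1 - r))) =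
     (2 * 2)^-1 :> R by field; rewrite n1' n2'.
  by rewrite lnV ?posrE ?mulr_gt0// !lnM ?posrE//; field.
have q1 : expR (- d%:R * ln (1 - r ^+ 2)) <= 1 + 2 * d%:R * r ^+ 2.
  have u0 : 0 < 1 - r ^+ 2 := sqr1 r0 r1.
  have -> : - d%:R * ln (1 - r ^+ 2) = - (ln (1 - r ^+ 2) * d%:R) by ring.
  rewrite expRN expRM_natr lnK ?posrE//.
  have bern m : 1 - m%:R * r ^+ 2 <= (1 - r ^+ 2) ^+ m.
    have rr : 0 <= r ^+ 2 by rewrite sqr_ge0.
    elim: m => [|m IH]; first by rewrite expr0 mul0r subr0.
    rewrite [leRHS]exprS; apply: (le_trans _ (ler_wpM2l (ltW u0) IH)).
    rewrite -natr1; have : 0 <= m%:R * r ^+ 2 * r ^+ 2.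
      by apply: mulr_ge0 => //; apply: mulr_ge0 => //; exact: ler0n.
    nra.
  have pos : 0 < 1 - d%:R * r ^+ 2 by lra.
  apply: (@le_trans _ _ (1 - d%:R * r ^+ 2)^-1).
    by rewrite lef_pV2 ?posrE ?exprn_gt0.
  rewrite -[leLHS]mul1r ler_pdivrMr//.
  have : 0 <= d%:R * r ^+ 2 by rewrite mulr_ge0 ?ler0n ?sqr_ge0.
  nra.
have ptw x y : g x * g y * s x y + rV * s x y <=
    g x * g y * (p x * p y) + ((r / 2 + rV / 2) * (p x * p y) + rV / 2 * q x y).
  have pxy : 0 < p x * p y by rewrite mulr_gt0.
  have := sE x y; move: (p x * p y) (s x y) (q x y) (g x * g y) pxy (s0 x y)
    (mulr_ge0 (g0 x) (g0 y)) (mulr_ile1 (g0 x) (g0 y) (g1 x) (g1 y)).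
  move=> P S Q G P0 S0 G0 G1 SQ.
  have -> : Q = S ^+ 2 / P by rewrite SQ; field; rewrite gt_eqF.
  rewrite -subr_ge0.
  have -> : G * P + ((r / 2 + rV / 2) * P + rV / 2 * (S ^+ 2 / P)) -
    (G * S + rV * S) = (P / 2 * rV) * (((S / P - 1) - r * G) ^+ 2 +
      (r ^+ 2) * (1 - G ^+ 2)).
    rewrite (_ : r = rV^-1); last by rewrite invrK.
    by field; rewrite !gt_eqF.
  apply: mulr_ge0; first by rewrite ltW// mulr_gt0// divr_gt0.
  apply: addr_ge0; first exact: sqr_ge0.
  by apply: mulr_ge0; [exact: sqr_ge0 | rewrite subr_ge0 expr_le1].
have ms1 : measurable_fun setT
    (fun z : Rd R d * Rd R d => g z.1 * g z.2 * s z.1 z.2) by exact: measurable_funM.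
have ms2 : measurable_fun setT (fun z : Rd R d * Rd R d => rV * s z.1 z.2).
  exact: measurable_funM.
have ms3 : measurable_fun setT
    (fun z : Rd R d * Rd R d => g z.1 * g z.2 * (p z.1 * p z.2)).
  exact: measurable_funM.
have ms4 : measurable_fun setT
    (fun z : Rd R d * Rd R d => (r / 2 + rV / 2) * (p z.1 * p z.2)).
  exact: measurable_funM.
have ms5 : measurable_fun setT (fun z : Rd R d * Rd R d => rV / 2 * q z.1 z.2).
  exact: measurable_funM.
have ms45 := measurable_funD ms4 ms5.
have gs0 x y : 0 <= g x * g y * s x y by apply: mulr_ge0 => //; exact: mulr_ge0.
have rs0 x y : 0 <= rV * s x y by apply: mulr_ge0 => //; exact: ltW.
have gp0 x y : 0 <= g x * g y * (p x * p y).
  by apply: mulr_ge0; exact: mulr_ge0.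
have c0 : 0 <= r / 2 + rV / 2 by rewrite addr_ge0 ?divr_ge0 ?ltW.
have pq0 x y : 0 <= p x * p y by rewrite mulr_ge0.
have cp0 x y : 0 <= (r / 2 + rV / 2) * (p x * p y) by rewrite mulr_ge0.
have rV20 : 0 <= rV / 2 by rewrite divr_ge0 ?ltW.
have rq0 x y : 0 <= rV / 2 * q x y by rewrite mulr_ge0.
have cq0 x y : 0 <= (r / 2 + rV / 2) * (p x * p y) + rV / 2 * q x y.
  exact: addr_ge0.
have sum0 x y : 0 <= g x * g y * s x y + rV * s x y by exact: addr_ge0.
have HA : _ = (_ + rV%:E * I2 s)%E :=
  etrans (ge0_integral2D L L ms1 ms2 gs0 rs0)
    (congr1 (adde _) (ge0_integral2Zl L L ms s0 (ltW rV0))).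
have HB : _ = (_ + (_ + (rV / 2)%:E * I2 q))%E :=
  etrans (ge0_integral2D L L ms3 ms45 gp0 cq0) (congr1 (adde _)
    (etrans (ge0_integral2D L L ms4 ms5 cp0 rq0) (f_equal2 adde
      (ge0_integral2Zl L L mpp pq0 c0) (ge0_integral2Zl L L mq q0 rV20)))).
have H2 := ge0_le_integral2 L L (measurable_funD ms1 ms2)
  (measurable_funD ms3 ms45) sum0 ptw.
have H : ((\int[gauss]_x (g x * ou_op r g x))%R%:E + rV%:E * 1%:E <=
    ((\int[gauss]_x g x) ^+ 2)%R%:E + ((r / 2 + rV / 2)%R%:E * 1%:E +
     (rV / 2)%R%:E * (expR (- d%:R * ln (1 - r ^+ 2)))%R%:E))%E.
  rewrite (integral_ou_op r0 r1 ug) -{1}int_s -int_q -int_ggpp -int_pp.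
  exact: (le_trans (eq_leq2 _ _ (esym HA)) (le_trans H2 (eq_leq2 _ _ HB))).
move: H; rewrite !mule1 -EFinM -!EFinD lee_fin => H.
exact: conclude q1 H.
Qed.

(** The spectral gap of the kernel is obtained without Hermite polynomials, from
    the semigroup property at small correlations. *)
Lemma ou_poincare r g : 0 < r -> r < 1 -> unit_fun g ->
  autocov r g <= r * gauss_variance g.
Proof.
move=> r0 r1 ug; have V0 := gauss_variance_ge0 ug.
have C0 : 0 <= 2^-1 + d%:R :> R by rewrite addr_ge0.
exact: (@le_of_square_ineq R (autocov ^~ g) (gauss_variance g) (2^-1 + d%:R) d%:R r
  V0 C0 (ler0n _ _) r0 r1 (fun q q0 q1 => autocov_sqr_le q0 q1 ug)
  (fun q q0 q1 dq => autocov_small q0 q1 dq ug)).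
Qed.

End ornstein_uhlenbeck.

(** * The flow of MALA *)

Lemma product_sigma_finite d1 d2 (X : measurableType d1) (Y : measurableType d2)
    (R : realType) (m1 : {sigma_finite_measure set X -> \bar R})
    (m2 : {sigma_finite_measure set Y -> \bar R}) :
  exists m : {sigma_finite_measure set (X * Y)%type -> \bar R},
    (m1 \x m2)%E = m :> (set (X * Y)%type -> \bar R).
Proof.
pose mu : {measure set (X * Y)%type -> \bar R} := (m1 \x m2)%E.
have sf : sigma_finite setT mu.
  have /sigma_finiteP[F [TF ndF Foo]] := sigma_finiteT m1.
  have /sigma_finiteP[G [TG ndG Goo]] := sigma_finiteT m2.
  exists (fun n => F n `*` G n).
    rewrite -setXTT TF TG predeqE => -[x y]; split.
      move=> [/= [n _ Fnx] [k _ Gky]]; exists (maxn n k) => //; split.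
      - by move: x Fnx; exact/subsetPset/ndF/leq_maxl.
      - by move: y Gky; exact/subsetPset/ndG/leq_maxr.
    by move=> [n _ []/= ? ?]; split; exists n.
  move=> k; have [? ?] := Foo k; have [? ?] := Goo k.
  split; first exact: measurableX.
  by rewrite /mu /= product_measure1E// lte_mul_pinfty// ge0_fin_numE.
pose S := Measure_isSigmaFinite.Build _ _ _ mu sf.
pose nu : {sigma_finite_measure set (X * Y)%type -> \bar R} :=
  HB.pack (Measure.sort mu) (Measure.class mu) S.
by exists nu.
Qed.

Lemma measurable_ler_set d (X : measurableType d) (R : realType) (f g : X -> R) :
  measurable_fun setT f -> measurable_fun setT g ->
  measurable [set x | f x <= g x].
Proof.
move=> mf mg; have := measurable_fun_ler mf mg measurableT (Y := [set true]).
by rewrite setTI; apply.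
Qed.

Section mala_flow.
Context (R : realType) (d : nat) (h : R).
Hypotheses (h0 : 0 < h) (h1 : h < 1).
Local Notation L := (@lebesgue_Rd R d).
Local Notation gauss := (@std_gaussian R d).
Local Notation p := (@std_gaussian_pdf R d).
Implicit Types (x y : Rd R d).

Definition mala_pdf x y : R := mala_proposal_pdf h x y * mala_accept h x y.

(** The geometric mean of the proposal flow and of its reverse. *)
Definition sym_flow x y : R :=
  expR (- (d%:R / 2) * (ln (2 * pi) + ln (2 * pi * (2 * h)))
    - ((2 + h) / 16) * (sqnorm x + 2 * dot x y + sqnorm y)
    - ((4 - 2 * h + h ^+ 2) / (16 * h)) * (sqnorm x - 2 * dot x y + sqnorm y)).

Definition mala_flow x y : R :=
  sym_flow x y * expR (- (h / 8 * `|sqnorm x - sqnorm y|)).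

Let h0' : 0 < 2 * h. Proof. by rewrite mulr_gt0. Qed.
Let hn0 : h != 0. Proof. by rewrite gt_eqF. Qed.

Lemma proposal_flowE x y : p x * mala_proposal_pdf h x y =
  sym_flow x y * expR (h / 8 * (sqnorm y - sqnorm x)).
Proof.
rewrite std_gaussian_pdfE /mala_proposal_pdf gaussian_pdfE// -!expRD.
by congr expR; rewrite (sqdist_scale (1 - h) x y); field.
Qed.

Lemma sym_flow_sym x y : sym_flow x y = sym_flow y x.
Proof. by rewrite /sym_flow (dotC y x); congr expR; ring. Qed.

Lemma mala_flow_sym x y : mala_flow x y = mala_flow y x.
Proof. by rewrite /mala_flow sym_flow_sym distrC. Qed.

Lemma sym_flow_gt0 x y : 0 < sym_flow x y.
Proof. exact: expR_gt0. Qed.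

Lemma std_gaussian_pdf_gt0 x : 0 < p x.
Proof. by rewrite std_gaussian_pdfE expR_gt0. Qed.

Lemma mala_proposal_pdf_gt0 x y : 0 < mala_proposal_pdf h x y.
Proof. by rewrite /mala_proposal_pdf gaussian_pdfE// expR_gt0. Qed.

(** The flow is the smaller of the proposal flow and its reverse, and their quotient is
    [exp (h / 4 * (|y| ^ 2 - |x| ^ 2))]. *)
Lemma mala_flowE x y : p x * mala_pdf x y = mala_flow x y.
Proof.
have px := std_gaussian_pdf_gt0 x; have qx := mala_proposal_pdf_gt0 x y.
have pq : 0 < p x * mala_proposal_pdf h x y by exact: mulr_gt0.
have minE (a b : R) : 0 < a -> a * Num.min 1 (b / a) = Num.min a b.
  by move=> a0; rewrite minr_pMr ?ltW// mulr1 mulrC divfK// gt_eqF.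
rewrite /mala_pdf mulrA /mala_accept (minE _ _ pq).
rewrite !proposal_flowE (sym_flow_sym y x) /mala_flow.
rewrite -minr_pMr ?ltW ?sym_flow_gt0//; congr (_ * _).
have [xy|xy] := leP (sqnorm x) (sqnorm y).
  rewrite ler0_norm ?subr_le0// min_r; first by congr expR; ring.
  by rewrite ler_expR; have := h0; nra.
rewrite ger0_norm ?subr_ge0 ?ltW// min_l; first by congr expR; ring.
by rewrite ler_expR; have := h0; nra.
Qed.

Lemma mala_accept_ge0 x y : 0 <= mala_accept h x y.
Proof.
rewrite /mala_accept le_min ler01/= divr_ge0// mulr_ge0//.
- exact: ltW (std_gaussian_pdf_gt0 y).
- exact: ltW (mala_proposal_pdf_gt0 y x).
- exact: ltW (std_gaussian_pdf_gt0 x).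
- exact: ltW (mala_proposal_pdf_gt0 x y).
Qed.

Lemma mala_accept_le1 x y : mala_accept h x y <= 1.
Proof. by rewrite /mala_accept ge_min lexx. Qed.

Lemma mala_pdf_ge0 x y : 0 <= mala_pdf x y.
Proof.
by rewrite mulr_ge0 ?mala_accept_ge0// ltW// mala_proposal_pdf_gt0.
Qed.

Lemma mala_pdf_rev x y : p x * mala_pdf x y = p y * mala_pdf y x.
Proof. by rewrite !mala_flowE mala_flow_sym. Qed.

Let P2 := (Rd R d * Rd R d)%type.

Lemma measurable_sqnorm_fst : measurable_fun setT (fun z : P2 => sqnorm z.1).
Proof. exact: measurableT_comp (@measurable_sqnorm R d) measurable_fst. Qed.

Lemma measurable_sqnorm_snd : measurable_fun setT (fun z : P2 => sqnorm z.2).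
Proof. exact: measurableT_comp (@measurable_sqnorm R d) measurable_snd. Qed.

Lemma measurable_dot_pair : measurable_fun setT (fun z : P2 => dot z.1 z.2).
Proof. exact: measurable_dot measurable_fst measurable_snd. Qed.

Lemma measurable_quadratic (k a b c : R) : measurable_fun setT
  (fun z : P2 => k + a * sqnorm z.1 + b * dot z.1 z.2 + c * sqnorm z.2).
Proof.
have mM (u : R) (f : P2 -> R) : measurable_fun setT f ->
    measurable_fun setT (fun z => u * f z) by move=> mf; exact: measurable_funM.
apply: measurable_funD; last exact: mM measurable_sqnorm_snd.
apply: measurable_funD; last exact: mM measurable_dot_pair.
by apply: measurable_funD => //; exact: mM measurable_sqnorm_fst.
Qed.

Lemma measurable_sym_flow : measurable_fun setT (fun z : P2 => sym_flow z.1 z.2).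
Proof.
apply: measurableT_comp => //.
pose s := (2 + h) / 16; pose m := (4 - 2 * h + h ^+ 2) / (16 * h).
have := measurable_quadratic (- (d%:R / 2) * (ln (2 * pi) + ln (2 * pi * (2 * h))))
  (- s - m) (2 * m - 2 * s) (- s - m).
by congr measurable_fun; apply/funext => z; rewrite -/s -/m; ring.
Qed.

Lemma measurable_mala_flow :
  measurable_fun setT (fun z : P2 => mala_flow z.1 z.2).
Proof.
apply: measurable_funM; first exact: measurable_sym_flow.
apply: measurableT_comp => //; apply: measurableT_comp => //.
apply: measurable_funM => //; apply: measurableT_comp => //.
exact: measurable_funB measurable_sqnorm_fst measurable_sqnorm_snd.
Qed.

Lemma measurable_mala_pdf : measurable_fun setT (fun z : P2 => mala_pdf z.1 z.2).
Proof.
have -> : (fun z : P2 => mala_pdf z.1 z.2) = (fun z : P2 =>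
    mala_flow z.1 z.2 * expR (d%:R / 2 * ln (2 * pi) + sqnorm z.1 / 2)).
  apply/funext => z; rewrite -mala_flowE std_gaussian_pdfE mulrAC -expRD.
  by rewrite (_ : _ + _ = 0) ?expR0 ?mul1r//; ring.
apply: measurable_funM; first exact: measurable_mala_flow.
apply: measurableT_comp => //; apply: measurable_funD => //.
by apply: measurable_funM => //; exact: measurable_sqnorm_fst.
Qed.

Lemma integral_mala_proposal_pdf x :
  (\int[L]_y (mala_proposal_pdf h x y)%:E = 1)%E.
Proof. exact: integral_gaussian_pdf. Qed.

Lemma integral_mala_pdf_le1 x : (\int[L]_y (mala_pdf x y)%:E <= 1)%E.
Proof.
rewrite -(integral_mala_proposal_pdf x); apply: ge0_le_integral_EFin.
- exact: measurable_section1 measurable_mala_pdf x.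
- exact: measurable_gaussian_pdf.
- exact: mala_pdf_ge0.
- by move=> y; rewrite ler_piMr ?mala_accept_le1// ltW// mala_proposal_pdf_gt0.
Qed.

(** The flow is a Gram kernel, so MALA is a positive operator: the symmetric
    part is a Gaussian integral of products, and
    [exp (- l |a - b|) = exp (- l a) exp (- l b) min (exp (2 l a), exp (2 l b))],
    where a minimum is the length of an intersection of intervals. *)
Definition mala_feature x (v : Rd R d * measurableTypeR R) : R :=
  let B := (1 - h) / (4 * h) in
  let A := (2 + h ^+ 2) / (8 * h) in
  expR (2^-1 * (- (d%:R / 2) * (ln (2 * pi) + ln (2 * pi * (2 * h))
      + ln (2 * pi * (2 * B)^-1)))
    - (A + B + h / 8) * sqnorm x + 2 * B * dot x v.1 - B / 2 * sqnorm v.1)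
  * \1_(`[0, expR (h / 4 * sqnorm x)]%classic : set R) v.2.

Lemma mala_feature_ge0 x v : 0 <= mala_feature x v.
Proof. by rewrite mulr_ge0 ?expR_ge0// indicE ler0n. Qed.

Lemma measurable_mala_feature : measurable_fun setT
  (fun z : Rd R d * (Rd R d * measurableTypeR R) => mala_feature z.1 z.2).
Proof.
pose T3 := (Rd R d * (Rd R d * measurableTypeR R))%type.
have m1 : measurable_fun setT (fun z : T3 => z.1) by exact: measurable_fst.
have m2 : measurable_fun setT (fun z : T3 => z.2.1).
  exact: measurableT_comp measurable_fst measurable_snd.
have m3 : measurable_fun setT (fun z : T3 => z.2.2 : R).
  exact: measurableT_comp measurable_snd measurable_snd.
have mN1 : measurable_fun setT (fun z : T3 => sqnorm z.1).
  exact: measurableT_comp (@measurable_sqnorm R d) m1.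
have mN2 : measurable_fun setT (fun z : T3 => sqnorm z.2.1).
  exact: measurableT_comp (@measurable_sqnorm R d) m2.
have md : measurable_fun setT (fun z : T3 => dot z.1 z.2.1).
  exact: measurable_dot m1 m2.
have mM (u : R) (f : T3 -> R) : measurable_fun setT f ->
    measurable_fun setT (fun z => u * f z) by move=> mf; exact: measurable_funM.
apply: measurable_funM.
  apply: measurableT_comp => //; apply: measurable_funB; last exact: mM.
  apply: measurable_funD; last exact: mM.
  by apply: measurable_funB => //; exact: mM.
pose D := [set z : T3 | 0 <= (z.2.2 : R)] `&`
  [set z : T3 | (z.2.2 : R) <= expR (h / 4 * sqnorm z.1)].
have mD : measurable D.
  have mE : measurable_fun setT (fun z : T3 => expR (h / 4 * sqnorm z.1)).
    by apply: measurableT_comp => //; exact: mM.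
  apply: measurableI.
    exact: (measurable_ler_set (f := fun=> 0)).
  exact: measurable_ler_set.
have -> : (fun z : T3 => \1_(`[0, expR (h / 4 * sqnorm z.1)]%classic : set R) z.2.2)
    = \1_D :> (T3 -> R).
  apply/funext => z; rewrite !indicE; congr ((nat_of_bool _)%:R).
  by apply/idP/idP; rewrite !inE /D /= in_itv/= => /andP.
exact: measurable_indic.
Qed.

Lemma mala_gram x y :
  (\int[(L \x @lebesgue_measure R)%E]_v (mala_feature x v * mala_feature y v)%:E =
   (p x * mala_pdf x y)%:E)%E.
Proof.
have mfx u : measurable_fun setT (mala_feature u).
  exact: (measurable_section1 measurable_mala_feature u).
rewrite fubini_tonelli1; last 2 first.
- by apply/measurable_EFinP; apply: measurable_funM; exact: mfx.
- by move=> v; rewrite lee_fin mulr_ge0 ?mala_feature_ge0.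
rewrite /fubini_F mala_flowE.
pose B := (1 - h) / (4 * h); have B0 : 0 < B by rewrite divr_gt0 ?subr_gt0 ?mulr_gt0.
pose A := (2 + h ^+ 2) / (8 * h).
pose v := (2 * B)^-1; have v0 : 0 < v by rewrite invr_gt0 mulr_gt0.
pose m := Num.min (expR (h / 4 * sqnorm x)) (expR (h / 4 * sqnorm y)).
have m0 : 0 < m by rewrite lt_min !expR_gt0.
pose c := expR (- (d%:R / 2) * (ln (2 * pi) + ln (2 * pi * (2 * h)))
  - A * (sqnorm x + sqnorm y) + 2 * B * dot x y
  - h / 8 * (sqnorm x + sqnorm y)).
have mint : (\int[@lebesgue_measure R]_s
    (\1_(`[0, m]%classic : set R) s)%:E)%E = m%:E.
  rewrite integral_indic// setIT; apply: (etrans (lebesgue_measure_itv `[0, m])).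
  by rewrite /= lte_fin m0 -EFinB subr0.
transitivity (\int[L]_w (m * c * gaussian_pdf (lincomb 1 1 x y) v w)%:E)%E.
  apply: eq_integral => w _.
  transitivity (\int[@lebesgue_measure R]_s (c * gaussian_pdf (lincomb 1 1 x y) v w *
      \1_(`[0, m]%classic : set R) s)%:E)%E; last first.
    rewrite ge0_integralZl_real ?mint -?EFinM.
    - by congr EFin; ring.
    - exact: measurable_indic.
    - by move=> s; rewrite indicE ler0n.
    - by rewrite mulr_ge0 ?expR_ge0 ?gaussian_pdf_ge0.
  apply: eq_integral => s _; congr EFin; rewrite /mala_feature /=.
  rewrite mulrACA -expRD; congr (_ * _).
    rewrite gaussian_pdfE// -expRD; congr expR.
    rewrite sqdist_lincomb (dotC w x) (dotC w y) -/B -/A -/v /v.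
    by field; rewrite gt_eqF.
  have iE (u : R) : ((s : R) \in (`[0, u]%classic : set R)) = (0 <= s <= u).
    by apply/idP/idP; rewrite inE/= in_itv.
  rewrite !indicE -natrM mulnb !iE /m le_min.
  by case: (0 <= s).
rewrite ge0_integralZl_real.
- rewrite integral_gaussian_pdf// mule1; congr EFin.
  have -> : m * c = c * m by rewrite mulrC.
  rewrite /mala_flow /sym_flow /c /m; have h4 : 0 <= h / 4 by rewrite divr_ge0 ?ltW.
  have [xy|xy] := leP (sqnorm x) (sqnorm y).
    rewrite min_l; last by rewrite ler_expR ler_wpM2l.
    rewrite ler0_norm ?subr_le0// -!expRD.
    by congr expR; rewrite /A /B; field.
  rewrite min_r; last by rewrite ler_expR ler_wpM2l// ltW.
  rewrite gtr0_norm ?subr_gt0// -!expRD.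
  by congr expR; rewrite /A /B; field.
- exact: measurable_gaussian_pdf.
- by move=> w; exact: gaussian_pdf_ge0.
- by rewrite mulr_ge0 ?expR_ge0 ?ltW.
Qed.

Definition mala_op := kernel_op L mala_pdf.

Lemma unit_fun_mala_op g : unit_fun g -> unit_fun (mala_op g).
Proof.
exact: unit_fun_kernel_op measurable_mala_pdf mala_pdf_ge0 integral_mala_pdf_le1 _.
Qed.

Lemma mala_op_mean g : unit_fun g ->
  \int[gauss]_x mala_op g x = \int[gauss]_x g x.
Proof.
exact: integral_kernel_op1 (@measurable_std_gaussian_pdf R d)
  (@std_gaussian_pdf_ge0 R d) (@std_gaussianE R d) measurable_mala_pdf
  mala_pdf_ge0 integral_mala_pdf_le1 mala_pdf_rev g.
Qed.

Lemma mala_dirichlet g : unit_fun g ->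
  (\int[L]_x \int[L]_y ((g x - g y) ^+ 2 * mala_flow x y)%:E)%E =
  (2 * (\int[gauss]_x (g x * g x) - \int[gauss]_x (g x * mala_op g x)))%:E.
Proof.
move=> ug; under eq_integral do under eq_integral do rewrite -mala_flowE.
exact: dirichlet_formE (@measurable_std_gaussian_pdf R d)
  (@std_gaussian_pdf_ge0 R d) (@std_gaussianE R d) measurable_mala_pdf
  mala_pdf_ge0 integral_mala_pdf_le1 mala_pdf_rev g ug.
Qed.

Lemma mala_op_contraction g : unit_fun g ->
  \int[gauss]_x (mala_op g x * mala_op g x) <= \int[gauss]_x (g x * mala_op g x).
Proof.
have [nu nuE] := product_sigma_finite L (@lebesgue_measure R).
have gram x y : (\int[nu]_v (mala_feature x v * mala_feature y v)%:E =
    (p x * mala_pdf x y)%:E)%E by rewrite -nuE mala_gram.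
move=> ug.
exact: (kernel_op_contraction (L := L) (pi := gauss) (p := p) (t := mala_pdf)
  (nu := nu) (psi := mala_feature)
  (@measurable_std_gaussian_pdf R d)
  (@std_gaussian_pdf_ge0 R d) (@std_gaussianE R d) measurable_mala_pdf
  mala_pdf_ge0 integral_mala_pdf_le1 mala_pdf_rev measurable_mala_feature
  mala_feature_ge0 gram ug).
Qed.

Lemma mala_lawE (mu0 : probability (Rd R d) R) n B : measurable B ->
  mala_law h mu0 n B = (\int[mu0]_x iter n mala_op \1_B x)%:E.
Proof.
apply: (law_kernel_op (mt := measurable_mala_pdf) (t0 := mala_pdf_ge0)
  (t1 := integral_mala_pdf_le1)) => //.
move=> {}n {}B mB /=; congr integral; apply/funext => x.
rewrite kernel_measureE /mala_kernel /moving_measure; congr (_ + _)%E.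
rewrite muleC diracE indicE; congr (_ * _)%E.
rewrite /holding EFinB fineK// ge0_fin_numE.
  exact: le_lt_trans (integral_mala_pdf_le1 x) (ltry 1).
by apply: integral_EFin_ge0 => y; exact: mala_pdf_ge0.
Qed.

End mala_flow.

(** * Iterated integrals over triples of points *)

Section triple_integrals.
Context d (X : measurableType d) (R : realType).
Variable L : {sigma_finite_measure set X -> \bar R}.
Let X3 := (X * X * X)%type.
Implicit Types F G : X -> X -> X -> R.

Definition integral3 F : \bar R := (\int[L]_x \int[L]_y \int[L]_z (F x y z)%:E)%E.

Definition measurable3 F : Prop :=
  measurable_fun setT (fun v : X3 => F v.1.1 v.1.2 v.2).

Let integral3E F : measurable3 F -> (forall x y z, 0 <= F x y z) ->
  exists m : {sigma_finite_measure set (X * X)%type -> \bar R},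
    (L \x L)%E = m :> (set (X * X)%type -> \bar R) /\
    integral3 F = (\int[m]_v \int[L]_z (F v.1 v.2 z)%:E)%E.
Proof.
move=> mF F0; have [m mE] := product_sigma_finite L L.
exists m; split => //; rewrite -mE fubini_tonelli1//.
  by apply: (measurable_integral_section1 L (F := fun v => F v.1 v.2)).
by move=> v; exact: integral_EFin_ge0.
Qed.

Lemma integral3_le F G : measurable3 F -> measurable3 G ->
  (forall x y z, 0 <= F x y z) -> (forall x y z, F x y z <= G x y z) ->
  (integral3 F <= integral3 G)%E.
Proof.
move=> mF mG F0 FG.
have G0 x y z : 0 <= G x y z by exact: le_trans (FG x y z).
have [m [mE ->]] := integral3E mF F0; have [m' [mE' ->]] := integral3E mG G0.
rewrite -mE' mE; exact: (ge0_le_integral2 m L (F := fun v => F v.1 v.2)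
  (G := fun v => G v.1 v.2)).
Qed.

Lemma integral3D F G : measurable3 F -> measurable3 G ->
  (forall x y z, 0 <= F x y z) -> (forall x y z, 0 <= G x y z) ->
  integral3 (fun x y z => F x y z + G x y z) = (integral3 F + integral3 G)%E.
Proof.
move=> mF mG F0 G0.
have mFG : measurable3 (fun x y z => F x y z + G x y z) by exact: measurable_funD.
have FG0 x y z : 0 <= F x y z + G x y z by exact: addr_ge0.
have [m [mE ->]] := integral3E mF F0; have [m' [mE' ->]] := integral3E mG G0.
have [m'' [mE'' ->]] := integral3E mFG FG0.
rewrite -mE' -mE'' mE; exact: (ge0_integral2D m L (F := fun v => F v.1 v.2)
  (G := fun v => G v.1 v.2)).
Qed.

Lemma integral3_swap12 F : measurable3 F -> (forall x y z, 0 <= F x y z) ->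
  integral3 F = integral3 (fun x y z => F y x z).
Proof.
move=> mF F0; rewrite /integral3.
apply: (fubini_tonelli (fun v : X * X => \int[L]_z (F v.1 v.2 z)%:E)%E).
  by apply: (measurable_integral_section1 L (F := fun v => F v.1 v.2)).
by move=> v; exact: integral_EFin_ge0.
Qed.

Lemma integral3_swap23 F : measurable3 F -> (forall x y z, 0 <= F x y z) ->
  integral3 F = (\int[L]_x \int[L]_z \int[L]_y (F x y z)%:E)%E.
Proof.
move=> mF F0; apply: eq_integral => x _; apply: tonelli_EFin => //.
apply: (measurableT_comp (f := fun v : X3 => F v.1.1 v.1.2 v.2)
  (g := fun v : X * X => ((x, v.1), v.2))) => //.
apply: measurable_fun_pair; last exact: measurable_snd.
by apply: measurable_fun_pair => //; exact: measurable_fst.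
Qed.

End triple_integrals.

(** * Comparison of the MALA flow with an Ornstein-Uhlenbeck flow *)

(** With this step the Ornstein-Uhlenbeck flow has the same coefficient of
    [|x - y| ^ 2] in its exponent as [sym_flow]. *)
Definition ou_step (R : realType) (h : R) : R := 4 * h / (4 - 2 * h + h ^+ 2).

Section scalar_bounds.
Context (R : realType).
Implicit Types h e r u : R.

Lemma neg_ln_le u : u < 1 -> - ln (1 - u) <= u / (1 - u).
Proof.
move=> u1; have v0 : 0 < 1 - u by rewrite subr_gt0.
rewrite -lnV ?posrE//.
have E : (1 - u)^-1 = 1 + u / (1 - u) by field; rewrite gt_eqF.
rewrite [X in ln X]E; apply: le_ln1Dx; rewrite -subr_gt0 opprK.
have -> : u / (1 - u) + 1 = (1 - u)^-1 by field; rewrite gt_eqF.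
by rewrite invr_gt0.
Qed.

Lemma ou_step_bounds h : 0 < h -> h <= 4^-1 ->
  h <= ou_step h <= 8 / 7 * h.
Proof.
move=> h0 h4; have q0 : 0 < 4 - 2 * h + h ^+ 2 by nra.
by rewrite /ou_step ler_pdivlMr// ler_pdivrMr//; apply/andP; split; nra.
Qed.

(** The first-order terms cancel because [z] has the same mean square norm as
    [x] and [y]; the remaining ones are at most of the orders [h ^ 3 * D] and
    [h ^ 2 * tau]. *)
Lemma bridge_exponent_le h e t D tau A B r v : 0 < h -> h <= 4^-1 ->
  h <= e -> e <= 8 / 7 * h -> - (h / 4) <= t -> t <= h / 4 ->
  0 <= D -> h ^+ 3 * D <= 1 -> 0 <= tau -> h ^+ 2 * tau <= 1 ->
  `|A - D| <= tau -> `|B - D| <= tau ->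
  r = 1 - e -> v = e * (1 + 2 * r) / (1 + r) ->
  - (D / 2) * ln (1 - 2 * t * v)
  + t * (r / (1 + r)) ^+ 2 / (1 - 2 * t * v) * (2 * (1 + r) * A)
  - t * ((1 + r) * A + e * B) / 2 <= 1.
Proof.
move=> h0 h4 eh e8 tl tu D0 hD tau0 htau Aa Bb rE vE.
have e0 : 0 < e by lra.
have r1 : 0 < 1 + r by lra.
have r1n : 1 + r != 0 by rewrite gt_eqF.
have [c cE] : exists c, c = 2 * r ^+ 2 / (1 + r) by exists (2 * r ^+ 2 / (1 + r)).
have c0 : 0 <= c.
  by rewrite cE; apply: divr_ge0; [apply: mulr_ge0 => //; exact: sqr_ge0 | exact: ltW].
have vc : v = 1 - c.
  rewrite cE vE; have -> : e = 1 - r by lra.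
  by field.
have v2 : v <= 2 * h by rewrite vE ler_pdivrMr// rE; nra.
have v0 : 0 <= v by rewrite vE divr_ge0 ?ltW// mulr_gt0//; lra.
have c1 : c <= 1 by lra.
have cl : - e <= c - (1 + r) / 2.
  by rewrite cE lerBrDr ler_pdivlMr// rE; nra.
have cu : c - (1 + r) / 2 <= 0.
  by rewrite cE subr_le0 ler_pdivrMr// rE; nra.
have [u uE] : exists u, u = 2 * t * v by exists (2 * t * v).
have tt : t ^+ 2 <= h ^+ 2 / 16 by nra.
have tvu : t * u <= h ^+ 3 / 4.
  have -> : t * u = 2 * (t ^+ 2 * v) by rewrite uE; ring.
  have : t ^+ 2 * v <= h ^+ 2 / 16 * (2 * h) by apply: ler_pM => //; exact: sqr_ge0.
  have -> : h ^+ 2 / 16 * (2 * h) = h ^+ 3 / 8 by field.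
  lra.
have tu0 : 0 <= t * u.
  have -> : t * u = 2 * (t ^+ 2 * v) by rewrite uE; ring.
  by apply: mulr_ge0 => //; apply: mulr_ge0 => //; exact: sqr_ge0.
have u2 : u ^+ 2 <= h ^+ 4.
  have -> : u ^+ 2 = 4 * (t ^+ 2 * v ^+ 2) by rewrite uE; ring.
  have vv : v ^+ 2 <= 4 * h ^+ 2 by nra.
  have : t ^+ 2 * v ^+ 2 <= h ^+ 2 / 16 * (4 * h ^+ 2).
    by apply: ler_pM => //; exact: sqr_ge0.
  have -> : h ^+ 2 / 16 * (4 * h ^+ 2) = h ^+ 4 / 4 by field.
  lra.
have u16 : u <= 16^-1.
  have hh : h ^+ 2 <= 16^-1 by nra.
  have : u <= h ^+ 2.
    have := v0; have := v2; have := tu; have := tl; rewrite uE; nra.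
  lra.
have k0 : 0 < 1 - u by lra.
have [k kD] : exists k, k = (1 - u)^-1 by exists (1 - u)^-1.
have kp : 0 < k by rewrite kD invr_gt0.
have k2 : k <= 16 / 15.
  by rewrite kD -[leRHS]invrK lef_pV2 ?posrE ?invf_div//; lra.
have kE : k = 1 + u * k by rewrite kD; field; rewrite gt_eqF.
have lnk : - ln (1 - u) <= u * k by rewrite kD; apply: neg_ln_le; lra.
have D1 : - (D / 2) * ln (1 - u) <= D / 2 * (u * k).
  by rewrite mulNr -mulrN ler_wpM2l// divr_ge0.
have [a aE] : exists a, a = A - D by exists (A - D).
have [b bE] : exists b, b = B - D by exists (B - D).
move: Aa Bb; rewrite -aE -bE !ler_norml => /andP[a1 a2] /andP[b1 b2].
have -> : t * (r / (1 + r)) ^+ 2 / (1 - 2 * t * v) * (2 * (1 + r) * A) =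
    t * c * A * k.
  by rewrite cE kD -uE; field; rewrite r1n gt_eqF.
rewrite -uE; apply: (@le_trans _ _ (D / 2 * (u * k) + t * c * A * k
    - t * ((1 + r) * A + e * B) / 2)); first by rewrite !lerD2r.
have -> : D / 2 * (u * k) + t * c * A * k - t * ((1 + r) * A + e * B) / 2 =
    D / 2 * (u ^+ 2 * k) + t * a * (c - (1 + r) / 2) - t * b * e / 2
    + c * ((t * u) * k * A).
  have -> : A = D + a by lra.
  have -> : B = D + b by lra.
  have e1 : u * k = u + u ^+ 2 * k by rewrite [in LHS]kE; ring.
  have e2 : t * c * (D + a) * k = t * c * (D + a) + c * ((t * u) * k * (D + a)).
    by rewrite [in LHS]kE; ring.
  rewrite e1 e2 uE vc; have -> : e = 1 - r by lra.
  by field.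
have h3 : 0 <= h ^+ 3 by rewrite exprn_ge0// ltW.
have T1 : D / 2 * (u ^+ 2 * k) <= 2 / 15.
  have : u ^+ 2 * k <= h ^+ 4 * (16 / 15).
    by apply: ler_pM => //; [exact: sqr_ge0 | exact: ltW].
  move=> /(ler_wpM2l (divr_ge0 D0 (ler0n _ 2))) H; apply: le_trans H _.
  have -> : D / 2 * (h ^+ 4 * (16 / 15)) = (h ^+ 3 * D) * (8 / 15 * h) by field.
  have : (h ^+ 3 * D) * (8 / 15 * h) <= 1 * (8 / 15 * h).
    by apply: ler_wpM2r => //; lra.
  lra.
have T2 : t * a * (c - (1 + r) / 2) <= 2 / 7.
  have ta : `|t * a| <= h / 4 * tau.
    by rewrite normrM ler_pM// ler_norml ?tl ?tu ?a1 ?a2.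
  have cc : `|c - (1 + r) / 2| <= 8 / 7 * h by rewrite ler_norml; apply/andP; lra.
  apply: le_trans (ler_norm _) _; rewrite normrM.
  apply: le_trans (ler_pM (normr_ge0 _) (normr_ge0 _) ta cc) _.
  have -> : h / 4 * tau * (8 / 7 * h) = (h ^+ 2 * tau) * (2 / 7) by field.
  lra.
have T3 : - (t * b * e / 2) <= 1 / 7.
  have tb : `|t * b| <= h / 4 * tau.
    by rewrite normrM ler_pM// ler_norml ?tl ?tu ?b1 ?b2.
  have ee : `|e| <= 8 / 7 * h by rewrite gtr0_norm.
  have : `|t * b * e| <= (h ^+ 2 * tau) * (2 / 7).
    rewrite normrM.
    apply: le_trans (ler_pM (normr_ge0 _) (normr_ge0 _) tb ee) _.
    by rewrite le_eqVlt; apply/orP; left; apply/eqP; field.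
  rewrite ler_norml => /andP[H _].
  lra.
have T4 : c * ((t * u) * k * A) <= 1 / 3.
  have AA : A <= D + tau by lra.
  have s1 : (t * u) * k <= h ^+ 3 / 4 * (16 / 15).
    by apply: ler_pM => //; exact: ltW.
  have tk0 : 0 <= t * u * k by rewrite mulr_ge0// ltW.
  have s2 : t * u * k * (D + tau) <= h ^+ 3 / 4 * (16 / 15) * (D + tau).
    by apply: ler_wpM2r => //; exact: addr_ge0.
  have s3 : h ^+ 3 / 4 * (16 / 15) * (D + tau) =
      4 / 15 * (h ^+ 3 * D) + 4 / 15 * (h * (h ^+ 2 * tau)) by field.
  have s4 : h * (h ^+ 2 * tau) <= h * 1 by apply: ler_wpM2l => //; exact: ltW.
  have s5 : t * u * k * A <= t * u * k * (D + tau) by apply: ler_wpM2l.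
  have s6 : t * u * k * A <= 1 / 3 by lra.
  have [p0|n0] := leP 0 (t * u * k * A).
    by apply: le_trans s6; rewrite ler_piMl.
  by apply: (@le_trans _ _ 0); [rewrite mulr_ge0_le0// ltW | lra].
lra.
Qed.

(** The right-hand side is the logarithm of the ratio of [sym_flow] to the
    Ornstein-Uhlenbeck flow. Its terms of order [h ^ 2 * D] cancel when [A] is near
    [D], which leaves [h ^ 3 * D] and [h ^ 2 * tau]. *)
Lemma flow_ratio_exponent_ge h D tau A : 0 < h -> h <= 4^-1 ->
  0 <= D -> h ^+ 3 * D <= 1 -> h ^+ 2 * tau <= 1 -> 0 <= tau ->
  `|A - D| <= tau -> forall r, r = 1 - ou_step h ->
  -1 <= D / 2 * (ln (1 - r ^+ 2) - ln (2 * h))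
     + (2^-1 - (1 + r) * (2 + h) / 8) * A.
Proof.
move=> h0 h4 D0 hD htau tau0 Aa r rE.
have q0 : 0 < 4 - 2 * h + h ^+ 2 by nra.
have qn : 4 - 2 * h + h ^+ 2 != 0 by rewrite gt_eqF.
have [q qE] : exists q, q = 4 - 2 * h + h ^+ 2 by exists (4 - 2 * h + h ^+ 2).
have q35 : 7 / 2 <= q by rewrite qE; nra.
have qp : 0 < q by rewrite qE.
have m0 : 0 < 4 - 2 * h by lra.
have mn : 4 - 2 * h != 0 by rewrite gt_eqF.
have hn : h != 0 by rewrite gt_eqF.
have [w wE] : exists w, w = (4 - 2 * h) / q by exists ((4 - 2 * h) / q).
have w0 : 0 < w by rewrite wE divr_gt0.
have rw : 1 - r ^+ 2 = (2 * h) * w ^+ 2.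
  by rewrite rE /ou_step wE qE; field.
have -> : ln (1 - r ^+ 2) - ln (2 * h) = 2 * ln w.
  rewrite rw lnM ?posrE ?exprn_gt0 ?mulr_gt0//.
  by rewrite lnXn// -mulr_natl; ring.
have lnw : - (h ^+ 2 / (4 - 2 * h)) <= ln w.
  rewrite lerNl -lnV ?posrE//.
  have -> : w^-1 = 1 + h ^+ 2 / (4 - 2 * h).
    by rewrite wE qE; field; rewrite mn.
  apply: le_ln1Dx; apply: (@lt_le_trans _ _ 0); first by lra.
  by rewrite divr_ge0 ?sqr_ge0// ltW.
have -> : 2^-1 - (1 + r) * (2 + h) / 8 = (4 * h ^+ 2 - h ^+ 3) / (4 * q).
  by rewrite rE /ou_step qE; field.
have [c cE] : exists c, c = (4 * h ^+ 2 - h ^+ 3) / (4 * q).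
  by exists ((4 * h ^+ 2 - h ^+ 3) / (4 * q)).
have c0 : 0 <= c.
  rewrite cE; apply: divr_ge0; last by apply: mulr_ge0 => //; exact: ltW.
  have -> : 4 * h ^+ 2 - h ^+ 3 = h ^+ 2 * (4 - h) by ring.
  by apply: mulr_ge0; [exact: sqr_ge0 | lra].
have hh : 0 <= h ^+ 2 by exact: sqr_ge0.
have h3 : 0 <= h ^+ 3 by rewrite exprn_ge0// ltW.
have cu : c <= 2 / 7 * h ^+ 2.
  by rewrite cE ler_pdivrMr ?mulr_gt0//; nra.
have AD : D - tau <= A by move: Aa; rewrite ler_norml => /andP[]; lra.
have s1 : D * - (h ^+ 2 / (4 - 2 * h)) <= D * ln w by exact: ler_wpM2l.
have s2 : c * (D - tau) <= c * A by exact: ler_wpM2l.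
have s3 : c * tau <= 2 / 7 * h ^+ 2 * tau by exact: ler_wpM2r.
have s4 : D * - (h ^+ 2 / (4 - 2 * h)) + c * D =
    - (h ^+ 3 * D) * ((4 + 2 * h) / (4 * q * (4 - 2 * h))).
  by rewrite cE qE; field; rewrite mn qn.
have s5 : (4 + 2 * h) / (4 * q * (4 - 2 * h)) <= 1 / 4.
  by rewrite ler_pdivrMr ?mulr_gt0//; nra.
have s6 : h ^+ 3 * D * ((4 + 2 * h) / (4 * q * (4 - 2 * h))) <= 1 * (1 / 4).
  apply: ler_pM => //; first by exact: mulr_ge0.
  by rewrite divr_ge0 ?mulr_ge0//; lra.
rewrite -cE; have -> : D / 2 * (2 * ln w) = D * ln w by field.
move: s4; rewrite mulNr => s4.
lra.
Qed.

End scalar_bounds.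

(** A Dirichlet form bounds the decay of the variance: [D] is the squared norm of
    a test function, [T] and [O] its correlations with its images by two
    reversible kernels, [S] the squared norm of its image by the first. *)
Lemma variance_contraction_of_dirichlet (R : realFieldType) (c b h e D O T S m V : R) :
  1 <= c -> 0 <= b -> 2 * (D - O) <= c * (2 * (D - T)) + b ->
  V = D - m ^+ 2 -> O - m ^+ 2 <= (1 - e) * V -> S <= T -> h * V <= e * V ->
  S - m ^+ 2 <= (1 - h / c) * V + b.
Proof.
move=> c1 b0 H VE P C hV; have c0 : 0 < c by lra.
have : (h * V) / c <= (c * (D - T) + b) / c by rewrite ler_pM2r ?invr_gt0//; lra.
rewrite mulrDl (mulrC c) mulfK ?gt_eqF//.
have : b / c <= b by rewrite ler_pdivrMr// ler_peMr.
by rewrite mulrAC; move: (b / c) (h / c) => u w; lra.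
Qed.

Definition path_const (R : realType) : R := 2 * expR 1.

Section flow_comparison.
Context (R : realType) (d : nat) (h tau : R).
Hypotheses (h0 : 0 < h) (h4 : h <= 4^-1) (hd : h ^+ 3 * d%:R <= 1).
Hypotheses (tau0 : 0 <= tau) (htau : h ^+ 2 * tau <= 1).
Local Notation L := (@lebesgue_Rd R d).
Local Notation gauss := (@std_gaussian R d).
Local Notation p := (@std_gaussian_pdf R d).
Local Notation e := (ou_step h).
Local Notation r := (1 - ou_step h).
Implicit Types (x y : Rd R d).

Lemma ou_step_gt0 : 0 < e.
Proof. by have /andP[+ _] := ou_step_bounds h0 h4; exact: lt_le_trans. Qed.

Lemma ou_corr_gt0 : 0 < r.
Proof. by have /andP[_] := ou_step_bounds h0 h4; have := h4; lra. Qed.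

Lemma ou_corr_lt1 : r < 1.
Proof. by have := ou_step_gt0; lra. Qed.

Let h1 : h < 1. Proof. by have := h4; lra. Qed.
Let rD0 : 0 < 1 + r. Proof. by have := ou_corr_gt0; lra. Qed.
Let rDn : 1 + r != 0. Proof. by rewrite gt_eqF. Qed.
Let en : e != 0. Proof. by rewrite gt_eqF// ou_step_gt0. Qed.

Definition chi_plus x y : R :=
  (sqnorm x + 2 * dot x y + sqnorm y) / (2 * (1 + r)).

Definition chi_minus x y : R :=
  (sqnorm x - 2 * dot x y + sqnorm y) / (2 * e).

Lemma chi_plus_sym x y : chi_plus x y = chi_plus y x.
Proof. by rewrite /chi_plus (dotC y x); congr (_ / _); ring. Qed.

Lemma chi_minus_sym x y : chi_minus x y = chi_minus y x.
Proof. by rewrite /chi_minus (dotC y x); congr (_ / _); ring. Qed.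

(** Under the Ornstein-Uhlenbeck flow [chi_plus] and [chi_minus] are independent
    chi-square variables with [d] degrees of freedom. *)
Definition ou_flow x y : R :=
  expR (- d%:R * ln (2 * pi) - d%:R / 2 * ln (1 - r ^+ 2)
    - chi_plus x y / 2 - chi_minus x y / 2).

Lemma ou_flow_pdfE x y : p x * ou_pdf r x y = ou_flow x y.
Proof.
rewrite ou_flowE ?ou_corr_gt0 ?ou_corr_lt1// /ou_flow /chi_plus /chi_minus.
congr expR; have -> : 1 - r = e by ring.
by field; rewrite en rDn.
Qed.

Lemma ou_flow_symm x y : ou_flow x y = ou_flow y x.
Proof. by rewrite /ou_flow chi_plus_sym chi_minus_sym. Qed.

Lemma ou_flow_ge0 x y : 0 <= ou_flow x y.
Proof. exact: expR_ge0. Qed.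

(** Near the means of the two variables [sym_flow] dominates [ou_flow] up to a
    constant and the bridge below has bounded exponential moments. *)
Definition good x y : bool :=
  (`|chi_plus x y - d%:R| <= tau) && (`|chi_minus x y - d%:R| <= tau).

Definition bad_flow x y : R := ou_flow x y * (~~ good x y)%:R.

Lemma bad_flow_ge0 x y : 0 <= bad_flow x y.
Proof. by rewrite mulr_ge0 ?ou_flow_ge0. Qed.

(** * The bridge through a third point *)

Let al := r / (1 + r).
Let v := e * (1 + 2 * r) / (1 + r).

Let v0 : 0 < v.
Proof.
have := ou_corr_gt0; have := ou_step_gt0; have := rD0 => H1 H2 H3.
by rewrite divr_gt0// mulr_gt0//; lra.
Qed.

(** Given [x] and [y], the third point of a Gaussian triple whose pairs all have
    correlation [r]. *)
Definition bridge x y (z : Rd R d) : R := gaussian_pdf (lincomb al al x y) v z.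

Lemma bridge_ge0 x y z : 0 <= bridge x y z.
Proof. exact: gaussian_pdf_ge0. Qed.

Lemma bridge_sym x y z : bridge x y z = bridge y x z.
Proof.
rewrite /bridge; suff -> : lincomb al al x y = lincomb al al y x by [].
by apply: eq_from_tnth => i; rewrite !tnth_mktuple addrC.
Qed.

Lemma bridge_exchange x y z :
  ou_flow x y * bridge x y z = ou_flow x z * bridge x z y.
Proof.
rewrite /bridge !gaussian_pdfE// /ou_flow -!expRD; congr expR.
rewrite !sqdist_lincomb (dotC z x) (dotC z y) (dotC y x) /chi_plus /chi_minus /al /v.
have H : 1 + 2 * r != 0.
  by have H0 := ou_corr_gt0; rewrite gt_eqF//; lra.
move: en rDn H; move: e => s en' rDn' H.
by field; rewrite H rDn' en'.
Qed.

Definition bridge_gap x y (z : Rd R d) : R := sqnorm z - (sqnorm x + sqnorm y) / 2.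

(** The tilted bridge is again Gaussian, up to a constant. *)
Let bridge_mgf t x y : 2 * t * v < 1 ->
  (\int[L]_z (expR (t * bridge_gap x y z) * bridge x y z)%:E)%E =
  (expR (- (d%:R / 2) * ln (1 - 2 * t * v)
    + t * al ^+ 2 / (1 - 2 * t * v) * (2 * (1 + r) * chi_plus x y)
    - t * ((1 + r) * chi_plus x y + e * chi_minus x y) / 2))%:E.
Proof.
move=> tv; have w0 : 0 < 1 - 2 * t * v by rewrite subr_gt0.
have vn : v != 0 by rewrite gt_eqF.
pose v' := v / (1 - 2 * t * v); have v'0 : 0 < v' by rewrite divr_gt0.
pose al' := al / (1 - 2 * t * v).
set c := expR (- _ * _ + _ - _).
transitivity (\int[L]_z (c * gaussian_pdf (lincomb al' al' x y) v' z)%:E)%E; last first.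
  rewrite ge0_integralZl_real ?expR_ge0//.
  - by rewrite integral_gaussian_pdf// mule1.
  - exact: measurable_gaussian_pdf.
  - by move=> z; exact: gaussian_pdf_ge0.
apply: eq_integral => z _; congr EFin.
rewrite /bridge !gaussian_pdfE// -!expRD; congr expR.
have -> : ln (2 * pi * v') = ln (2 * pi * v) - ln (1 - 2 * t * v).
  have -> : 2 * pi * v' = 2 * pi * v / (1 - 2 * t * v) by rewrite mulrA.
  have c0 : 0 < 2 * pi * v := mulr_gt0 (mulr_gt0 (ltr0n R 2) (pi_gt0 R)) v0.
  by rewrite ln_div ?posrE.
rewrite !sqdist_lincomb /bridge_gap /chi_plus /chi_minus /al' /v'.
move: vn w0 en rDn; move: (ln _) (ln _) => l1 l2.
move: al v e => a s u sn w0 un rDn'.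
by field; rewrite sn rDn' un gt_eqF.
Qed.

Let bridge_mgf_le t x y : - (h / 4) <= t -> t <= h / 4 -> good x y ->
  (\int[L]_z (expR (t * bridge_gap x y z) * bridge x y z)%:E <= (expR 1)%:E)%E.
Proof.
move=> tl tu /andP[gp gm].
have /andP[eh e8] := ou_step_bounds h0 h4.
have v2 : v <= 2 * h.
  rewrite /v ler_pdivrMr; last exact: rD0.
  by have := h4; have := h0; move: eh e8; move: e => s; nra.
have tv : 2 * t * v < 1.
  have := v0; have := h4; have := h0; move: v2 tl tu; move: v => w; nra.
rewrite bridge_mgf// lee_fin ler_expR.
exact: (bridge_exponent_le h0 h4 eh e8 tl tu (ler0n _ _) hd tau0 htau gp gm
  erefl erefl).
Qed.

Local Notation kap := (h / 4).
Let kap0 : 0 <= kap. Proof. by rewrite divr_ge0// ltW. Qed.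
Local Notation a := (path_const R).
Let a0 : 0 < a. Proof. by rewrite mulr_gt0// expR_gt0. Qed.

(** The weight favours third points whose squared norm is near the mean of those
    of the two others: it makes a large jump of the norm from [x] to [y] go
    through two jumps of half the size, which MALA is likely to accept. *)
Definition path x y (z : Rd R d) : R :=
  ou_flow x y * bridge x y z * expR (- (h / 4 * `|bridge_gap x y z|)).

Lemma path_ge0 x y z : 0 <= path x y z.
Proof.
apply: mulr_ge0; last exact: expR_ge0.
exact: mulr_ge0 (ou_flow_ge0 x y) (bridge_ge0 x y z).
Qed.

Lemma path_sym x y z : path x y z = path y x z.
Proof.
rewrite /path ou_flow_symm bridge_sym; congr (_ * expR (- (_ * `|_|))).
by rewrite /bridge_gap (addrC (sqnorm x)).
Qed.

Let mexp d' (T : measurableType d') (f : T -> R) : measurable_fun setT f ->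
  measurable_fun setT (fun u => expR (f u)).
Proof. by move=> mf; exact: measurableT_comp. Qed.

Let mscal d' (T : measurableType d') (k : R) (f : T -> R) : measurable_fun setT f ->
  measurable_fun setT (fun u => k * f u).
Proof. by move=> mf; exact: measurable_funM. Qed.

Let P2 := (Rd R d * Rd R d)%type.

Lemma measurable_chi_plus :
  measurable_fun setT (fun u : P2 => chi_plus u.1 u.2).
Proof.
apply: measurable_funM => //.
have := measurable_quadratic 0 1 2 1 (R := R) (d := d).
by congr measurable_fun; apply/funext => u; rewrite !mul1r add0r.
Qed.

Lemma measurable_chi_minus :
  measurable_fun setT (fun u : P2 => chi_minus u.1 u.2).
Proof.
apply: measurable_funM => //.
have := measurable_quadratic 0 1 (- 2) 1 (R := R) (d := d).
by congr measurable_fun; apply/funext => u; rewrite !mul1r add0r mulNr.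
Qed.

Lemma measurable_ou_flow : measurable_fun setT (fun u : P2 => ou_flow u.1 u.2).
Proof.
apply: measurableT_comp => //; apply: measurable_funB.
  apply: measurable_funB => //.
  by apply: measurable_funM => //; exact: measurable_chi_plus.
by apply: measurable_funM => //; exact: measurable_chi_minus.
Qed.

Lemma measurable_bad_flow : measurable_fun setT (fun u : P2 => bad_flow u.1 u.2).
Proof.
apply: measurable_funM; first exact: measurable_ou_flow.
pose G := [set u : P2 | `|chi_plus u.1 u.2 - d%:R| <= tau] `&`
  [set u : P2 | `|chi_minus u.1 u.2 - d%:R| <= tau].
have mG : measurable G.
  apply: measurableI; apply: measurable_ler_set => //; apply: measurableT_comp => //;
    apply: measurable_funB => //;
    [exact: measurable_chi_plus | exact: measurable_chi_minus].
have -> : (fun u : P2 => (~~ good u.1 u.2)%:R) = \1_(~` G) :> (P2 -> R).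
  apply/funext => u; rewrite indicE in_setC; congr ((nat_of_bool (~~ _))%:R).
  by apply/idP/idP; rewrite inE /G /good /= => /andP.
by apply: measurable_indic; exact: measurableC.
Qed.

Lemma measurable3_path : measurable3 path.
Proof.
pose T3 := (Rd R d * Rd R d * Rd R d)%type.
have m1 : measurable_fun setT (fun u : T3 => u.1.1).
  exact: measurableT_comp measurable_fst measurable_fst.
have m2 : measurable_fun setT (fun u : T3 => u.1.2).
  exact: measurableT_comp measurable_snd measurable_fst.
have m3 : measurable_fun setT (fun u : T3 => u.2) by exact: measurable_snd.
have mN1 : measurable_fun setT (fun u : T3 => sqnorm u.1.1).
  exact: measurableT_comp (@measurable_sqnorm R d) m1.
have mN2 : measurable_fun setT (fun u : T3 => sqnorm u.1.2).
  exact: measurableT_comp (@measurable_sqnorm R d) m2.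
have mN3 : measurable_fun setT (fun u : T3 => sqnorm u.2).
  exact: measurableT_comp (@measurable_sqnorm R d) m3.
apply: measurable_funM; first apply: measurable_funM.
- apply: (measurableT_comp (f := fun u : P2 => ou_flow u.1 u.2)
    (g := fun u : T3 => u.1)); [exact: measurable_ou_flow | exact: measurable_fst].
- rewrite /bridge; under eq_fun do rewrite gaussian_pdfE// sqdist_lincomb.
  apply: measurableT_comp => //; apply: measurable_funB => //.
  apply: measurable_funM => //.
  apply: measurable_funD; last exact: mscal.
  apply: measurable_funD; last by apply: mscal; exact: measurable_dot.
  apply: measurable_funD; last exact: mscal.
  apply: measurable_funB; last by apply: mscal; exact: measurable_dot.
  by apply: measurable_funB => //; apply: mscal; exact: measurable_dot.
- apply: measurableT_comp => //; apply: measurableT_comp => //; apply: mscal.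
  apply: measurableT_comp => //; apply: measurable_funB => //.
  by apply: measurable_funM => //; exact: measurable_funD.
Qed.

Let mbridge x y : measurable_fun setT (bridge x y).
Proof. exact: measurable_gaussian_pdf. Qed.

Let mgap x y : measurable_fun setT (bridge_gap x y).
Proof. by apply: measurable_funB => //; exact: measurable_sqnorm. Qed.

Let integral_bridge x y : (\int[L]_z (bridge x y z)%:E = 1)%E.
Proof. exact: integral_gaussian_pdf. Qed.

Let two_sided x y z : R :=
  expR (kap * bridge_gap x y z) * bridge x y z
  + expR (- kap * bridge_gap x y z) * bridge x y z.

Let two_sided_ge0 x y z : 0 <= two_sided x y z.
Proof.
by apply: addr_ge0; apply: mulr_ge0; [exact: expR_ge0 | exact: bridge_ge0 |
  exact: expR_ge0 | exact: bridge_ge0].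
Qed.

Let mside t x y :
  measurable_fun setT (fun z => expR (t * bridge_gap x y z) * bridge x y z).
Proof.
apply: measurable_funM; last exact: mbridge.
by apply: mexp; apply: mscal; exact: mgap.
Qed.

Let mtwo x y : measurable_fun setT (two_sided x y).
Proof. by apply: measurable_funD; exact: mside. Qed.

Let two_sided_le x y : good x y -> (\int[L]_z (two_sided x y z)%:E <= a%:E)%E.
Proof.
move=> gxy; have s0 t z : 0 <= expR (t * bridge_gap x y z) * bridge x y z.
  exact: mulr_ge0 (expR_ge0 _) (bridge_ge0 x y z).
rewrite (ge0_integralD_EFin _ (mside kap x y) (mside (- kap) x y) (s0 kap)
  (s0 (- kap))).
rewrite /path_const mulr_natl mulr2n EFinD; apply: leeD; apply: bridge_mgf_le => //.
- by have := h0; lra.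
- by have := h0; lra.
Qed.

Let expR_abs_le (u : R) : expR `|u| <= expR u + expR (- u).
Proof.
by case: (ler0P u) => _; rewrite ?lerDr ?lerDl expR_ge0.
Qed.

(** Integrate [2 / a <= w + w^-1 / a ^ 2], where [w] is the weight in [path]:
    the exponential moment of the gap bounds the integral of [w^-1] by [a]. *)
Let path_lower x y : good x y ->
  ((ou_flow x y)%:E <= a%:E * \int[L]_z (path x y z)%:E)%E.
Proof.
move=> gxy; pose f z := bridge x y z * expR (- (h / 4 * `|bridge_gap x y z|)).
have f0 z : 0 <= f z by exact: mulr_ge0 (bridge_ge0 x y z) (expR_ge0 _).
have mf : measurable_fun setT f.
  apply: measurable_funM; first exact: mbridge.
  apply: measurableT_comp => //; apply: measurableT_comp => //; apply: mscal.
  by apply: measurableT_comp => //; exact: mgap.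
have -> : (\int[L]_z (path x y z)%:E)%E = ((ou_flow x y)%:E * \int[L]_z (f z)%:E)%E.
  rewrite -ge0_integralZl_real ?ou_flow_ge0//.
  by apply: eq_integral => z _; rewrite /path /f mulrA.
have ptw z : 2 / a * bridge x y z <= f z + a ^- 2 * two_sided x y z.
  have b0 := bridge_ge0 x y z.
  have -> : a ^- 2 * two_sided x y z = bridge x y z * (a ^- 2 *
      (expR (kap * bridge_gap x y z) + expR (- (kap * bridge_gap x y z)))).
    by rewrite /two_sided mulNr; ring.
  rewrite [leLHS]mulrC -mulrDr; apply: ler_wpM2l => //.
  have := expR_abs_le (kap * bridge_gap x y z).
  rewrite normrM (ger0_norm kap0) (expRN (kap * `|bridge_gap x y z|)).
  move: (expR_gt0 (kap * `|bridge_gap x y z|)).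
  move: (expR (kap * `|bridge_gap x y z|)) (_ + _) => E S E0 ES.
  apply: (@le_trans _ _ (E^-1 + a ^- 2 * E)); last first.
    by rewrite lerD2l ler_wpM2l// invr_ge0 exprn_ge0// ltW.
  rewrite -subr_ge0; have -> : E^-1 + a ^- 2 * E - 2 / a = E^-1 * (1 - E / a) ^+ 2.
    by field; rewrite !gt_eqF.
  by apply: mulr_ge0; [rewrite invr_ge0 ltW | exact: sqr_ge0].
have a2 : 0 <= a ^- 2 by rewrite invr_ge0 exprn_ge0// ltW.
have c0 z : 0 <= 2 / a * bridge x y z.
  by rewrite mulr_ge0 ?bridge_ge0// divr_ge0// ltW.
have mc : measurable_fun setT (fun z => 2 / a * bridge x y z).
  by apply: mscal; exact: mbridge.
have mt : measurable_fun setT (fun z => a ^- 2 * two_sided x y z).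
  by apply: mscal; exact: mtwo.
have t0 z : 0 <= a ^- 2 * two_sided x y z by rewrite mulr_ge0// two_sided_ge0.
have := ge0_le_integral_EFin L mc (measurable_funD mf mt) c0 ptw.
rewrite (ge0_integralD_EFin L mf mt f0 t0).
rewrite (ge0_integralZl_real L (mtwo x y) (two_sided_ge0 x y) a2).
rewrite (ge0_integralZl_real L (mbridge x y) (bridge_ge0 x y)); last first.
  by rewrite divr_ge0// ltW.
rewrite integral_bridge mule1 => H.
have H2 : ((2 / a)%:E <= \int[L]_z (f z)%:E + (a ^- 2 * a)%:E)%E.
  apply: le_trans H _; rewrite EFinM; apply: leeD => //.
  by apply: lee_wpmul2l; [rewrite lee_fin | exact: two_sided_le].
have : ((a^-1)%:E <= \int[L]_z (f z)%:E)%E.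
  move: H2; case: (\int[L]_z (f z)%:E)%E => [I||]; rewrite ?leey//.
  rewrite -EFinD !lee_fin => H2.
  have E1 : a ^- 2 * a = a^-1 by field; rewrite gt_eqF.
  have E2 : 2 / a = a^-1 + a^-1 by field; rewrite gt_eqF.
  by move: H2; rewrite E1 E2 lerD2r.
move=> H3; have s0 := ou_flow_ge0 x y.
rewrite muleCA; apply: (@le_trans _ _ ((ou_flow x y)%:E * (a%:E * (a^-1)%:E))%E).
  have -> : (a%:E * (a^-1)%:E)%E = 1%:E by rewrite -EFinM mulfV// gt_eqF.
  by rewrite mule1.
apply: lee_wpmul2l; first by rewrite lee_fin.
by apply: lee_wpmul2l => //; rewrite lee_fin ltW.
Qed.

Let sym_flow_ge x y : good x y -> ou_flow x y <= expR 1 * sym_flow h x y.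
Proof.
move=> /andP[gp gm]; rewrite /ou_flow /sym_flow -expRD ler_expR.
have H := flow_ratio_exponent_ge h0 h4 (ler0n R d) hd htau tau0 gp erefl.
have -> : ln (2 * pi * (2 * h)) = ln (2 * pi) + ln (2 * h).
  have c1 : 0 < 2 * pi :> R := mulr_gt0 (ltr0n R 2) (pi_gt0 R).
  by rewrite lnM// posrE mulr_gt0.
have q0 : 4 - 2 * h + h ^+ 2 != 0.
  by rewrite gt_eqF//; have := h4; have := h0; nra.
have -> : (4 - 2 * h + h ^+ 2) / (16 * h) = (4 * e)^-1.
  by rewrite /ou_step; field; rewrite q0 gt_eqF.
rewrite -subr_ge0.
set u := (X in 0 <= X).
suff -> : u = 1 + (d%:R / 2 * (ln (1 - r ^+ 2) - ln (2 * h))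
    + (2^-1 - (1 + r) * (2 + h) / 8) * chi_plus x y).
  by move: H; rewrite -subr_ge0 opprK addrC.
rewrite /u {u H gp gm q0} /chi_plus /chi_minus.
move: rDn en; move: e (ln (1 - _)) (ln (2 * h)) => s l1 l2 rDn' en'.
by field; rewrite rDn' en'.
Qed.

(** Read from [x] and [z], the bridge leads to [y], and the gap is half of
    [3 / 2 * (|z| ^ 2 - |x| ^ 2)] minus the gap of the exchanged triple. The
    triangle inequality extracts the acceptance factor of MALA. *)
Let path_upper x z :
  (\int[L]_y (path x y z)%:E <= (a * expR 1 * mala_flow h x z + bad_flow x z)%:E)%E.
Proof.
pose f y := bridge x z y * expR (- (h / 4 * `|bridge_gap x y z|)).
have f0 y : 0 <= f y by exact: mulr_ge0 (bridge_ge0 x z y) (expR_ge0 _).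
have mgap2 : measurable_fun setT (fun y => bridge_gap x y z).
  apply: measurable_funB => //; apply: measurable_funM => //.
  by apply: measurable_funD => //; exact: measurable_sqnorm.
have mf : measurable_fun setT f.
  apply: measurable_funM; first exact: mbridge.
  apply: measurableT_comp => //; apply: measurableT_comp => //; apply: mscal.
  exact: measurableT_comp.
have -> : (\int[L]_y (path x y z)%:E)%E = ((ou_flow x z)%:E * \int[L]_y (f y)%:E)%E.
  rewrite -(ge0_integralZl_real L mf f0 (ou_flow_ge0 x z)).
  apply: eq_integral => y _; congr EFin.
  by rewrite /path bridge_exchange /f mulrA.
have J0 : 0 <= mala_flow h x z.
  exact: mulr_ge0 (ltW (sym_flow_gt0 h x z)) (expR_ge0 _).
have ae0 : 0 <= a * expR 1 * mala_flow h x z.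
  by apply: mulr_ge0 => //; apply: mulr_ge0; [exact: ltW | exact: expR_ge0].
case: (boolP (good x z)) => gxz; last first.
  apply: (@le_trans _ _ (bad_flow x z)%:E); last by rewrite lee_fin lerDr.
  rewrite /bad_flow gxz mulr1 -[leRHS]mule1.
  apply: lee_wpmul2l; first by rewrite lee_fin ou_flow_ge0.
  rewrite -(integral_bridge x z); apply: ge0_le_integral_EFin => //.
  move=> y; rewrite /f ler_piMr ?bridge_ge0//.
  rewrite -[leRHS]expR0 ler_expR oppr_le0.
  by apply: mulr_ge0; [exact: kap0 | exact: normr_ge0].
apply: (@le_trans _ _ (a * expR 1 * mala_flow h x z)%:E); last first.
  by rewrite lee_fin lerDl bad_flow_ge0.
pose w := expR (- (h / 8 * `|sqnorm x - sqnorm z|)).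
have ptw y : f y <= w * two_sided x z y.
  have b0 := bridge_ge0 x z y.
  have -> : w * two_sided x z y = bridge x z y * (w *
      (expR (kap * bridge_gap x z y) + expR (- (kap * bridge_gap x z y)))).
    by rewrite /two_sided mulNr; ring.
  apply: ler_wpM2l => //.
  apply: (@le_trans _ _ (w * expR `|kap * bridge_gap x z y|)); last first.
    by apply: ler_wpM2l; [exact: expR_ge0 | exact: expR_abs_le].
  rewrite /w -expRD ler_expR normrM (ger0_norm kap0).
  have -> : bridge_gap x y z = (3 / 2 * (sqnorm z - sqnorm x) - bridge_gap x z y) / 2.
    by rewrite /bridge_gap; field.
  move: (bridge_gap x z y) => g.
  rewrite (distrC (sqnorm x)); move: (sqnorm z - sqnorm x) => u.
  have : `|u| <= `|(3 / 2 * u - g) / 2| * 2 + `|g|.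
    have -> : `|(3 / 2 * u - g) / 2| * 2 = `|3 / 2 * u - g|.
      by rewrite -[X in _ * X]ger0_norm// -normrM divfK.
    apply: (@le_trans _ _ (`|3 / 2 * u|)).
      by rewrite normrM ger0_norm// ler_peMl//; lra.
    by have := ler_normD (3 / 2 * u - g) g; rewrite subrK.
  have := h0; have := normr_ge0 g; have := normr_ge0 u.
  move: `|(3 / 2 * u - g) / 2| `|u| `|g| => n1 n2 n3 n20 n30 hh H.
  have := ler_wpM2l (ltW hh) H; have : 0 <= h * n3 by rewrite mulr_ge0// ltW.
  lra.
have w0 : 0 <= w by exact: expR_ge0.
apply: (@le_trans _ _ ((ou_flow x z)%:E * (w * a)%:E)%E).
  apply: lee_wpmul2l; first by rewrite lee_fin ou_flow_ge0.
  have mt : measurable_fun setT (fun y => w * two_sided x z y).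
    by apply: mscal; exact: mtwo.
  apply: le_trans (ge0_le_integral_EFin L mf mt f0 ptw) _.
  rewrite (ge0_integralZl_real L (mtwo x z) (two_sided_ge0 x z) w0) EFinM.
  by apply: lee_wpmul2l; [rewrite lee_fin | exact: two_sided_le].
rewrite -EFinM lee_fin /mala_flow -/w.
have -> : a * expR 1 * (sym_flow h x z * w) = (expR 1 * sym_flow h x z) * (w * a).
  by ring.
apply: ler_wpM2r; last exact: sym_flow_ge.
by apply: mulr_ge0 => //; exact: ltW.
Qed.

Let P2fst : measurable_fun setT (fun u : P2 => u.1) := measurable_fst.
Let P2snd : measurable_fun setT (fun u : P2 => u.2) := measurable_snd.

Let twice_twice (w : \bar R) : (2%:E * w + 2%:E * w = 4%:E * w)%E.
Proof.
have e : 2 + 2 = 4 :> R by ring.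
by rewrite -ge0_muleDl ?lee_fin// -EFinD e.
Qed.

Let scale_bound (s c j b : R) : s <= 1 -> 0 <= b ->
  s * (c * j + b) <= c * (s * j) + b.
Proof.
move=> s1 b0; have : s * b <= b by rewrite ler_piMl.
by rewrite mulrDr mulrCA lerD2l.
Qed.

Let sum_bound (d1 d2 d3 d4 b : \bar R) :
  (0 <= d4)%E -> (0 <= b)%E ->
  (d1 <= a%:E * d2 + b)%E -> (d2 <= 4%:E * d3)%E ->
  (d3 <= (a * expR 1)%:E * d4 + b)%E ->
  (d1 <= (4 * a ^+ 2 * expR 1)%:E * d4 + (4 * a + 1)%:E * b)%E.
Proof.
move=> d40 b0 s1 s2 s3; have ap := ltW a0.
apply: le_trans s1 _.
have s4 : (a%:E * d2 <= a%:E * (4%:E * ((a * expR 1)%:E * d4 + b)))%E.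
  apply: lee_wpmul2l; first by rewrite lee_fin.
  by apply: le_trans s2 _; apply: lee_wpmul2l; rewrite ?lee_fin.
apply: le_trans (leeD s4 (lexx b)) _.
have ae0 : 0 <= a * expR 1 by exact: mulr_ge0 ap (expR_ge0 1).
rewrite ge0_muleDr//; last by apply: mule_ge0 => //; rewrite lee_fin.
rewrite ge0_muleDr; last 2 first.
- by apply: mule_ge0; rewrite ?lee_fin//; apply: mule_ge0; rewrite ?lee_fin.
- by apply: mule_ge0; rewrite ?lee_fin.
rewrite !muleA -!EFinM -addeA; apply: leeD.
  have -> : a * 4 * (a * expR 1) = 4 * a ^+ 2 * expR 1 by ring.
  exact: lexx.
rewrite [(4 * a + 1)%:E]EFinD ge0_muleDl ?lee_fin//; last exact: mulr_ge0.
by rewrite mul1e (mulrC a).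
Qed.

(** Bound the square of a jump from [x] to [y] by those of the jumps from [x] to
    [z] and from [z] to [y], and integrate against [path]. *)
Lemma dirichlet_comparison (g : Rd R d -> R) : unit_fun g ->
  (\int[L]_x \int[L]_y ((g x - g y) ^+ 2 * ou_flow x y)%:E <=
   (4 * a ^+ 2 * expR 1)%:E *
     (\int[L]_x \int[L]_y ((g x - g y) ^+ 2 * mala_flow h x y)%:E) +
   (4 * a + 1)%:E * (\int[L]_x \int[L]_y (bad_flow x y)%:E))%E.
Proof.
move=> ug.
pose T3 := (Rd R d * Rd R d * Rd R d)%type.
have mg1 : measurable_fun setT (fun u : P2 => g u.1) := measurableT_comp ug.1 P2fst.
have mg2 : measurable_fun setT (fun u : P2 => g u.2) := measurableT_comp ug.1 P2snd.
have mD : measurable_fun setT (fun u : P2 => (g u.1 - g u.2) ^+ 2).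
  by apply: measurable_funX; exact: measurable_funB.
have sq0 x y : 0 <= (g x - g y) ^+ 2 by exact: sqr_ge0.
have sq1 x y : (g x - g y) ^+ 2 <= 1.
  have := unit_fun_ge0 ug x; have := unit_fun_le1 ug x.
  have := unit_fun_ge0 ug y; have := unit_fun_le1 ug y.
  move: (g x) (g y) => s t t1 t0 s1 s0.
  have : 0 <= (1 - (s - t)) * (1 + (s - t)) by apply: mulr_ge0; lra.
  lra.
pose q12 x y := fine (\int[L]_z (path x y z)%:E)%E.
pose q13 x z := fine (\int[L]_y (path x y z)%:E)%E.
have fin13 x z : (\int[L]_y (path x y z)%:E)%E \is a fin_num.
  rewrite ge0_fin_numE; last by apply: integral_EFin_ge0 => y; exact: path_ge0.
  exact: le_lt_trans (path_upper x z) (ltry _).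
have fin12 x y : (\int[L]_z (path x y z)%:E)%E \is a fin_num.
  rewrite ge0_fin_numE; last by apply: integral_EFin_ge0 => z; exact: path_ge0.
  apply: le_lt_trans (ltry (ou_flow x y)); rewrite -[leRHS]mule1 -(integral_bridge x y).
  rewrite -(ge0_integralZl_real L (mbridge x y) (bridge_ge0 x y) (ou_flow_ge0 x y)).
  apply: ge0_le_integral_EFin.
  - exact: (measurable_section1 (F := fun u z => path u.1 u.2 z) measurable3_path (x, y)).
  - by apply: mscal; exact: mbridge.
  - by move=> z; exact: path_ge0.
  - move=> z; rewrite /path ler_piMr//.
      exact: mulr_ge0 (ou_flow_ge0 x y) (bridge_ge0 x y z).
    rewrite -[leRHS]expR0 ler_expR oppr_le0.
    by apply: mulr_ge0; [exact: kap0 | exact: normr_ge0].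
have q12_0 x y : 0 <= q12 x y.
  by apply: fine_ge0; apply: integral_EFin_ge0 => z; exact: path_ge0.
have q13_0 x y : 0 <= q13 x y.
  by apply: fine_ge0; apply: integral_EFin_ge0 => z; exact: path_ge0.
have mq12 : measurable_fun setT (fun u : P2 => q12 u.1 u.2).
  apply: measurableT_comp => //.
  apply: (measurable_integral_section1 L (F := fun u z => path u.1 u.2 z)).
    exact: measurable3_path.
  by move=> u z; exact: path_ge0.
have mq13 : measurable_fun setT (fun u : P2 => q13 u.1 u.2).
  apply: measurableT_comp => //.
  apply: (measurable_integral_section1 L (F := fun u y => path u.1 y u.2)).
    apply: (measurableT_comp (f := fun u : T3 => path u.1.1 u.1.2 u.2)
      (g := fun u : T3 => ((u.1.1, u.2), u.1.2))); first exact: measurable3_path.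
    apply: measurable_fun_pair; last first.
      exact: measurableT_comp measurable_snd measurable_fst.
    apply: measurable_fun_pair; last exact: measurable_snd.
    exact: measurableT_comp measurable_fst measurable_fst.
  by move=> u z; exact: path_ge0.
have q12E x y : (\int[L]_z (path x y z)%:E)%E = (q12 x y)%:E.
  exact: esym (fineK (fin12 x y)).
have q13E x z : (\int[L]_y (path x y z)%:E)%E = (q13 x z)%:E.
  exact: esym (fineK (fin13 x z)).
clearbody q12 q13.
have bad0 x y : 0 <= bad_flow x y by exact: bad_flow_ge0.
have J0 x y : 0 <= mala_flow h x y.
  exact: mulr_ge0 (ltW (sym_flow_gt0 h x y)) (expR_ge0 _).
have mJ := @measurable_mala_flow R d h.
have mbad := measurable_bad_flow.
have aE0 : 0 <= a * expR 1 by apply: mulr_ge0; [exact: ltW | exact: expR_ge0].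
pose D (K : Rd R d -> Rd R d -> R) :=
  (\int[L]_x \int[L]_y ((g x - g y) ^+ 2 * K x y)%:E)%E.
pose B := (\int[L]_x \int[L]_y (bad_flow x y)%:E)%E.
have mDK (K : Rd R d -> Rd R d -> R) :
    measurable_fun setT (fun u : P2 => K u.1 u.2) ->
    measurable_fun setT (fun u : P2 => (g u.1 - g u.2) ^+ 2 * K u.1 u.2).
  by move=> mK; exact: measurable_funM.
have DK0 (K : Rd R d -> Rd R d -> R) : (forall x y, 0 <= K x y) ->
    forall x y, 0 <= (g x - g y) ^+ 2 * K x y.
  by move=> K0 x y; exact: mulr_ge0.
have mDB (k : R) (K : Rd R d -> Rd R d -> R) :
    measurable_fun setT (fun u : P2 => K u.1 u.2) ->
    measurable_fun setT (fun u : P2 =>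
      k * ((g u.1 - g u.2) ^+ 2 * K u.1 u.2) + bad_flow u.1 u.2).
  move=> mK; apply: measurable_funD; last exact: mbad.
  by apply: mscal; exact: mDK.
have DBE (k : R) (K : Rd R d -> Rd R d -> R) : 0 <= k ->
    measurable_fun setT (fun u : P2 => K u.1 u.2) -> (forall x y, 0 <= K x y) ->
    (\int[L]_x \int[L]_y (k * ((g x - g y) ^+ 2 * K x y) + bad_flow x y)%:E =
     k%:E * D K + B)%E.
  move=> k0 mK K0; apply: (etrans (ge0_integral2D L L (mscal k (mDK _ mK)) mbad
    (fun x y => mulr_ge0 k0 (DK0 _ K0 x y)) bad0)).
  by apply: (f_equal2 adde) => //; exact: (ge0_integral2Zl L L (mDK _ mK) (DK0 _ K0) k0).
have step1 : (D ou_flow <= a%:E * D q12 + B)%E.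
  rewrite -(DBE a q12 (ltW a0) mq12 q12_0).
  apply: (ge0_le_integral2 L L (mDK _ measurable_ou_flow) (mDB a _ mq12)
    (DK0 _ ou_flow_ge0)) => x y /=.
  case: (boolP (good x y)) => gxy.
    have H := path_lower gxy.
    have H2 : ou_flow x y <= a * q12 x y.
      by rewrite -lee_fin EFinM -q12E.
    apply: (@le_trans _ _ ((g x - g y) ^+ 2 * (a * q12 x y))).
      by apply: ler_wpM2l.
    by rewrite mulrCA lerDl.
  rewrite /bad_flow gxy mulr1; apply: (@le_trans _ _ (ou_flow x y)).
    by rewrite ler_piMl// ou_flow_ge0.
  rewrite lerDr; apply: mulr_ge0; first exact: ltW.
  exact: DK0.
pose F1 x (y z : Rd R d) := (g x - g y) ^+ 2 * path x y z.
pose F2 x (y z : Rd R d) := 2 * ((g x - g z) ^+ 2 * path x y z).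
pose F3 x (y z : Rd R d) := 2 * ((g z - g y) ^+ 2 * path x y z).
have m1 : measurable_fun setT (fun u : T3 => u.1.1).
  exact: measurableT_comp measurable_fst measurable_fst.
have m2 : measurable_fun setT (fun u : T3 => u.1.2).
  exact: measurableT_comp measurable_snd measurable_fst.
have m3 : measurable_fun setT (fun u : T3 => u.2) by exact: measurable_snd.
have mF (k1 k2 : T3 -> Rd R d) : measurable_fun setT k1 -> measurable_fun setT k2 ->
    measurable_fun setT (fun u : T3 => (g (k1 u) - g (k2 u)) ^+ 2 *
      path u.1.1 u.1.2 u.2).
  move=> mk1 mk2; apply: measurable_funM; last exact: measurable3_path.
  apply: measurable_funX; apply: measurable_funB.
    exact: measurableT_comp ug.1 mk1.
  exact: measurableT_comp ug.1 mk2.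
have mF1 : measurable3 F1 by exact: mF.
have mF2 : measurable3 F2 by apply: mscal; exact: mF.
have mF3 : measurable3 F3 by apply: mscal; exact: mF.
have F10 x y z : 0 <= F1 x y z by exact: mulr_ge0 (sq0 x y) (path_ge0 x y z).
have F20 x y z : 0 <= F2 x y z.
  by apply: mulr_ge0 => //; exact: mulr_ge0 (sq0 x z) (path_ge0 x y z).
have F30 x y z : 0 <= F3 x y z.
  by apply: mulr_ge0 => //; exact: mulr_ge0 (sq0 z y) (path_ge0 x y z).
have F123 x y z : F1 x y z <= F2 x y z + F3 x y z.
  have -> : F2 x y z + F3 x y z =
      (2 * ((g x - g z) ^+ 2 + (g z - g y) ^+ 2)) * path x y z.
    by rewrite /F2 /F3; ring.
  apply: ler_wpM2r; first exact: path_ge0.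
  by move: (g x) (g y) (g z) => s t w; have := sqr_ge0 (s - 2 * w + t); nra.
have D12 : D q12 = integral3 L F1.
  apply: eq_integral => x _; apply: eq_integral => y _.
  have mp := measurable_section1 (F := fun u z => path u.1 u.2 z)
    measurable3_path (x, y).
  rewrite EFinM -q12E.
  by rewrite -(ge0_integralZl_real L mp (path_ge0 x y) (sq0 x y)).
have F32 : integral3 L F3 = integral3 L F2.
  rewrite (integral3_swap12 L mF3 F30).
  apply: eq_integral => x _; apply: eq_integral => y _; apply: eq_integral => z _.
  by rewrite /F3 /F2 path_sym -sqrrN opprB.
have F2E : integral3 L F2 = (2%:E * D q13)%E.
  rewrite (integral3_swap23 L mF2 F20).
  rewrite -(ge0_integral2Zl L L (mDK _ mq13) (DK0 _ q13_0) (ler0n R 2)).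
  apply: eq_integral => x _; apply: eq_integral => z _.
  have mp : measurable_fun setT (fun y => path x y z).
    apply: (measurableT_comp (f := fun u : T3 => path u.1.1 u.1.2 u.2)
      (g := fun y => ((x, y), z))); first exact: measurable3_path.
    by apply: measurable_fun_pair => //; exact: measurable_fun_pair.
  transitivity (\int[L]_y ((2 * (g x - g z) ^+ 2) * path x y z)%:E)%E.
    by apply: eq_integral => y _; rewrite /F2 mulrA.
  have k0 : 0 <= 2 * (g x - g z) ^+ 2 by exact: mulr_ge0 (ler0n R 2) (sq0 x z).
  rewrite (ge0_integralZl_real L mp (fun y => path_ge0 x y z) k0).
  by rewrite q13E -EFinM -mulrA.
have eqle (u w : \bar R) : u = w -> (u <= w)%E by move=> ->.
have step2 : (D q12 <= 4%:E * D q13)%E.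
  rewrite D12; apply: le_trans (integral3_le L mF1 (measurable_funD mF2 mF3) F10 F123) _.
  have e := etrans (integral3D L mF2 mF3 F20 F30)
    (f_equal2 adde F2E (etrans F32 F2E)).
  by rewrite -twice_twice; exact: (eqle _ _ e).
have step3 : (D q13 <= (a * expR 1)%:E * D (mala_flow h) + B)%E.
  rewrite -(DBE _ _ aE0 mJ J0).
  apply: (ge0_le_integral2 L L (mDK _ mq13) (mDB (a * expR 1) _ mJ)
    (DK0 _ q13_0)) => x z /=.
  have H : q13 x z <= a * expR 1 * mala_flow h x z + bad_flow x z.
    by rewrite -lee_fin -q13E; exact: path_upper.
  apply: le_trans (ler_wpM2l (sq0 x z) H) _.
  exact: scale_bound (sq1 x z) (bad0 x z).
rewrite -/(D ou_flow) -/(D (mala_flow h)) -/B.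
have D0 (K : Rd R d -> Rd R d -> R) : (forall x y, 0 <= K x y) -> (0 <= D K)%E.
  by move=> K0; apply: integral_ge0 => x _; apply: integral_EFin_ge0 => y; exact: DK0.
have B0 : (0 <= B)%E.
  by apply: integral_ge0 => x _; apply: integral_EFin_ge0 => y.
exact: sum_bound (D0 _ J0) B0 step1 step2 step3.
Qed.

(** * The bad pairs and the contraction of the variance *)

Let tilted (c1 c2 k : R) x y : R :=
  expR k * (ou_flow x y * expR (c1 * chi_plus x y + c2 * chi_minus x y)).

Let tilted_ge0 c1 c2 k x y : 0 <= tilted c1 c2 k x y.
Proof. exact: mulr_ge0 (expR_ge0 _) (mulr_ge0 (ou_flow_ge0 x y) (expR_ge0 _)). Qed.

Let mtilted c1 c2 k : measurable_fun setT (fun u : P2 => tilted c1 c2 k u.1 u.2).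
Proof.
apply: mscal; apply: measurable_funM; first exact: measurable_ou_flow.
apply: mexp; apply: measurable_funD; apply: mscal;
  [exact: measurable_chi_plus | exact: measurable_chi_minus].
Qed.

(** The moment generating function of a pair of independent chi-square variables,
    [(1 - 2 * c1) ^ (- d / 2) * (1 - 2 * c2) ^ (- d / 2)]. *)
Let integral_tilted c1 c2 k : 2 * c1 < 1 -> 2 * c2 < 1 ->
  (\int[L]_x \int[L]_y (tilted c1 c2 k x y)%:E =
   (expR (k - d%:R / 2 * (ln (1 - 2 * c1) + ln (1 - 2 * c2))))%:E)%E.
Proof.
move=> c11 c21; have q1 : 0 < 1 - 2 * c1 by rewrite subr_gt0.
have q2 : 0 < 1 - 2 * c2 by rewrite subr_gt0.
have e0 := ou_step_gt0.
pose A := (1 - 2 * c1) / (4 * (1 + r)); pose B := (1 - 2 * c2) / (4 * e).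
have A0 : 0 < A := divr_gt0 q1 (mulr_gt0 (ltr0n R 4) rD0).
have B0 : 0 < B := divr_gt0 q2 (mulr_gt0 (ltr0n R 4) e0).
transitivity (\int[L]_x \int[L]_y (expR (k - d%:R * ln (2 * pi)
      - d%:R / 2 * ln (1 - r ^+ 2)
     - A * (sqnorm x + 2 * dot x y + sqnorm y)
     - B * (sqnorm x - 2 * dot x y + sqnorm y)))%:E)%E.
  apply: eq_integral => x _; apply: eq_integral => y _; congr EFin.
  rewrite /tilted /ou_flow -!expRD; congr expR.
  rewrite /chi_plus /chi_minus /A /B.
  move: rDn en; move: e (ln (1 - r ^+ 2)) => s l rDn' en'.
  by field; rewrite rDn' en'.
rewrite gaussian_integral2//; congr (expR _)%:E.
have re : 1 - r ^+ 2 = e * (1 + r) by ring.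
have -> : 4 * A * B = (1 - 2 * c1) * (1 - 2 * c2) / (2 * 2 * (e * (1 + r))).
  rewrite /A /B; move: rDn en; move: e => s rDn' en'.
  by field; rewrite rDn' en'.
rewrite re.
have pi0 := pi_gt0 R; have er0 : 0 < e * (1 + r) := mulr_gt0 e0 rD0.
have l4 : ln (2 * 2 * (e * (1 + r))) = ln 2 + ln 2 + ln (e * (1 + r)).
  have t0 : (2 : R) \is Num.pos by rewrite posrE.
  have tt0 : (2 * 2 : R) \is Num.pos by rewrite posrE mulr_gt0.
  have es : e * (1 + r) \is Num.pos by rewrite posrE.
  by rewrite (lnM tt0 es) (lnM t0 t0).
rewrite ln_div ?posrE ?(mulr_gt0 q1 q2)//; last first.
  by apply: mulr_gt0 => //; exact: mulr_gt0.
rewrite l4 (lnM (x := 1 - 2 * c1)) ?posrE// (lnM (x := 2) (y := pi)) ?posrE//.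
by field.
Qed.

(** Chernoff bounds for the two tails of the two chi-square variables. *)
Let integral_bad_flow t : 0 < t -> t <= 4^-1 ->
  (\int[L]_x \int[L]_y (bad_flow x y)%:E <=
   (4 * expR (4 * t ^+ 2 * d%:R - t * tau))%:E)%E.
Proof.
move=> t0 t4; pose D : R := d%:R; have D0 : 0 <= D := ler0n R d.
pose F := tilted t 0 (- t * D - t * tau); pose G := tilted (- t) 0 (t * D - t * tau).
pose H := tilted 0 t (- t * D - t * tau); pose K := tilted 0 (- t) (t * D - t * tau).
have F0 x y : 0 <= F x y by exact: tilted_ge0.
have G0 x y : 0 <= G x y by exact: tilted_ge0.
have H0 x y : 0 <= H x y by exact: tilted_ge0.
have K0 x y : 0 <= K x y by exact: tilted_ge0.
have mF : measurable_fun setT (fun u : P2 => F u.1 u.2) by exact: mtilted.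
have mG : measurable_fun setT (fun u : P2 => G u.1 u.2) by exact: mtilted.
have mH : measurable_fun setT (fun u : P2 => H u.1 u.2) by exact: mtilted.
have mK : measurable_fun setT (fun u : P2 => K u.1 u.2) by exact: mtilted.
have tail (u : R) : tau < `|u - D| ->
    1 <= expR (t * (u - D) - t * tau) + expR (- t * (u - D) - t * tau).
  move=> tu; have [uD|uD] := leP 0 (u - D).
    rewrite ger0_norm// in tu.
    apply: (@le_trans _ _ (expR (t * (u - D) - t * tau))).
      by rewrite -[leLHS]expR0 ler_expR -mulrBr mulr_ge0 ?ltW// subr_gt0.
    by rewrite lerDl expR_ge0.
  rewrite ltr0_norm// in tu.
  apply: (@le_trans _ _ (expR (- t * (u - D) - t * tau))).
    by rewrite -[leLHS]expR0 ler_expR mulNr -mulrN -mulrBr mulr_ge0 ?ltW// subr_gt0.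
  by rewrite lerDr expR_ge0.
have tE c s k x y u : u = k + (c * chi_plus x y + s * chi_minus x y) ->
    ou_flow x y * expR u = tilted c s k x y.
  by move=> ->; rewrite /tilted (expRD k) (mulrCA (expR k) (ou_flow x y)).
have tE1 x y : ou_flow x y * expR (t * (chi_plus x y - D) - t * tau) = F x y.
  by apply: tE; ring.
have tE2 x y : ou_flow x y * expR (- t * (chi_plus x y - D) - t * tau) = G x y.
  by apply: tE; ring.
have tE3 x y : ou_flow x y * expR (t * (chi_minus x y - D) - t * tau) = H x y.
  by apply: tE; ring.
have tE4 x y : ou_flow x y * expR (- t * (chi_minus x y - D) - t * tau) = K x y.
  by apply: tE; ring.
have ptw x y : bad_flow x y <= (F x y + G x y) + (H x y + K x y).
  rewrite /bad_flow /good; have o0 := ou_flow_ge0 x y.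
  have FG0 : 0 <= F x y + G x y by exact: addr_ge0.
  have HK0 : 0 <= H x y + K x y by exact: addr_ge0.
  have [p1|p1] := leP `|chi_plus x y - d%:R| tau; last first.
    rewrite /= mulr1; apply: (@le_trans _ _ (F x y + G x y)); last by rewrite lerDl.
    rewrite -tE1 -tE2 -mulrDr -[leLHS]mulr1; apply: ler_wpM2l => //.
    exact: tail.
  have [p2|p2] := leP `|chi_minus x y - d%:R| tau.
    by rewrite /= mulr0; exact: addr_ge0.
  rewrite /= mulr1; apply: (@le_trans _ _ (H x y + K x y)); last by rewrite lerDr.
  rewrite -tE3 -tE4 -mulrDr -[leLHS]mulr1; apply: ler_wpM2l => //.
  exact: tail.
have mFG := measurable_funD mF mG; have mHK := measurable_funD mH mK.
have FG0 x y : 0 <= F x y + G x y by exact: addr_ge0.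
have HK0 x y : 0 <= H x y + K x y by exact: addr_ge0.
apply: le_trans (ge0_le_integral2 L L measurable_bad_flow (measurable_funD mFG mHK)
  bad_flow_ge0 ptw) _.
have E := etrans (ge0_integral2D L L mFG mHK FG0 HK0) (f_equal2 adde
  (ge0_integral2D L L mF mG F0 G0) (ge0_integral2D L L mH mK H0 K0)).
apply: le_trans (eq_ind _ (fun w => _ <= w)%E (lexx _) _ E) _.
pose b := expR (4 * t ^+ 2 * D - t * tau).
have bound (c s k : R) : 2 * c < 1 -> 2 * s < 1 ->
    k - D / 2 * (ln (1 - 2 * c) + ln (1 - 2 * s)) <= 4 * t ^+ 2 * D - t * tau ->
    (\int[L]_x \int[L]_y (tilted c s k x y)%:E <= b%:E)%E.
  by move=> c1 s1 le; rewrite integral_tilted// lee_fin ler_expR.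
have ln10 : ln (1 - 2 * 0) = 0 :> R by rewrite mulr0 subr0 ln1.
have t2 : 2 * t < 1 by lra.
have tm2 : 2 * - t < 1 by lra.
have zz : 2 * 0 < 1 :> R by rewrite mulr0.
have q1 : - ln (1 - 2 * t) <= 2 * t + 8 * t ^+ 2.
  apply: le_trans (neg_ln_le t2) _.
  by rewrite ler_pdivrMr ?subr_gt0//; nra.
have q2 : - ln (1 - 2 * - t) <= - (2 * t) + 8 * t ^+ 2.
  apply: le_trans (neg_ln_le tm2) _.
  by rewrite ler_pdivrMr ?subr_gt0//; nra.
have Dq1 := ler_wpM2l (divr_ge0 D0 (ler0n R 2)) q1.
have Dq2 := ler_wpM2l (divr_ge0 D0 (ler0n R 2)) q2.
have c1 : - t * D - t * tau - D / 2 * ln (1 - 2 * t) <= 4 * t ^+ 2 * D - t * tau.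
  by move: Dq1; rewrite /D; move: (ln _) d%:R => l n; lra.
have c2 : t * D - t * tau - D / 2 * ln (1 - 2 * - t) <= 4 * t ^+ 2 * D - t * tau.
  by move: Dq2; rewrite /D; move: (ln _) d%:R => l n; lra.
have -> : (4 * b)%:E = ((b + b)%R%:E + (b + b)%R%:E)%E.
  by rewrite -EFinD; congr EFin; ring.
rewrite !EFinD; apply: leeD; apply: leeD; apply: bound => //.
- by rewrite ln10 addr0.
- by rewrite ln10 addr0.
- by rewrite ln10 add0r.
- by rewrite ln10 add0r.
Qed.

Lemma dirichlet_const_ge1 : 1 <= 4 * a ^+ 2 * expR 1.
Proof.
have e1 : 1 <= expR 1 :> R by apply: le_trans (expR_ge1Dx _); lra.
have a1 : 1 <= a by rewrite /path_const; lra.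
move: e1 a1; move: (expR 1) a => s b s1 b1; nra.
Qed.

(** Positivity of the operator bounds the loss of variance below by half of the
    Dirichlet form, which dominates the Ornstein-Uhlenbeck one; the Poincare
    inequality of the latter is then of order [h]. *)
Lemma variance_mala_op t (g : Rd R d -> R) : 0 < t -> t <= 4^-1 -> unit_fun g ->
  gauss_variance (mala_op h g) <= (1 - h / (4 * a ^+ 2 * expR 1)) * gauss_variance g
    + (4 * a + 1) * (4 * expR (4 * t ^+ 2 * d%:R - t * tau)).
Proof.
move=> t0 t4 ug; have r0 := ou_corr_gt0; have r1 := ou_corr_lt1.
have H := dirichlet_comparison ug.
rewrite (mala_dirichlet h0 ug) in H.
have HO : (\int[L]_x \int[L]_y ((g x - g y) ^+ 2 * ou_flow x y)%:E)%E =
    (2 * (\int[gauss]_x (g x * g x) - \int[gauss]_x (g x * ou_op r g x)))%:E.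
  under eq_integral do under eq_integral do rewrite -ou_flow_pdfE.
  apply: (dirichlet_formE (measurable_std_gaussian_pdf (d := d))
    (std_gaussian_pdf_ge0 (d := d)) (std_gaussianE (d := d))
    (measurable_ou_pdf r0 r1) (@ou_pdf_ge0 R d r) _ _ ug).
  - by move=> x; rewrite integral_ou_pdf.
  - by move=> x y; exact: ou_flow_sym.
rewrite HO in H.
have aE := dirichlet_const_ge1.
have a41 : 0 < 4 * a + 1 by rewrite ltr_wpDl// mulr_ge0// ltW.
have B := integral_bad_flow t0 t4.
have {}H := le_trans H (leeD (lexx _)
  (lee_wpmul2l (eqbRL (lee_fin _ _) (ltW a41)) B)).
rewrite -!EFinM -EFinD lee_fin in H.
have P := ou_poincare r0 r1 ug; rewrite /autocov in P.
have C := mala_op_contraction h0 h1 ug.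
have M := mala_op_mean h0 ug.
have V0 := gauss_variance_ge0 ug.
have /andP[he _] := ou_step_bounds h0 h4.
have hV := ler_wpM2r V0 he.
rewrite {1}/gauss_variance M.
exact: (variance_contraction_of_dirichlet aE
  (mulr_ge0 (ltW a41) (mulr_ge0 (ler0n R 4) (expR_ge0 _))) H erefl P C hV).
Qed.

End flow_comparison.

(** * From the decay of the variance to the mixing time *)

Section warm_start.
Context d (X : measurableType d) (R : realType).
Variables (mu pi : probability X R) (M : R).
Hypothesis muM : warm M mu pi.

Lemma warm_ge1 : 1 <= M.
Proof.
have := muM measurableT; rewrite !probability_setT mule1 lee_fin; exact.
Qed.

Lemma warm_integral_le (f : X -> R) : measurable_fun setT f ->
  (forall x, 0 <= f x) -> (\int[mu]_x (f x)%:E <= M%:E * \int[pi]_x (f x)%:E)%E.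
Proof.
move=> mf f0; have M0 : 0 <= M by apply: le_trans warm_ge1.
have mfE : measurable_fun setT (EFin \o f) by exact/measurable_EFinP.
have fE (x : X) : setT x -> (0 <= (EFin \o f) x)%E by rewrite lee_fin.
have := ge0_integral_mscale pi measurableT (NngNum M0) mfE fE => /= <-.
by apply: ge0_le_measure_integral => // x; rewrite lee_fin.
Qed.

(** From [|F - m| <= eta / 2 + (F - m) ^ 2 / (2 * eta)], with [m] the mean of [F]. *)
Lemma warm_mean_le (F : X -> R) (eta : R) : unit_fun F -> 0 < eta ->
  `|\int[mu]_x F x - \int[pi]_x F x| <=
  M * (eta / 2 + (\int[pi]_x (F x * F x) - (\int[pi]_x F x) ^+ 2) / (2 * eta)).
Proof.
move=> uF e0.
have /andP[m0 m1] := unit_fun_integral_le1 pi uF.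
have F0 := unit_fun_ge0 uF; have F1 := unit_fun_le1 uF.
have sqE := integral_square_affine pi 1 0 (- \int[pi]_x F x) uF uF.
move: sqE m0 m1; move: (\int[pi]_x F x) => m sqE m0 m1.
pose s x := (1 * F x + 0 * F x + - m) ^+ 2.
have us : unit_fun s.
  split.
    apply: measurable_funX; apply: measurable_funD => //.
    by apply: measurable_funD; apply: measurable_funM => //; exact: uF.1.
  move=> x; rewrite sqr_ge0/= /s; have := F0 x; have := F1 x.
  by move: (F x) => u u1 u0; nra.
have s0 := unit_fun_ge0 us.
have k0 : 0 <= (2 * eta)^-1 by rewrite invr_ge0; lra.
have e20 : 0 <= eta / 2 by lra.
pose phi x := (2 * eta)^-1 * s x + eta / 2.
have mks : measurable_fun setT (fun x => (2 * eta)^-1 * s x).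
  by apply: measurable_funM => //; exact: us.1.
have ks0 x : 0 <= (2 * eta)^-1 * s x by exact: mulr_ge0.
have phi0 x : 0 <= phi x by exact: addr_ge0.
have mphi : measurable_fun setT phi by exact: measurable_funD.
have bound u : u - m <= (2 * eta)^-1 * (1 * u + 0 * u + - m) ^+ 2 + eta / 2 /\
    m - u <= (2 * eta)^-1 * (1 * u + 0 * u + - m) ^+ 2 + eta / 2.
  have := sqr_ge0 (u - m - eta); have := sqr_ge0 (u - m + eta) => s1 s2.
  have i1 := mulr_ge0 k0 s1; have i2 := mulr_ge0 k0 s2.
  have E1 : (2 * eta)^-1 * (1 * u + 0 * u + - m) ^+ 2 + eta / 2 - (u - m) =
      (2 * eta)^-1 * (u - m - eta) ^+ 2 by field; rewrite gt_eqF.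
  have E2 : (2 * eta)^-1 * (1 * u + 0 * u + - m) ^+ 2 + eta / 2 - (m - u) =
      (2 * eta)^-1 * (u - m + eta) ^+ 2 by field; rewrite gt_eqF.
  by rewrite -E1 in i2; rewrite -E2 in i1; split; rewrite -subr_ge0.
have cstE (nu : probability X R) (c : R) : (\int[nu]_x c%:E = c%:E)%E.
  have := @integral_cst _ _ _ nu setT measurableT c%:E => /= ->.
  by rewrite [nu _]probability_setT mule1.
have piphi : (\int[pi]_x (phi x)%:E =
    ((2 * eta)^-1 * (\int[pi]_x (F x * F x) - m ^+ 2) + eta / 2)%:E)%E.
  rewrite (ge0_integralD_EFin _ mks (measurable_cst _) ks0 (fun _ => e20)).
  rewrite (ge0_integralZl_real _ us.1 s0 k0) (unit_fun_integralE _ us) sqE.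
  rewrite cstE -EFinM -EFinD; congr EFin.
  by move: (\int[pi]_x (F x * F x)) => q; ring.
have := warm_integral_le mphi phi0; rewrite piphi -EFinM.
have -> : (2 * eta)^-1 * (\int[pi]_x (F x * F x) - m ^+ 2) + eta / 2 =
    eta / 2 + (\int[pi]_x (F x * F x) - m ^+ 2) / (2 * eta).
  by move: (\int[pi]_x (F x * F x)) => q; rewrite [LHS]addrC [(2 * eta)^-1 * _]mulrC.
move: (M * (eta / 2 + _)) => b muphi.
have muF := unit_fun_integralE mu uF.
rewrite ler_norml; apply/andP; split.
  suff : (m%:E <= (\int[mu]_x F x)%:E + b%:E)%E.
    by rewrite -EFinD lee_fin => ?; lra.
  rewrite -muF -[leLHS](cstE mu); apply: (@le_trans _ _ (\int[mu]_x (F x + phi x)%:E)%E).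
    apply: ge0_le_integral_EFin => //; first by apply: measurable_funD => //; exact: uF.1.
    by move=> x; have [_ ] := bound (F x); rewrite lerBlDl.
  by rewrite (ge0_integralD_EFin _ uF.1 mphi F0 phi0); exact: leeD.
suff : ((\int[mu]_x F x)%:E <= m%:E + b%:E)%E.
  by rewrite -EFinD lee_fin => ?; lra.
rewrite -muF; apply: (@le_trans _ _ (\int[mu]_x (m + phi x)%:E)%E).
  apply: ge0_le_integral_EFin => //; [exact: uF.1 | exact: measurable_funD|].
  by move=> x; have [+ _] := bound (F x); rewrite lerBlDl.
rewrite (ge0_integralD_EFin mu (measurable_cst m) mphi (fun=> m0) phi0) cstE.
exact: leeD.
Qed.

(** Warmness applied to a set and to its complement bounds the excess and the
    deficit of its mass. *)
Lemma tv_dist_warm_le : (tv_dist mu pi <= (1 - M^-1)%:E)%E.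
Proof.
apply: ge_ereal_sup => _ [B mB <-].
have M1 := warm_ge1.
have fin (nu : probability X R) A : measurable A -> nu A = (fine (nu A))%:E.
  by move=> mA; rewrite fineK// fin_num_measure.
have HB := muM mB; have HC := muM (measurableC mB).
rewrite !probability_setC// in HC.
have p1 := probability_le1 pi mB; have q1 := probability_le1 mu mB.
have q0 : 0 <= fine (mu B) by apply: fine_ge0.
move: HB HC p1 q1; rewrite (fin mu B mB) (fin pi B mB); move: q0.
move: (fine (mu B)) (fine (pi B)) => q p.
rewrite -!EFinB -!EFinM abse_EFin !lee_fin => q0 HB HC p1 q1.
have Mi : 0 < M^-1 by rewrite invr_gt0; lra.
have MM : M^-1 * M = 1 by rewrite mulVf// gt_eqF; lra.
have H1 := ler_wpM2l (ltW Mi) HB; have H2 := ler_wpM2l (ltW Mi) HC.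
rewrite !mulrA MM !mul1r in H1 H2.
have Mi1 : M^-1 <= 1 by rewrite invf_le1//; lra.
move: H1 H2 Mi1 Mi; move: M^-1 => i H1 H2 Mi1 Mi.
have A1 : 0 <= (1 - q) * (1 - i) by apply: mulr_ge0; lra.
have A2 : 0 <= q * (1 - i) by apply: mulr_ge0; lra.
rewrite ler_norml; apply/andP; split; lra.
Qed.

End warm_start.

Lemma geometric_decay (R : realType) (q b : R) (V : nat -> R) : 0 < q -> q <= 1 ->
  0 <= b -> V 0%N <= 1 -> (forall n, V n.+1 <= (1 - q) * V n + b) ->
  forall n, V n <= expR (- (n%:R * q)) + b / q.
Proof.
move=> q0 q1 b0 V0 VS; have bq0 : 0 <= b / q by rewrite divr_ge0// ltW.
elim=> [|n IH].
  by rewrite mul0r oppr0 expR0; apply: le_trans V0 _; rewrite lerDl.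
apply: le_trans (VS n) _.
have E : b / q * q = b by rewrite divfK// gt_eqF.
have Eexp : expR (- (n.+1%:R * q)) = expR (- (n%:R * q)) * expR (- q).
  by rewrite -expRD; congr expR; rewrite -natr1; ring.
have e1 : 1 - q <= expR (- q) by exact: expR_ge1Dx.
have q10 : 0 <= 1 - q by lra.
have H1 := ler_wpM2l q10 IH.
have H2 := ler_wpM2l (expR_ge0 (- (n%:R * q))) e1.
rewrite Eexp; apply: le_trans (lerD H1 (lexx b)) _.
move: H2 E; move: (expR (- (n%:R * q))) (expR (- q)) (b / q) => x y z H2 E.
lra.
Qed.

Section convergence.
Context (R : realType) (d : nat) (h tau t : R).
Hypotheses (h0 : 0 < h) (h4 : h <= 4^-1) (hd : h ^+ 3 * d%:R <= 1).
Hypotheses (tau0 : 0 <= tau) (htau : h ^+ 2 * tau <= 1).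
Hypotheses (t0 : 0 < t) (t4 : t <= 4^-1).
Local Notation gauss := (@std_gaussian R d).
Local Notation a := (path_const R).

Lemma unit_fun_iter_mala_op n (g : Rd R d -> R) : unit_fun g ->
  unit_fun (iter n (mala_op h) g).
Proof. by move=> ug; elim: n => //= n; exact: unit_fun_mala_op. Qed.

Lemma iter_mala_op_mean n (g : Rd R d -> R) : unit_fun g ->
  \int[gauss]_x iter n (mala_op h) g x = \int[gauss]_x g x.
Proof.
move=> ug; elim: n => // n IH; rewrite -IH.
exact: (mala_op_mean h0) (unit_fun_iter_mala_op n ug).
Qed.

Definition variance_rate : R := h / (4 * a ^+ 2 * expR 1).

Definition variance_error : R :=
  (4 * a + 1) * (4 * expR (4 * t ^+ 2 * d%:R - t * tau)).

Lemma variance_iter_mala_op n (g : Rd R d -> R) : unit_fun g ->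
  gauss_variance (iter n (mala_op h) g) <=
  expR (- (n%:R * variance_rate)) + variance_error / variance_rate.
Proof.
move=> ug; have c1 := dirichlet_const_ge1 R.
have c0 : 0 < 4 * a ^+ 2 * expR 1 by apply: lt_le_trans c1.
have a0 : 0 < a by rewrite mulr_gt0// expR_gt0.
apply: (@geometric_decay R variance_rate variance_error
  (fun n => gauss_variance (iter n (mala_op h) g))).
- exact: divr_gt0.
- by rewrite /variance_rate ler_pdivrMr// mul1r; have := h4; lra.
- by apply: mulr_ge0; [lra | rewrite mulr_ge0 ?expR_ge0].
- have /andP[_ H] := unit_fun_integral_le1 gauss (unit_funM ug ug).
  apply: le_trans H; rewrite /= /gauss_variance gerBl; exact: sqr_ge0.
- move=> k; exact: (variance_mala_op h0 h4 hd tau0 htau t0 t4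
    (unit_fun_iter_mala_op k ug)).
Qed.

Lemma tv_dist_mala_law_le (mu0 : probability (Rd R d) R) (M0 eta : R) n :
  warm M0 mu0 gauss -> 0 < eta ->
  (tv_dist (mala_law h mu0 n) gauss <=
   (M0 * (eta / 2 + (expR (- (n%:R * variance_rate))
      + variance_error / variance_rate) / (2 * eta)))%:E)%E.
Proof.
move=> wM e0; apply: ge_ereal_sup => _ [B mB <-].
have h1 : h < 1 by have := h4; lra.
have uB : unit_fun (\1_B : Rd R d -> R) by exact: unit_fun_indic.
have uF := unit_fun_iter_mala_op n uB.
have M0p : 0 <= M0 by apply: le_trans (warm_ge1 wM).
have gE : gauss B = (\int[gauss]_x iter n (mala_op h) \1_B x)%:E.
  rewrite (iter_mala_op_mean n uB) -(unit_fun_integralE gauss uB).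
  by rewrite integral_indic// setIT.
rewrite mala_lawE// gE -EFinB abse_EFin lee_fin.
apply: le_trans (warm_mean_le wM uF e0) _.
apply: ler_wpM2l => //; rewrite lerD2l ler_pM2r ?invr_gt0 ?mulr_gt0//.
exact: variance_iter_mala_op.
Qed.

End convergence.

Lemma mixing_time_le (R : realType) d (X : measurableType d) (eps : R)
    (law : nat -> set X -> \bar R) (nu : set X -> \bar R) n :
  (tv_dist (law n) nu <= eps%:E)%E -> (mixing_time eps law nu <= n%:R%:E)%E.
Proof. by move=> H; apply: ereal_inf_lbound; exists n. Qed.

Lemma ln2_bounds (R : realType) : 1 <= 2 * ln (2 : R) /\ ln (2 : R) <= 1.
Proof.
have H1 : ln (1 + 1) <= 1 :> R by apply: le_ln1Dx; lra.
have H2 : ln (1 + - 2^-1) <= - 2^-1 :> R by apply: le_ln1Dx; lra.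
have E1 : 1 + 1 = 2 :> R by ring.
have E2 : 1 + - 2^-1 = 2^-1 :> R by field.
by rewrite E1 in H1; rewrite E2 lnV ?posrE// in H2; split => //; lra.
Qed.

(** The tail parameter in the exponent is chosen so that one term absorbs the
    accuracy [(x * h) ^ 2 >= exp (- 2 * K * D)] and the other the constants. *)
Lemma bad_error_le (R : realType) (K C1 C2 D h x : R) : 0 <= K -> 0 < h -> h <= 1 ->
  1 <= D -> 1 <= 2 * (C1 * C2) -> expR (- (K * D)) <= x * h ->
  C2 * expR (D / 4 - (1 + 8 * K + 4 * ln (2 * (C1 * C2))) * D / 4) / (h / C1)
    <= x ^+ 2 / 2.
Proof.
move=> K0 h0 h1 D1 C12 Hx; have c0 : 0 < 2 * (C1 * C2) by lra.
have k0 : 0 <= ln (2 * (C1 * C2)) by exact: ln_ge0.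
have kE : expR (ln (2 * (C1 * C2))) = 2 * (C1 * C2) by rewrite lnK.
move: k0 kE; move: (ln _) => k k0 kE.
set E := expR _.
have E0 : 0 <= E by exact: expR_ge0.
have HE : E * (2 * (C1 * C2)) <= (x * h) ^+ 2.
  apply: (@le_trans _ _ (expR (- (K * D)) ^+ 2)); last first.
    by rewrite ler_sqr ?nnegrE ?expR_ge0//; apply: le_trans Hx; exact: expR_ge0.
  rewrite -kE /E -expRD expr2 -expRD ler_expR.
  have : k <= k * D by rewrite ler_peMr.
  lra.
have -> : C2 * E / (h / C1) = E * (2 * (C1 * C2)) / (2 * h).
  have C1n : C1 != 0 by apply: contraTneq c0 => ->; rewrite mul0r mulr0 ltxx.
  by field; rewrite C1n gt_eqF.
rewrite ler_pdivrMr ?mulr_gt0//.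
apply: le_trans HE _; rewrite exprMn.
have -> : x ^+ 2 / 2 * (2 * h) = x ^+ 2 * h by field.
by apply: ler_wpM2l; [exact: sqr_ge0 | rewrite expr2 ler_piMl// ltW].
Qed.

Theorem proposition37 (R : realType) (K : R) (K_gt0 : 0 < K) :
  exists c C : R, 0 < c /\ 0 < C /\
    forall (d : nat) (h : R), (1 <= d)%N -> h = c * d%:R `^ (- 3^-1) ->
    forall (mu0 : probability (Rd R d) R) (M0 eps : R),
      warm M0 mu0 (@std_gaussian R d) ->
      0 < eps -> eps < M0 ->
      ln (M0 / (eps * h)) <= K * d%:R `^ (3^-1) ->
      (mixing_time eps (mala_law h mu0) (@std_gaussian R d)
       <= (C * d%:R `^ (3^-1) * ln (M0 / eps))%:E)%E.
Proof.
have [ln2l ln2u] := ln2_bounds R.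
(* [C1 / h] bounds the relaxation time and [C2] multiplies the mass of the bad pairs *)
pose C1 : R := 4 * path_const R ^+ 2 * expR 1.
pose C2 : R := (4 * path_const R + 1) * 4.
have C1_1 : 1 <= C1 := dirichlet_const_ge1 R.
have C2_1 : 1 <= C2.
  have : 0 <= path_const R by rewrite mulr_ge0// expR_ge0.
  by rewrite /C2; lra.
have C12 : 1 <= 2 * (C1 * C2).
  by clearbody C1 C2; have := mulr_ge0 (eqbRL (subr_ge0 _ _) C1_1)
    (eqbRL (subr_ge0 _ _) C2_1); lra.
pose T0 : R := 1 + 8 * K + 4 * ln (2 * (C1 * C2)).
have T1 : 1 <= T0 by have := ln_ge0 C12; rewrite /T0; have := K_gt0; lra.
have T0p : 0 < T0 by lra.
pose c : R := (8 * T0)^-1.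
have c0 : 0 < c by rewrite invr_gt0 mulr_gt0.
have cT : c * T0 = 8^-1 by rewrite /c; field; rewrite gt_eqF.
have c8 : c <= 8^-1 by rewrite -cT ler_peMr// ltW.
exists c, (3 * C1 / c + 1); split=> //; split.
  by rewrite addr_gt0// divr_gt0// mulr_gt0//; lra.
move=> d h d1 hE mu0 M0 eps wM e0 eM lnle.
set D := d%:R `^ 3^-1 in lnle *.
have dR1 : 1 <= d%:R :> R by rewrite ler1n.
have D1 : 1 <= D.
  have -> : 1 = 1 `^ 3^-1 :> R by rewrite powR1.
  by apply: ge0_ler_powR; rewrite ?nnegrE//; lra.
have D0 : 0 < D by lra.
have D3 : D ^+ 3 = d%:R.
  by rewrite -powR_mulrn ?powR_ge0// /D -powRrM mulVf// powRr1// ler0n.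
have {}hE : h = c / D by rewrite hE powRN.
have h0 : 0 < h by rewrite hE divr_gt0.
have hc : h <= c by rewrite hE ler_pdivrMr// ler_peMr// ltW.
have M00 : 0 < M0 by apply: lt_trans eM.
pose x := eps / M0; have x0 : 0 < x by rewrite divr_gt0.
have x1 : x < 1 by rewrite ltr_pdivrMr// mul1r.
have lE : ln (M0 / eps) = - ln x.
  by rewrite -lnV ?posrE// /x invf_div.
have l0 : 0 < - ln x by rewrite oppr_gt0 ln_lt0// x0.
have K1D : 0 < (3 * C1 / c + 1) * D.
  by rewrite mulr_gt0// addr_gt0// divr_gt0// mulr_gt0//; lra.
rewrite lE.
(* a start that is already close enough needs no step *)
have [big|small] := leP (1 - M0^-1) eps.
  apply: (@le_trans _ _ (0%:R%:E)).
    apply: mixing_time_le => /=; apply: le_trans (tv_dist_warm_le wM) _.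
    by rewrite lee_fin.
  by rewrite lee_fin mulr_ge0// ltW.
(* here [eps / M0 < (1 - 1 / M0) / M0 <= 1 / 4] and [ln 4 >= 1] *)
have l1 : 1 <= - ln x.
  have x4 : x <= 4^-1.
    rewrite /x; apply: (@le_trans _ _ ((1 - M0^-1) / M0)).
      by rewrite ler_pM2r ?invr_gt0// ltW.
    by have := sqr_ge0 (M0^-1 - 2^-1); move: (M0^-1) => i; lra.
  have : ln x <= ln 4^-1 by rewrite ler_ln ?posrE.
  rewrite lnV ?posrE//; have -> : 4 = 2 ^+ 2 :> R by ring.
  by rewrite lnXn//; move: (ln x) => u; rewrite mulr2n; lra.
have hx : expR (- (K * D)) <= x * h.
  have xh0 : 0 < x * h by exact: mulr_gt0.
  have -> : x * h = expR (ln (x * h)) by rewrite lnK.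
  rewrite ler_expR.
  have E : M0 / (eps * h) = (x * h)^-1.
    by rewrite /x; field; rewrite !gt_eqF.
  by move: lnle; rewrite E lnV ?posrE//; lra.
pose tau := T0 * D ^+ 2; pose t := (4 * D)^-1.
pose y := C1 / h * (2 * - ln x + ln 2).
have y0 : 0 <= y.
  by rewrite mulr_ge0 ?divr_ge0//; lra.
pose n := (Num.truncn y).+1.
have h1 : h <= 1 by lra.
have h4 : h <= 4^-1 by lra.
have hd : h ^+ 3 * d%:R <= 1.
  rewrite -D3 hE -exprMn divfK ?gt_eqF// exprn_ile1//; lra.
have htau : h ^+ 2 * tau <= 1.
  have -> : h ^+ 2 * tau = c * (c * T0) by rewrite /tau hE; field; rewrite gt_eqF.
  by rewrite cT; lra.
have tau0 : 0 <= tau by rewrite mulr_ge0 ?exprn_ge0// ltW.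
have t0 : 0 < t by rewrite invr_gt0 mulr_gt0.
have t4 : t <= 4^-1 by rewrite lef_pV2 ?posrE ?mulr_gt0//; lra.
apply: (@le_trans _ _ n%:R%:E).
  apply: mixing_time_le.
  apply: le_trans (tv_dist_mala_law_le h0 h4 hd tau0 htau t0 t4 n wM x0) _.
  rewrite lee_fin; set W := expR _ + _.
  suff Wx : W <= x ^+ 2.
    have -> : eps = M0 * x by rewrite /x mulrC divfK// gt_eqF.
    apply: ler_wpM2l; first exact: ltW.
    have H : W / (2 * x) <= x ^+ 2 / (2 * x) by rewrite ler_pM2r// invr_gt0 mulr_gt0.
    have E : x ^+ 2 / (2 * x) = x / 2 by field; rewrite gt_eqF.
    by move: H; rewrite E; move: (W / _) => w; lra.
  have W1 : expR (- (n%:R * variance_rate h)) <= x ^+ 2 / 2.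
    have -> : x ^+ 2 / 2 = expR (- (2 * - ln x + ln 2)).
      by rewrite mulrN opprD opprK expRD expRN !lnK ?posrE// mulr_natl mulr2n
        expRD lnK ?posrE// expr2.
    rewrite ler_expR lerN2.
    have yn : y < n%:R by exact: truncnS_gt.
    have qE : variance_rate h = h / C1 by [].
    have q0 : 0 < h / C1 by rewrite divr_gt0//; lra.
    have yE : 2 * - ln x + ln 2 = y * (h / C1).
      by rewrite /y mulrAC -(invf_div h C1) mulVf ?mul1r// gt_eqF.
    by rewrite qE yE ler_pM2r// ltW.
  have W2 : variance_error d tau t / variance_rate h <= x ^+ 2 / 2.
    apply: le_trans (bad_error_le (ltW K_gt0) h0 h1 D1 C12 hx).
    rewrite /variance_error /variance_rate -/C1 mulrA -/C2.
    suff -> : 4 * t ^+ 2 * d%:R - t * tau = D / 4 - T0 * D / 4 by [].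
    by rewrite -D3 /t /tau; field; rewrite gt_eqF.
  by rewrite /W; move: W1 W2; move: (expR _) (_ / variance_rate h) => u w; lra.
have ny : n%:R <= y + 1.
  by rewrite /n -natr1 lerD2r truncn_le.
rewrite lee_fin; apply: le_trans ny _.
have -> : (3 * C1 / c + 1) * D * - ln x = C1 / h * (3 * - ln x) + D * - ln x.
  by rewrite hE; move: (ln x) => u; field; rewrite !gt_eqF.
apply: lerD.
  by apply: ler_wpM2l; [rewrite divr_ge0//; lra | move: (ln x) l1 => u; lra].
by rewrite -[leLHS]mulr1; apply: ler_pM.
Qed.
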